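(* Let $\mathbf{k}$ be an algebraically closed field with $\operatorname{char}(\mathbf{k})=p>0$. **(1)** Let $G$ be a $p$-elementary subgroup of the de Jonquières group $\mathrm{J}$. Then $G$ is conjugate in $\mathrm{J}$ to a subgroup of the form $L\times R$, where: - $R$ is a subgroup of $\{\left[\begin{smallmatrix}1&t\\ 0&1\end{smallmatrix}\right]\mid t\in\mathbf{k}\}\subset\mathrm{PGL}(2,\mathbf{k})$; - $L$ is a subgroup of $\{\left[\begin{smallmatrix}1&t\\ 0&1\end{smallmatrix}\right]\mid t\in\mathbf{k}(x)^R\}\subset\mathrm{PGL}(2,\mathbf{k}(x))$, or (if $p=2$) of $\{\left[\begin{smallmatrix}a&bg\\ b&a\end{smallmatrix}\right]\mid a,b\in\mathbf{k}(x)^R,\ a^2+b^2g\neq0\}\subset\mathrm{PGL}(2,\mathbf{k}(x))$, where $g$ is a monic polynomial over $\mathbf{k}$ with simple roots. **(2)** Assume $p=2$. For $t\in\mathbf{k}\setminus\{0,1\}$ define the subgroups of $\mathrm{Aut}(\mathbb{P}^2)=\mathrm{PGL}(3,\mathbf{k})$ $$G_1=\left\langle\left[\begin{smallmatrix}1&0&0\\ 0&1&1\\ 0&0&1\end{smallmatrix}\right],\left[\begin{smallmatrix}1&0&1\\ 0&1&0\\ 0&0&1\end{smallmatrix}\right]\right\rangle,\quad G_2=\left\langle\left[\begin{smallmatrix}1&1&0\\ 0&1&0\\ 0&0&1\end{smallmatrix}\right],\left[\begin{smallmatrix}1&0&1\\ 0&1&0\\ 0&0&1\end{smallmatrix}\right]\right\rangle,\quad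 G_{3,t}=\left\langle\left[\begin{smallmatrix}1&1&0\\ 0&1&0\\ 0&0&1\end{smallmatrix}\right],\left[\begin{smallmatrix}1&t&0\\ 0&1&0\\ 0&0&1\end{smallmatrix}\right]\right\rangle.$$ Every Klein subgroup of $\mathrm{Aut}(\mathbb{P}^2)$ is conjugate in $\mathrm{Aut}(\mathbb{P}^2)$ to $G_1$, to $G_2$ or to $G_{3,t}$ for some $t\in\mathbf{k}\setminus\{0,1\}$. Furthermore, for $t,t'\in\mathbf{k}\setminus\{0,1\}$: - the subgroups $G_1,G_2,G_{3,t}$ are pairwise not conjugate in $\mathrm{Aut}(\mathbb{P}^2)$; - $G_{3,t}$ and $G_{3,t'}$ are conjugate in $\mathrm{Aut}(\mathbb{P}^2)$ if and only if $t'\in\{t,t+1,\frac1t,\frac{t+1}t,\frac1{t+1},\frac t{t+1}\}$; - $G_1$ and $G_{3,t}$ are conjugate by a birational map (of $\mathbb{P}^2$); - $G_1$ and $G_2$ are not conjugate by a birational map (of $\mathbb{P}^2$).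
   Context: A $p$-elementary group is a group isomorphic to $(\mathbb{Z}/p)^r$ for some integer $r\ge0$; a Klein subgroup is a subgroup isomorphic to $(\mathbb{Z}/2)^2$. The de Jonquières group $\mathrm{J}$ is the group of birational maps $(x,y)\dashrightarrow\left(\frac{ax+b}{cx+d},\frac{\alpha(x)y+\beta(x)}{\gamma(x)y+\delta(x)}\right)$ of $\mathbb{A}^2$ with $a,b,c,d\in\mathbf{k}$, $\alpha,\beta,\gamma,\delta\in\mathbf{k}(x)$, $ad-bc\ne0$, $\alpha\delta-\beta\gamma\ne0$. It is the semi-direct product $\mathrm{PGL}(2,\mathbf{k}(x))\rtimes\mathrm{PGL}(2,\mathbf{k})$, where $\left[\begin{smallmatrix}\alpha&\beta\\ \gamma&\delta\end{smallmatrix}\right]$ acts on $y$ and $\left[\begin{smallmatrix}a&b\\ c&d\end{smallmatrix}\right]$ on $x$ by Möbius transformations. $L\times R$ denotes the subgroup $\{(l,r)\mid l\in L,r\in R\}$ of this semi-direct product (a direct product). $\mathrm{PGL}(2,\mathbf{k})$ acts on $\mathbf{k}(x)$ by Möbius transformations of $x$, and $\mathbf{k}(x)^R$ is the subfield of $R$-invariant elements. *)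

(* Defs.v *)
From HB Require Import structures.
From mathcomp Require Import all_boot all_order all_algebra.
From mathcomp Require Import monoid fraction generic_quotient.
From mathcomp Require Import boolp classical_sets.

Set Implicit Arguments.
Unset Strict Implicit.
Unset Printing Implicit Defensive.

Import GRing.Theory.
Local Open Scope classical_set_scope.
Local Open Scope ring_scope.
Local Open Scope quotient_scope.

Section GroupNotions.
Variable G : groupType.
Implicit Types (H J : set G).
Local Open Scope group_scope.

Definition subgroup H : Prop :=
  [/\ H 1, (forall x y, H x -> H y -> H (x * y)) & (forall x, H x -> H x^-1)].

Definition generated (A : set G) : set G := smallest subgroup A.

Definition conjugate_in J H H' : Prop :=
  exists2 g, J g & [set h ^ g | h in H] = H'.

Definition conjugate H H' : Prop := conjugate_in setT H H'.

(* the elements of [H] are the image of an injective morphism from (Z/p)^r;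
   'F_p is Z/p only for prime p *)
Definition elementary_of_rank (p r : nat) H : Prop :=
  subgroup H /\
  exists f : 'rV['F_p]_r -> G,
    [/\ (forall u v, f (u + v)%R = f u * f v), injective f & range f = H].

Definition elementary (p : nat) H : Prop :=
  exists r, elementary_of_rank p r H.

Definition klein H : Prop := elementary_of_rank 2 2 H.

End GroupNotions.

Section ProjectiveLinearGroup.
Variables (n : nat) (F : fieldType).

Record GL := MkGL { glval :> 'M[F]_n; glvalP : glval \in unitmx }.
HB.instance Definition _ := [isSub for glval].
HB.instance Definition _ := [Choice of GL by <:].

Definition GL1 : GL := MkGL (unitmx1 F n).

Definition proportional (A B : GL) : bool :=
  `[< exists2 c : F, c != 0 & glval A = c *: glval B >].

Lemma proportional_equiv : equiv_class_of proportional.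
Proof.
split=> [A|A B|B A C].
- by apply/asboolP; exists 1; rewrite ?oner_eq0 ?scale1r.
- apply/asboolP/asboolP => -[c c0 e]; exists c^-1; rewrite ?invr_eq0 // e.
    by rewrite scalerA mulVf ?scale1r.
  by rewrite scalerA mulVf ?scale1r.
- move=> /asboolP[c c0 eA] /asboolP[d d0 eB]; apply/asboolP.
  by exists (c * d); rewrite ?mulf_neq0 // eA eB scalerA.
Qed.

Canonical proportional_rel := EquivRelPack proportional_equiv.

Definition PGL := {eq_quot proportional}.
HB.instance Definition _ : EqQuotient _ proportional PGL := EqQuotient.on PGL.
HB.instance Definition _ := Choice.on PGL.

Lemma PGL_eqP (A B : GL) :
  reflect (exists2 c : F, c != 0 & glval A = c *: glval B)
          (\pi_PGL A == \pi_PGL B).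
Proof. by rewrite eqmodE; apply: asboolP. Qed.

Lemma PGL_reprP (A : GL) :
  exists2 c : F, c != 0 & glval (repr (\pi_PGL A)) = c *: glval A.
Proof. by apply/PGL_eqP; rewrite reprK. Qed.

Fact glmul_subproof (A B : GL) : glval A *m glval B \in unitmx.
Proof. by rewrite unitmx_mul !glvalP. Qed.
Fact glinv_subproof (A : GL) : invmx (glval A) \in unitmx.
Proof. by rewrite unitmx_inv glvalP. Qed.

Definition pgl_mul (u v : PGL) : PGL :=
  \pi_PGL (MkGL (glmul_subproof (repr u) (repr v))).
Definition pgl_inv (u : PGL) : PGL := \pi_PGL (MkGL (glinv_subproof (repr u))).
Definition pgl_one : PGL := \pi_PGL GL1.

Fact pgl_mulA : associative pgl_mul.
Proof.
move=> u v w; apply/eqP/PGL_eqP => /=.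
have [c c0 ->] := PGL_reprP (MkGL (glmul_subproof (repr v) (repr w))).
have [d d0 ->] := PGL_reprP (MkGL (glmul_subproof (repr u) (repr v))).
exists (c / d); first by rewrite mulf_neq0 ?invr_eq0.
by rewrite /= -scalemxAr -scalemxAl scalerA divfK // mulmxA.
Qed.

Fact pgl_mul1g : left_id pgl_one pgl_mul.
Proof.
move=> u; rewrite -[RHS]reprK; apply/eqP/PGL_eqP => /=.
have [c c0 ->] := PGL_reprP GL1.
by exists c; rewrite //= -scalemxAl mul1mx.
Qed.

Fact pgl_mulg1 : right_id pgl_one pgl_mul.
Proof.
move=> u; rewrite -[RHS]reprK; apply/eqP/PGL_eqP => /=.
have [c c0 ->] := PGL_reprP GL1.
by exists c; rewrite //= -scalemxAr mulmx1.
Qed.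

Fact pgl_mulVg : left_inverse pgl_one pgl_inv pgl_mul.
Proof.
move=> u; apply/eqP/PGL_eqP => /=.
have [c c0 ->] := PGL_reprP (MkGL (glinv_subproof (repr u))).
by exists c; rewrite //= -scalemxAl mulVmx ?glvalP.
Qed.

Fact pgl_mulgV : right_inverse pgl_one pgl_inv pgl_mul.
Proof.
move=> u; apply/eqP/PGL_eqP => /=.
have [c c0 ->] := PGL_reprP (MkGL (glinv_subproof (repr u))).
by exists c; rewrite //= -scalemxAr mulmxV ?glvalP.
Qed.

HB.instance Definition _ :=
  isGroup.Build PGL pgl_mulA pgl_mul1g pgl_mulg1 pgl_mulVg pgl_mulgV.

(* the class of [A]; a junk value (the identity) if [A] is not invertible *)
Definition pgl (A : 'M[F]_n) : PGL := \pi_PGL (insubd GL1 A).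

Definition mx_of_rows (s : seq (seq F)) : 'M[F]_n :=
  \matrix_(i, j) (nth [::] s i)`_j.

End ProjectiveLinearGroup.

Section Substitution.
Variables (R : idomainType) (L : fieldType).

(* The extension of [e] to fractions.  It does not depend on the chosen
   numerator and denominator when [e] is injective, see [fracmapE]. *)
Definition fracmap (e : R -> L) (f : {fraction R}) : L :=
  e \n_(repr f) / e \d_(repr f).

Lemma fracE (f : {fraction R}) :
  f = tofrac \n_(repr f) / tofrac \d_(repr f).
Proof.
have d0 : tofrac \d_(repr f) != 0 by rewrite tofrac_eq0 denom_ratioP.
apply: (mulIf d0); rewrite divfK //.
rewrite -{1}[f]reprK /tofrac; unlock.
rewrite -[LHS]FracField.pi_mul; apply/eqmodP => /=.
rewrite FracField.equivfE /FracField.mulf.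
by rewrite !numden_Ratio ?mulf_neq0 ?oner_eq0 ?denom_ratioP // !mulr1 mulrC.
Qed.

Variable e : {rmorphism R -> L}.
Hypothesis e_inj : forall a, e a = 0 -> a = 0.

Lemma fracmapE (a b : R) : b != 0 ->
  fracmap e (tofrac a / tofrac b) = e a / e b.
Proof.
move=> b0; set f := _ / _; rewrite /fracmap.
have nz c : c != 0 -> e c != 0 by apply: contra_neq; apply: e_inj.
have d0 := denom_ratioP (repr f).
have := fracE f; rewrite {1}/f => /eqP; rewrite eqr_div ?tofrac_eq0 //.
rewrite -!tofracM tofrac_eq => /eqP /(congr1 e); rewrite !rmorphM => h.
by apply/eqP; rewrite eqr_div ?nz // h.
Qed.

Lemma fracmap_tofrac a : fracmap e (tofrac a) = e a.
Proof.
by rewrite -[tofrac a]divr1 -tofrac1 fracmapE ?oner_eq0 // rmorph1 divr1.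
Qed.

Lemma fracmap_zmod : zmod_morphism (fracmap e).
Proof.
move=> f g; rewrite (fracE f) (fracE g).
have nz c : c != 0 -> e c != 0 by apply: contra_neq; apply: e_inj.
have df := denom_ratioP (repr f); have dg := denom_ratioP (repr g).
move: (\n_(repr f)) (\d_(repr f)) (\n_(repr g)) (\d_(repr g)) df dg.
move=> a b c d b0 d0.
rewrite -mulNr -tofracN addf_div ?tofrac_eq0 // -!tofracM -tofracD.
rewrite !fracmapE ?mulf_neq0 // -mulNr addf_div ?nz //.
by rewrite rmorphD !rmorphM rmorphN.
Qed.

Lemma fracmap_monoid : GRing.monoid_morphism (fracmap e).
Proof.
split=> [|f g]; first by rewrite -tofrac1 fracmap_tofrac rmorph1.
rewrite (fracE f) (fracE g).
have df := denom_ratioP (repr f); have dg := denom_ratioP (repr g).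
move: (\n_(repr f)) (\d_(repr f)) (\n_(repr g)) (\d_(repr g)) df dg.
move=> a b c d b0 d0.
rewrite mulf_div -!tofracM !fracmapE ?mulf_neq0 // !rmorphM /=.
by rewrite mulf_div.
Qed.

End Substitution.

Section Evaluation.
Variables (k : fieldType) (L : fieldType) (c : {rmorphism k -> L}).

(* p(t) for p in k[x], and p(u, v) for p in k[x][y] *)
Definition at1 (t : L) : {poly k} -> L := horner_eval t \o map_poly c.
HB.instance Definition _ t :=
  GRing.RMorphism.copy (at1 t) (horner_eval t \o map_poly c).

Definition at2 (u v : L) : {poly {poly k}} -> L :=
  horner_eval v \o map_poly (at1 u).
HB.instance Definition _ u v :=
  GRing.RMorphism.copy (at2 u v) (horner_eval v \o map_poly (at1 u)).

Lemma at1C t a : at1 t a%:P = c a.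
Proof. by rewrite /at1 /= map_polyC /horner_eval hornerC. Qed.
Lemma at1X t : at1 t 'X = t.
Proof. by rewrite /at1 /= map_polyX /horner_eval hornerX. Qed.
Lemma at2C u v p : at2 u v p%:P = at1 u p.
Proof. by rewrite /at2 /= map_polyC /horner_eval hornerC. Qed.
Lemma at2X u v : at2 u v 'X = v.
Proof. by rewrite /at2 /= map_polyX /horner_eval hornerX. Qed.

End Evaluation.

(* [takes_value e f z]: the fraction f has value z under e, for some
   representation of f whose denominator does not vanish under e *)
Section TakesValue.
Variables (R : idomainType) (L : fieldType) (e : {rmorphism R -> L}).

Definition takes_value (f : {fraction R}) (z : L) : Prop :=
  exists a b, [/\ f = tofrac a / tofrac b, e b != 0 & z = e a / e b].

Let nz b : e b != 0 -> tofrac b != 0.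
Proof. by rewrite tofrac_eq0; apply: contra_neq => ->; rewrite rmorph0. Qed.

Lemma takes_value_tofrac a : takes_value (tofrac a) (e a).
Proof.
by exists a, 1; split; rewrite ?tofrac1 ?rmorph1 ?divr1 ?oner_eq0.
Qed.

Lemma takes_valueD f g y z :
  takes_value f y -> takes_value g z -> takes_value (f + g) (y + z).
Proof.
move=> [a [b [-> b0 ->]]] [a' [b' [-> b0' ->]]].
exists (a * b' + a' * b), (b * b'); split.
- by rewrite addf_div ?nz // !(tofracM, tofracD).
- by rewrite rmorphM mulf_neq0.
- by rewrite addf_div // !(rmorphM, rmorphD).
Qed.

Lemma takes_valueM f g y z :
  takes_value f y -> takes_value g z -> takes_value (f * g) (y * z).
Proof.
move=> [a [b [-> b0 ->]]] [a' [b' [-> b0' ->]]].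
exists (a * a'), (b * b'); split.
- by rewrite mulf_div !tofracM.
- by rewrite rmorphM mulf_neq0.
- by rewrite mulf_div !rmorphM.
Qed.

Lemma takes_valueV f z : z != 0 -> takes_value f z -> takes_value f^-1 z^-1.
Proof.
move=> z0 [a [b [ef b0 ez]]]; exists b, a; split.
- by rewrite ef invf_div.
- by apply: contra_neq z0; rewrite ez => ->; rewrite mul0r.
- by rewrite ez invf_div.
Qed.

Lemma takes_value_div f g y z : z != 0 ->
  takes_value f y -> takes_value g z -> takes_value (f / g) (y / z).
Proof. by move=> z0 fy gz; apply: takes_valueM => //; apply: takes_valueV. Qed.

Lemma takes_value0 z : takes_value 0 z -> z = 0.
Proof.
move=> [a [b [e0 b0 ->]]]; have b1 := nz b0.
move/esym/eqP: e0; rewrite mulf_eq0 invr_eq0 (negPf b1) orbF tofrac_eq0.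
by move=> /eqP->; rewrite rmorph0 mul0r.
Qed.

Lemma takes_value_fracmap f z : (forall a, e a = 0 -> a = 0) ->
  takes_value f z -> fracmap e f = z.
Proof.
move=> e_inj [a [b [-> b0 ->]]]; apply: fracmapE => //.
by apply: contra_neq b0 => ->; rewrite rmorph0.
Qed.

Variables (k : fieldType) (c : {rmorphism k -> {fraction R}}).
Variable c' : {rmorphism k -> L}.
Hypothesis cc' : forall a, takes_value (c a) (c' a).

Lemma takes_value_at1 t t' p : takes_value t t' ->
  takes_value (at1 c t p) (at1 c' t' p).
Proof.
move=> tt'; elim/poly_ind: p => [|p a IH].
  by rewrite !rmorph0 -tofrac0 -(rmorph0 e); apply: takes_value_tofrac.
rewrite !rmorphD !rmorphM /= !at1C !at1X.
by apply: takes_valueD => //; apply: takes_valueM.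
Qed.

Lemma takes_value_at2 u u' v v' p : takes_value u u' -> takes_value v v' ->
  takes_value (at2 c u v p) (at2 c' u' v' p).
Proof.
move=> uu' vv'; elim/poly_ind: p => [|p a IH].
  by rewrite !rmorph0 -tofrac0 -(rmorph0 e); apply: takes_value_tofrac.
rewrite !rmorphD !rmorphM /= !at2C !at2X.
by apply: takes_valueD; [apply: takes_valueM|apply: takes_value_at1].
Qed.

Lemma takes_value_fracmap1 t t' (f : {fraction {poly k}}) :
    (forall p, at1 c' t' p = 0 -> p = 0) -> takes_value t t' ->
  takes_value (fracmap (at1 c t) f) (fracmap (at1 c' t') f).
Proof.
move=> inj tt'; apply: takes_value_div; try exact: takes_value_at1.
by apply: contra_neq (denom_ratioP (repr f)); apply: inj.
Qed.

End TakesValue.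

Definition mobius (F L : fieldType) (c : F -> L) (A : 'M[F]_2) (t : L) : L :=
  (c (A 0 0) * t + c (A 0 1)) / (c (A 1 0) * t + c (A 1 1)).

Section MobiusTheory.
Variables (F L : fieldType) (c : {rmorphism F -> L}).
Implicit Types A B : 'M[F]_2.

Definition mden A (t : L) := c (A 1 0) * t + c (A 1 1).
Definition mnum A (t : L) := c (A 0 0) * t + c (A 0 1).

Lemma mden_comp A B t : mden B t != 0 ->
  mden A (mobius c B t) = mden (A *m B) t / mden B t.
Proof.
move=> d0; apply: (mulIf d0); rewrite divfK // /mobius -/(mden B t) /mden.
rewrite !mxE !big_ord_recl !big_ord0 !addr0 !rmorphD !rmorphM /=.
rewrite -/(mden B t) mulrDl -mulrA divfK //= /mden.
have -> : lift ord0 ord0 = 1 :> 'I_2 by apply/val_inj.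
by rewrite /= !(mulrDr, mulrDl, mulrA) addrACA.
Qed.

Lemma mnum_comp A B t : mden B t != 0 ->
  mnum A (mobius c B t) = mnum (A *m B) t / mden B t.
Proof.
move=> d0; apply: (mulIf d0); rewrite divfK // /mobius -/(mden B t) /mnum.
rewrite !mxE !big_ord_recl !big_ord0 !addr0 !rmorphD !rmorphM /=.
rewrite -/(mden B t) mulrDl -mulrA divfK //= /mden.
have -> : lift ord0 ord0 = 1 :> 'I_2 by apply/val_inj.
by rewrite /= !(mulrDr, mulrDl, mulrA) addrACA.
Qed.

Lemma mobius_comp A B t : mden B t != 0 ->
  mobius c A (mobius c B t) = mobius c (A *m B) t.
Proof.
move=> d0; rewrite {1}/mobius -/(mden _ _) -/(mnum _ _) mden_comp // mnum_comp //.
by rewrite invf_div mulrA divfK.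
Qed.

Lemma mobius1 t : mobius c 1%:M t = t.
Proof. by rewrite /mobius !mxE /= rmorph1 rmorph0 !mul0r mul1r addr0 add0r divr1. Qed.

Lemma mobiusZ a A t : a != 0 -> mobius c (a *: A) t = mobius c A t.
Proof.
move=> a0; rewrite /mobius !mxE !rmorphM -!mulrA -!mulrDr.
by rewrite -mulf_div divff ?fmorph_eq0 // mul1r.
Qed.

Definition nondegenerate (t : L) := forall a b, c a * t + c b = 0 -> a = 0 /\ b = 0.

Lemma mden_neq0 A t : nondegenerate t -> A \in unitmx -> mden A t != 0.
Proof.
move=> nt uA; apply/eqP => /nt [a0 b0]; have : row 1 A = 0.
  apply/rowP => j; rewrite !mxE; case: j => -[|[|//]] lj.
  - by rewrite -[RHS]a0; congr (A _ _); apply: val_inj.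
  - by rewrite -[RHS]b0; congr (A _ _); apply: val_inj.
move=> r0; have : row 1 (A *m invmx A) = 0 by rewrite row_mul r0 mul0mx.
rewrite mulmxV // => /rowP /(_ 1); rewrite !mxE eqxx => /eqP.
by rewrite oner_eq0.
Qed.

End MobiusTheory.

Lemma takes_value_mobius (R : idomainType) (L F F' : fieldType)
    (e : {rmorphism R -> L}) (c : F -> {fraction R}) (c' : {rmorphism F' -> L})
    (A : 'M[F]_2) (A' B : 'M[F']_2) t s :
    (forall i j, takes_value e (c (A i j)) (c' (A' i j))) ->
    A' \in unitmx -> B \in unitmx -> nondegenerate c' s ->
    takes_value e t (mobius c' B s) ->
  takes_value e (mobius c A t) (mobius c' (A' *m B) s).
Proof.
move=> cA uA uB ns ts; rewrite -mobius_comp ?mden_neq0 //.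
apply: takes_value_div.
- rewrite -/(mden _ _ _) mden_comp ?mden_neq0 // mulf_neq0 ?invr_eq0 //.
    by rewrite mden_neq0 // unitmx_mul uA.
  by rewrite mden_neq0.
- by apply: takes_valueD => //; apply: takes_valueM.
- by apply: takes_valueD => //; apply: takes_valueM.
Qed.

Lemma map_mx_unit (F L : fieldType) (f : {rmorphism F -> L}) n (A : 'M[F]_n) :
  A \in unitmx -> map_mx f A \in unitmx.
Proof. by rewrite map_unitmx. Qed.

Lemma takes_value_mulmx (R : idomainType) (L k : fieldType)
    (e : {rmorphism R -> L}) (c : k -> {fraction R}) (c' : k -> L) n
    (A : 'M[k]_n) (u : 'cV[{fraction R}]_n) (u' : 'cV[L]_n) :
    (forall a, takes_value e (c a) (c' a)) ->
    (forall i, takes_value e (u i 0) (u' i 0)) ->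
  forall i, takes_value e ((map_mx c A *m u) i 0) ((map_mx c' A *m u') i 0).
Proof.
move=> ec eu i; rewrite !mxE; apply: (big_ind2 (takes_value e)).
- by rewrite -(rmorph0 e) -tofrac0; apply: takes_value_tofrac.
- by move=> f f' g g'; apply: takes_valueD.
- by move=> j _; rewrite !mxE; apply: takes_valueM.
Qed.

Lemma scale_div (L : fieldType) n (a : L) (u : 'cV[L]_n) i j :
  a != 0 -> (a *: u) i 0 / (a *: u) j 0 = u i 0 / u j 0.
Proof. by move=> a0; rewrite !mxE -mulf_div divff ?mul1r. Qed.

Lemma scale_neq0 (L : fieldType) n (a : L) (u : 'cV[L]_n) i :
  a != 0 -> u i 0 != 0 -> (a *: u) i 0 != 0.
Proof. by move=> a0 u0; rewrite !mxE mulf_neq0. Qed.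

Section Cremona.
Variable k : fieldType.
Local Notation kx := {fraction {poly k}}.
Local Notation kxy := {fraction {poly {poly k}}}.

Definition kx_cst : k -> kx := @tofrac _ \o polyC.
HB.instance Definition _ := GRing.RMorphism.copy kx_cst (@tofrac _ \o polyC).

Definition kxy_cst : k -> kxy := @tofrac _ \o polyC \o polyC.
HB.instance Definition _ :=
  GRing.RMorphism.copy kxy_cst (@tofrac _ \o polyC \o polyC).

Definition kx_x : kx := tofrac 'X.
Definition kxy_x : kxy := tofrac 'X%:P.
Definition kxy_y : kxy := tofrac 'X.

Lemma at1_kx p : at1 kx_cst kx_x p = tofrac p.
Proof.
elim/poly_ind: p => [|p a IH]; first by rewrite !rmorph0.
by rewrite !rmorphD !rmorphM /= at1C at1X IH.
Qed.

Lemma at1_kxy p : at1 kxy_cst kxy_x p = tofrac p%:P.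
Proof.
elim/poly_ind: p => [|p a IH]; first by rewrite !rmorph0.
by rewrite !rmorphD !rmorphM /= at1C at1X IH.
Qed.

Lemma at2_kxy p : at2 kxy_cst kxy_x kxy_y p = tofrac p.
Proof.
elim/poly_ind: p => [|p a IH]; first by rewrite !rmorph0.
by rewrite !rmorphD !rmorphM /= at2C at2X IH at1_kxy.
Qed.

(* f(t), for f in k(x) and t in k(x) or k(x, y) *)
Definition kx_subst (L : fieldType) (c : {rmorphism k -> L}) (t : L) : kx -> L :=
  fracmap (at1 c t).

Definition kx_kxy : kx -> kxy := kx_subst kxy_cst kxy_x.

(* A pair (f, g) stands for the rational map (x, y) -> (f(x, y), g(x, y)) of the
   affine plane.  It is dominant iff f and g are algebraically independent, and
   then [kxy_subst v h] is h(f, g). *)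
Definition dominant (v : kxy * kxy) : Prop :=
  forall P : {poly {poly k}}, at2 kxy_cst v.1 v.2 P = 0 -> P = 0.

Definition kxy_subst (v : kxy * kxy) : kxy -> kxy :=
  fracmap (at2 kxy_cst v.1 v.2).

Definition ratmap_comp (v w : kxy * kxy) : kxy * kxy :=
  (kxy_subst w v.1, kxy_subst w v.2).

Definition ratmap_id : kxy * kxy := (kxy_x, kxy_y).

Definition birational (v : kxy * kxy) : Prop :=
  dominant v /\
  exists w, [/\ dominant w, ratmap_comp v w = ratmap_id
                          & ratmap_comp w v = ratmap_id].

Lemma dominant_id : dominant ratmap_id.
Proof. by move=> P /=; rewrite at2_kxy => /eqP; rewrite tofrac_eq0 => /eqP. Qed.

Section Dominant.
Variables (w : kxy * kxy) (dw : dominant w).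

Let e_inj : forall P, at2 kxy_cst w.1 w.2 P = 0 -> P = 0 := dw.

HB.instance Definition _ :=
  GRing.isZmodMorphism.Build kxy kxy (kxy_subst w) (fracmap_zmod e_inj).
HB.instance Definition _ :=
  GRing.isMonoidMorphism.Build kxy kxy (kxy_subst w) (fracmap_monoid e_inj).

Let s : {rmorphism kxy -> kxy} := kxy_subst w.

Lemma kxy_subst_cst a : kxy_subst w (kxy_cst a) = kxy_cst a.
Proof. by rewrite /kxy_subst fracmap_tofrac //= at2C at1C. Qed.

Lemma kxy_subst_at1 t p :
  kxy_subst w (at1 kxy_cst t p) = at1 kxy_cst (kxy_subst w t) p.
Proof.
rewrite -/s; elim/poly_ind: p => [|p a IH]; first by rewrite !rmorph0.
by rewrite !rmorphD !rmorphM /= !at1C !at1X IH /= kxy_subst_cst.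
Qed.

Lemma kxy_subst_at2 v P :
  kxy_subst w (at2 kxy_cst v.1 v.2 P) =
  at2 kxy_cst (ratmap_comp v w).1 (ratmap_comp v w).2 P.
Proof.
rewrite -/s; elim/poly_ind: P => [|P a IH]; first by rewrite !rmorph0.
by rewrite !rmorphD !rmorphM /= !at2C !at2X IH /= kxy_subst_at1.
Qed.

Lemma dominant_comp v : dominant v -> dominant (ratmap_comp v w).
Proof.
move=> dv P; rewrite -kxy_subst_at2 -/s => /eqP.
by rewrite fmorph_eq0 => /eqP /dv.
Qed.

Lemma kxy_subst_comp v f : dominant v ->
  kxy_subst w (kxy_subst v f) = kxy_subst (ratmap_comp v w) f.
Proof.
move=> dv; rewrite {2}/kxy_subst /fracmap -/s.
by rewrite fmorph_div /= !kxy_subst_at2.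
Qed.

Lemma ratmap_compA u v : dominant v ->
  ratmap_comp u (ratmap_comp v w) = ratmap_comp (ratmap_comp u v) w.
Proof.
by move=> dv; rewrite /ratmap_comp /= !(kxy_subst_comp _ dv).
Qed.

Lemma ratmap_comp1l : ratmap_comp ratmap_id w = w.
Proof.
case: (w) e_inj => f g inj; rewrite /ratmap_comp /kxy_subst /=.
by rewrite !fracmap_tofrac //= at2X at2C at1X.
Qed.

End Dominant.

Lemma ratmap_comp1r w : ratmap_comp w ratmap_id = w.
Proof.
case: w => f g; rewrite /ratmap_comp /kxy_subst /fracmap /=.
by rewrite !at2_kxy -!fracE.
Qed.

Lemma birational_id : birational ratmap_id.
Proof.
split; first exact: dominant_id; exists ratmap_id.
by rewrite ratmap_comp1r; split=> //; apply: dominant_id.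
Qed.

Lemma birational_comp v w :
  birational v -> birational w -> birational (ratmap_comp v w).
Proof.
move=> [dv [v' [dv' vv' v'v]]] [dw [w' [dw' ww' w'w]]].
split; first exact: dominant_comp.
exists (ratmap_comp w' v'); split; first exact: dominant_comp.
- rewrite ratmap_compA // -(ratmap_compA dw' _ dw) ww'.
  by rewrite ratmap_comp1r.
- rewrite ratmap_compA // -(ratmap_compA dv _ dv') v'v.
  by rewrite ratmap_comp1r.
Qed.

(* The group of birational maps of the affine plane, which is also the group of
   birational maps of the projective plane. *)
Record Cr := MkCr { crval :> kxy * kxy; crvalP : `[< birational crval >] }.
HB.instance Definition _ := [isSub for crval].
HB.instance Definition _ := [Choice of Cr by <:].

Lemma Cr_birational (v : Cr) : birational (crval v).
Proof. exact/asboolP/crvalP. Qed.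

Lemma Cr_dominant (v : Cr) : dominant (crval v).
Proof. by case: (Cr_birational v). Qed.

Fact cr_inv_subproof (v : Cr) :
  exists w : Cr, ratmap_comp (crval v) (crval w) = ratmap_id /\
                 ratmap_comp (crval w) (crval v) = ratmap_id.
Proof.
have [dv [w [dw vw wv]]] := Cr_birational v.
have bw : birational w by split=> //; exists (crval v).
by exists (MkCr (asboolT bw)).
Qed.

Definition cr_one : Cr := MkCr (asboolT birational_id).
Definition cr_mul (v w : Cr) : Cr :=
  MkCr (asboolT (birational_comp (Cr_birational v) (Cr_birational w))).
Definition cr_inv (v : Cr) : Cr := sval (cid (cr_inv_subproof v)).

Fact cr_mulA : associative cr_mul.
Proof.
by move=> u v w; apply: val_inj; apply: ratmap_compA; apply: Cr_dominant.
Qed.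
Fact cr_mul1g : left_id cr_one cr_mul.
Proof. by move=> v; apply: val_inj; apply/ratmap_comp1l/Cr_dominant. Qed.
Fact cr_mulg1 : right_id cr_one cr_mul.
Proof. by move=> v; apply: val_inj; apply: ratmap_comp1r. Qed.
Fact cr_mulVg : left_inverse cr_one cr_inv cr_mul.
Proof. by move=> v; apply: val_inj; rewrite /= /cr_inv; case: cid => w []. Qed.
Fact cr_mulgV : right_inverse cr_one cr_inv cr_mul.
Proof. by move=> v; apply: val_inj; rewrite /= /cr_inv; case: cid => w []. Qed.

HB.instance Definition _ :=
  isGroup.Build Cr cr_mulA cr_mul1g cr_mulg1 cr_mulVg cr_mulgV.

Section DeJonquieres.

Lemma kx_x_nondegenerate : nondegenerate kx_cst kx_x.
Proof.
move=> a b; rewrite /kx_cst /kx_x /= -tofracM -tofracD => /eqP.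
rewrite tofrac_eq0 => /eqP e.
have := congr1 (coefp 1) e; have := congr1 (coefp 0) e.
by rewrite /= !(coefD, coefMX, coefC) /= add0r addr0.
Qed.

Lemma kxy_x_nondegenerate : nondegenerate kxy_cst kxy_x.
Proof.
move=> a b; rewrite /kxy_cst /kxy_x /= -tofracM -tofracD -polyCM -polyCD => /eqP.
rewrite tofrac_eq0 polyC_eq0 => /eqP e.
have := congr1 (coefp 1) e; have := congr1 (coefp 0) e.
by rewrite /= !(coefD, coefMX, coefC) /= add0r addr0.
Qed.

Lemma kxy_cst_at1_inj p : at1 kxy_cst kxy_x p = 0 -> p = 0.
Proof.
by rewrite at1_kxy => /eqP; rewrite tofrac_eq0 polyC_eq0 => /eqP.
Qed.

HB.instance Definition _ :=
  GRing.isZmodMorphism.Build kx kxy kx_kxy (fracmap_zmod kxy_cst_at1_inj).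
HB.instance Definition _ :=
  GRing.isMonoidMorphism.Build kx kxy kx_kxy (fracmap_monoid kxy_cst_at1_inj).

Lemma kx_kxy_tofrac p : kx_kxy (tofrac p) = tofrac p%:P.
Proof.
rewrite /kx_kxy /kx_subst fracmap_tofrac; first by rewrite /= at1_kxy.
exact: kxy_cst_at1_inj.
Qed.

Lemma kx_kxy_frac n d :
  kx_kxy (tofrac n / tofrac d) = tofrac n%:P / tofrac d%:P.
Proof. by rewrite fmorph_div /= !kx_kxy_tofrac. Qed.

Lemma kxy_y_nondegenerate : nondegenerate kx_kxy kxy_y.
Proof.
move=> a b /=; rewrite (fracE a) (fracE b) !kx_kxy_frac /kxy_y.
move: (denom_ratioP (repr a)) (denom_ratioP (repr b)).
move: (\n_(repr a)) (\d_(repr a)) (\n_(repr b)) (\d_(repr b)) => n d m e d0 e0.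
have d1 : tofrac d%:P != 0 :> kxy by rewrite tofrac_eq0 polyC_eq0.
have e1 : tofrac e%:P != 0 :> kxy by rewrite tofrac_eq0 polyC_eq0.
move=> h; have {}h : n%:P * 'X * e%:P + m%:P * d%:P = 0.
  apply/eqP; rewrite -tofrac_eq0 tofracD !tofracM.
  have -> : 0 = (0 : kxy) * (tofrac d%:P * tofrac e%:P) by rewrite mul0r.
  rewrite -h mulrDl; apply/eqP; congr (_ + _).
    move: (tofrac n%:P) (tofrac d%:P) (tofrac e%:P) (tofrac 'X) d1 => N D E Y d1.
    by rewrite mulrA [N / D * Y]mulrAC divfK.
  by rewrite [tofrac d%:P * _]mulrC mulrA divfK.
have := congr1 (coefp 1) h; have := congr1 (coefp 0) h.
rewrite /= !(coefD, coefMC, coefMX, coefCM, coefC) /= !(mulr0, mul0r, add0r, addr0).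
move=> /eqP; rewrite mulf_eq0 (negPf d0) orbF => /eqP ->.
by move=> /eqP; rewrite mulf_eq0 (negPf e0) orbF => /eqP ->; rewrite tofrac0 !mul0r.
Qed.

(* B acts on k(x) by f |-> f(B x) *)
Definition mobius_kx (B : 'M[k]_2) : kx -> kx :=
  kx_subst kx_cst (mobius kx_cst B kx_x).


Section MobiusKx.
Variables (B : 'M[k]_2) (uB : B \in unitmx).

Lemma mobius_kx_inj p : at1 kx_cst (mobius kx_cst B kx_x) p = 0 -> p = 0.
Proof.
move=> p0; pose w := mobius kx_cst (invmx B) kx_x.
have ui : invmx B \in unitmx by rewrite unitmx_inv.
pose e : {rmorphism {poly k} -> kx} := at1 kx_cst w.
have ec a : takes_value e (kx_cst a) (kx_cst a).
  by have := takes_value_tofrac e a%:P; rewrite /= at1C.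
have ex : takes_value e kx_x w.
  by have := takes_value_tofrac e 'X; rewrite /= at1X.
have ev : takes_value e (mobius kx_cst B kx_x) kx_x.
  rewrite -[X in takes_value _ _ X](mobius1 kx_cst) -(mulmxV uB).
  by apply: takes_value_mobius => //; apply: kx_x_nondegenerate.
have := takes_value_at1 ec p ev.
rewrite p0 at1_kx => /takes_value0 /eqP.
by rewrite tofrac_eq0 => /eqP.
Qed.

HB.instance Definition _ :=
  GRing.isZmodMorphism.Build kx kx (mobius_kx B) (fracmap_zmod mobius_kx_inj).
HB.instance Definition _ :=
  GRing.isMonoidMorphism.Build kx kx (mobius_kx B) (fracmap_monoid mobius_kx_inj).

Definition mobius_kx_rmorphism : {rmorphism kx -> kx} := mobius_kx B.

Lemma map_mobius_kx_unit (A : 'M[kx]_2) :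
  A \in unitmx -> map_mx (mobius_kx B) A \in unitmx.
Proof. by move=> uA; have h := map_mx_unit mobius_kx_rmorphism uA; exact: h. Qed.

Lemma kx_kxy_cst a : kx_kxy (kx_cst a) = kxy_cst a.
Proof. by rewrite /kx_cst /= kx_kxy_tofrac. Qed.

Lemma kx_kxy_at1 t p : kx_kxy (at1 kx_cst t p) = at1 kxy_cst (kx_kxy t) p.
Proof.
elim/poly_ind: p => [|p a IH]; first by rewrite !rmorph0.
by rewrite !rmorphD !rmorphM /= !at1C !at1X IH kx_kxy_cst.
Qed.

Lemma kx_kxy_mobius : kx_kxy (mobius kx_cst B kx_x) = mobius kxy_cst B kxy_x.
Proof.
rewrite /mobius fmorph_div /= !rmorphD !rmorphM /= !kx_kxy_cst.
by rewrite /kx_x kx_kxy_tofrac.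
Qed.

Lemma mobius_kxy_inj p : at1 kxy_cst (mobius kxy_cst B kxy_x) p = 0 -> p = 0.
Proof.
rewrite -kx_kxy_mobius -kx_kxy_at1 => /eqP; rewrite fmorph_eq0 => /eqP.
exact: mobius_kx_inj.
Qed.

Lemma kx_kxy_mobius_kx f :
  kx_kxy (mobius_kx B f) = kx_subst kxy_cst (mobius kxy_cst B kxy_x) f.
Proof.
by rewrite /mobius_kx /kx_subst /fracmap fmorph_div /= !kx_kxy_at1 kx_kxy_mobius.
Qed.

End MobiusKx.

(* (x, y) -> (B x, A(x) y) *)
Definition dJ_map (A : 'M[kx]_2) (B : 'M[k]_2) : kxy * kxy :=
  (mobius kxy_cst B kxy_x, mobius kx_kxy A kxy_y).

Definition evalp (w : kxy * kxy) : {rmorphism {poly {poly k}} -> kxy} :=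
  at2 kxy_cst w.1 w.2.

Lemma dJ_map_comp A A' B B' :
    A \in unitmx -> A' \in unitmx -> B \in unitmx -> B' \in unitmx ->
  let v := dJ_map A B in let w := dJ_map A' B' in
  let u := dJ_map (map_mx (mobius_kx B') A *m A') (B *m B') in
  takes_value (evalp w) v.1 u.1 /\
  takes_value (evalp w) v.2 u.2.
Proof.
move=> uA uA' uB uB' v w u.
set e := evalp w.
have ec a : takes_value e (kxy_cst a) (kxy_cst a).
  by have := takes_value_tofrac e a%:P%:P; rewrite /= at2C at1C.
have ex : takes_value e kxy_x w.1.
  by have := takes_value_tofrac e 'X%:P; rewrite /= at2C at1X.
have ey : takes_value e kxy_y w.2.
  by have := takes_value_tofrac e 'X; rewrite /= at2X.
split.
  by apply: takes_value_mobius => //; apply: kxy_x_nondegenerate.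
have uA2 : map_mx (mobius_kx B') A \in unitmx.
  exact (map_mobius_kx_unit uB' uA).
have cA i j : takes_value e (kx_kxy (A i j)) (kx_kxy (map_mx (mobius_kx B') A i j)).
  rewrite mxE kx_kxy_mobius_kx //.
  by apply: takes_value_fracmap1 => //; apply: mobius_kxy_inj.
exact (takes_value_mobius cA uA2 uA' kxy_y_nondegenerate ey).
Qed.

Lemma dJ_map1 : dJ_map 1%:M 1%:M = ratmap_id.
Proof. by rewrite /dJ_map (mobius1 kxy_cst) (mobius1 kx_kxy). Qed.

End DeJonquieres.

Lemma takes_value_dominant v w :
    takes_value (evalp w) v.1 kxy_x ->
    takes_value (evalp w) v.2 kxy_y ->
  dominant v.
Proof.
set e := evalp w.
move=> v1 v2 P P0.
have ec a : takes_value e (kxy_cst a) (kxy_cst a).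
  by have := takes_value_tofrac e a%:P%:P; rewrite /= at2C at1C.
have := takes_value_at2 ec P v1 v2; rewrite P0 at2_kxy => /takes_value0 /eqP.
by rewrite tofrac_eq0 => /eqP.
Qed.

Lemma birational_of_right_inverses (S : set (kxy * kxy)) :
    (forall v, S v -> exists2 w, S w &
      takes_value (evalp w) v.1 kxy_x /\
      takes_value (evalp w) v.2 kxy_y) ->
  forall v, S v -> birational v.
Proof.
move=> inv.
have dom v : S v -> dominant v.
  by move=> /inv [w _ [v1 v2]]; apply: takes_value_dominant v1 v2.
have rinv v : S v -> exists2 w, S w & ratmap_comp v w = ratmap_id.
  move=> /inv [w Sw [v1 v2]]; exists w => //.
  have dw := dom _ Sw.
  by congr pair; apply: takes_value_fracmap.
move=> v Sv; have [w Sw vw] := rinv v Sv; have [u Su wu] := rinv w Sw.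
have dv := dom v Sv; have dw := dom w Sw; have du := dom u Su.
split=> //; exists w; split=> //.
suff <- : u = v by [].
by rewrite -[u](ratmap_comp1l du) -vw -(ratmap_compA du) // wu ratmap_comp1r.
Qed.

Lemma dJ_map_birational A B :
  A \in unitmx -> B \in unitmx -> birational (dJ_map A B).
Proof.
move=> uA uB; pose S : set (kxy * kxy) := [set v | exists A B,
  [/\ A \in unitmx, B \in unitmx & v = dJ_map A B]].
apply: (@birational_of_right_inverses S); last by exists A, B.
move=> _ [{uA uB}A [{}B [uA uB ->]]].
have uB' : invmx B \in unitmx by rewrite unitmx_inv.
have uC : map_mx (mobius_kx (invmx B)) A \in unitmx.
  exact (map_mobius_kx_unit uB' uA).
set A' := invmx (map_mx (mobius_kx (invmx B)) A).
have uA' : A' \in unitmx by rewrite unitmx_inv.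
exists (dJ_map A' (invmx B)); first by exists A', (invmx B).
have := dJ_map_comp uA uA' uB uB'.
by cbv zeta; rewrite (mulmxV uB) (mulmxV uC) dJ_map1.
Qed.

Lemma dJ_map_mul A A' B B' :
    A \in unitmx -> A' \in unitmx -> B \in unitmx -> B' \in unitmx ->
  ratmap_comp (dJ_map A B) (dJ_map A' B') =
  dJ_map (map_mx (mobius_kx B') A *m A') (B *m B').
Proof.
move=> uA uA' uB uB'; have [h1 h2] := dJ_map_comp uA uA' uB uB'.
have dw : dominant (dJ_map A' B') by case: (dJ_map_birational uA' uB').
by congr pair; [exact (takes_value_fracmap dw h1)|exact (takes_value_fracmap dw h2)].
Qed.

(* [x : y : 1] -> [u 0 : u 1 : u 2] in the chart where the last homogeneous
   coordinate is 1, for a column u of rational functions *)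
Definition affine_pt (u : 'cV[kxy]_3) : kxy * kxy :=
  (u 0 0 / u 2 0, u 1 0 / u 2 0).

Definition homogeneous_pt (v : kxy * kxy) : 'cV[kxy]_3 :=
  \col_i [:: v.1; v.2; 1]`_i.

Definition lin_map (A : 'M[k]_3) : kxy * kxy :=
  affine_pt (map_mx kxy_cst A *m homogeneous_pt ratmap_id).

Section LinMap.

Lemma lin_form_neq0 (A : 'M[k]_3) i : A \in unitmx ->
  (map_mx kxy_cst A *m homogeneous_pt ratmap_id) i 0 != 0.
Proof.
move=> uA; apply/eqP; rewrite !mxE !big_ord_recl big_ord0 !mxE /= addr0 mulr1.
rewrite /kxy_cst /kxy_x /kxy_y /= -!tofracM -!tofracD => /eqP.
rewrite tofrac_eq0 => /eqP e.
have := congr1 (coefp 1) e; have := congr1 (coefp 0) e.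
rewrite /= !(coefD, coefCM, coefMX, coefX, coefC) /= !(mulr0, mulr1, addr0, add0r).
move=> e0 /eqP; rewrite polyC_eq0 => /eqP a1.
have := congr1 (coefp 1) e0; have := congr1 (coefp 0) e0.
rewrite /= !(coefD, coefCM, coefMX, coefX, coefC) /= !(mulr0, mulr1, addr0, add0r).
move=> a2 a0; have r0 : row i A = 0.
  apply/rowP => j; rewrite !mxE; case: j => -[|[|[|//]]] lj.
  - by rewrite -[RHS]a0; congr (A _ _); apply: val_inj.
  - by rewrite -[RHS]a1; congr (A _ _); apply: val_inj.
  - by rewrite -[RHS]a2; congr (A _ _); apply: val_inj.
have : row i (A *m invmx A) = 0 by rewrite row_mul r0 mul0mx.
rewrite mulmxV // => /rowP /(_ i); rewrite !mxE eqxx => /eqP.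
by rewrite oner_eq0.
Qed.

Lemma homogeneous_affine (u : 'cV[kxy]_3) : u 2 0 != 0 ->
  homogeneous_pt (affine_pt u) = (u 2 0)^-1 *: u.
Proof.
move=> u0; apply/colP => -[[|[|[|//]]] lj]; rewrite !mxE /= mulrC.
- by congr (_ * u _ _); apply: val_inj.
- by congr (_ * u _ _); apply: val_inj.
- by rewrite -(divff u0); congr (u _ _ * _); apply: val_inj.
Qed.

Lemma lin_map_comp A B : A \in unitmx -> B \in unitmx ->
  let w := lin_map B in let u := lin_map (A *m B) in
  takes_value (evalp w) (lin_map A).1 u.1 /\
  takes_value (evalp w) (lin_map A).2 u.2.
Proof.
move=> uA uB w u; set e := evalp w.
set s := (map_mx kxy_cst B *m homogeneous_pt ratmap_id) 2 0.
have s1 : s != 0 by exact (lin_form_neq0 2 uB).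
have s0 : s^-1 != 0 by rewrite invr_eq0.
have ec a : takes_value e (kxy_cst a) (kxy_cst a).
  by have := takes_value_tofrac e a%:P%:P; rewrite /= at2C at1C.
have ex : takes_value e kxy_x w.1.
  by have := takes_value_tofrac e 'X%:P; rewrite /= at2C at1X.
have ey : takes_value e kxy_y w.2.
  by have := takes_value_tofrac e 'X; rewrite /= at2X.
have e1 : takes_value e 1 1.
  by have := takes_value_tofrac e 1; rewrite rmorph1 tofrac1.
have eh i : takes_value e (homogeneous_pt ratmap_id i 0) (homogeneous_pt w i 0).
  by rewrite !mxE; case: i => -[|[|[|//]]] lj /=.
have tv := takes_value_mulmx A ec eh.
pose AB := map_mx kxy_cst (A *m B) *m homogeneous_pt ratmap_id.
have linE : map_mx kxy_cst A *m homogeneous_pt w = s^-1 *: AB.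
  rewrite /AB map_mxM -mulmxA scalemxAr; congr (_ *m _).
  exact (homogeneous_affine s1).
rewrite linE in tv.
have uAB : A *m B \in unitmx by rewrite unitmx_mul uA.
have AB0 := scale_neq0 s0 (lin_form_neq0 2 uAB).
rewrite /u /lin_map /affine_pt /= -/AB.
rewrite -(scale_div AB 0 2 s0) -(scale_div AB 1 2 s0).
by split; exact (takes_value_div AB0 (tv _) (tv 2)).
Qed.

Lemma lin_map1 : lin_map 1%:M = ratmap_id.
Proof.
by rewrite /lin_map map_mx1 mul1mx /affine_pt !mxE /= !divr1.
Qed.

Lemma lin_map_birational A : A \in unitmx -> birational (lin_map A).
Proof.
move=> uA; pose S : set (kxy * kxy) :=
  [set v | exists2 A, A \in unitmx & v = lin_map A].
apply: (@birational_of_right_inverses S); last by exists A.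
move=> _ [{uA}A uA ->]; have uA' : invmx A \in unitmx by rewrite unitmx_inv.
exists (lin_map (invmx A)); first by exists (invmx A).
by have := lin_map_comp uA uA'; cbv zeta; rewrite (mulmxV uA) lin_map1.
Qed.

Lemma lin_map_mul A B : A \in unitmx -> B \in unitmx ->
  ratmap_comp (lin_map A) (lin_map B) = lin_map (A *m B).
Proof.
move=> uA uB; have [h1 h2] := lin_map_comp uA uB.
have dB : dominant (lin_map B) by case: (lin_map_birational uB).
by congr pair; [exact (takes_value_fracmap dB h1)|exact (takes_value_fracmap dB h2)].
Qed.

End LinMap.

(* the action of PGL(3, k) = Aut(P^2) on the chart [x : y : 1]; it is a group
   morphism by [lin_map_mul] *)
Definition lin (u : PGL 3 k) : Cr :=
  MkCr (asboolT (lin_map_birational (glvalP (repr u)))).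

(* the element (l, r) of the semi-direct product PGL(2, k(x)) x| PGL(2, k),
   whose product is given by [dJ_map_mul] *)
Definition dJ (l : PGL 2 kx) (r : PGL 2 k) : Cr :=
  MkCr (asboolT (dJ_map_birational (glvalP (repr l)) (glvalP (repr r)))).

Definition deJonquieres : set Cr := [set phi |
  exists (a b c d : k) (al be ga de : kx),
    [/\ a * d - b * c != 0, al * de - be * ga != 0 &
        crval phi =
          ((kxy_cst a * kxy_x + kxy_cst b) / (kxy_cst c * kxy_x + kxy_cst d),
           (kx_kxy al * kxy_y + kx_kxy be) / (kx_kxy ga * kxy_y + kx_kxy de))]].

Definition prod_LR (L : set (PGL 2 kx)) (R : set (PGL 2 k)) : set Cr :=
  [set dJ l r | l in L & r in R].

(* the field k(x)^R *)
Definition kx_invariants (R : set (PGL 2 k)) : set kx :=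
  [set f | forall r, R r -> mobius_kx (repr r) f = f].

(* the classes of [1 t; 0 1] for t in T *)
Definition translations (F : fieldType) (T : set F) : set (PGL 2 F) :=
  [set pgl (mx_of_rows 2 [:: [:: 1; t]; [:: 0; 1]]) | t in T].

(* the classes of [a bg; b a] for a, b in k(x)^R with a^2 + b^2 g <> 0, which is
   the determinant in characteristic 2 *)
Definition twisted_torus (g : {poly k}) (R : set (PGL 2 k)) : set (PGL 2 kx) :=
  [set u | exists a b : kx,
    [/\ kx_invariants R a, kx_invariants R b,
        a ^+ 2 + b ^+ 2 * tofrac g != 0 &
        u = pgl (mx_of_rows 2 [:: [:: a; b * tofrac g]; [:: b; a]])]].

Definition kleinG1 : set (PGL 3 k) := generated
  [set pgl (mx_of_rows 3 [:: [:: 1; 0; 0]; [:: 0; 1; 1]; [:: 0; 0; 1]]);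
       pgl (mx_of_rows 3 [:: [:: 1; 0; 1]; [:: 0; 1; 0]; [:: 0; 0; 1]])].

Definition kleinG2 : set (PGL 3 k) := generated
  [set pgl (mx_of_rows 3 [:: [:: 1; 1; 0]; [:: 0; 1; 0]; [:: 0; 0; 1]]);
       pgl (mx_of_rows 3 [:: [:: 1; 0; 1]; [:: 0; 1; 0]; [:: 0; 0; 1]])].

Definition kleinG3 (t : k) : set (PGL 3 k) := generated
  [set pgl (mx_of_rows 3 [:: [:: 1; 1; 0]; [:: 0; 1; 0]; [:: 0; 0; 1]]);
       pgl (mx_of_rows 3 [:: [:: 1; t; 0]; [:: 0; 1; 0]; [:: 0; 0; 1]])].

Definition birationally_conjugate (H H' : set (PGL 3 k)) : Prop :=
  conjugate (lin @` H) (lin @` H').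

End Cremona.

Arguments deJonquieres k : clear implicits.
Arguments kleinG1 k : clear implicits.
Arguments kleinG2 k : clear implicits.

(* Main.v *)
From HB Require Import structures.
Require Import Defs.
From mathcomp Require Import all_boot all_order all_algebra.
From mathcomp Require Import monoid fraction generic_quotient.
From mathcomp Require Import boolp classical_sets.
From mathcomp Require Import ring zify.

(** Part 1.  The elements of G act on the base by 2 x 2 matrices over k which commute
    up to scalars and have scalar p-th powers; as k is closed, they are simultaneously
    unipotent, so that G may be assumed to consist of maps (x + t, A(x) y).  The group
    T of those t for which G contains (x + t, y) is then enlarged one element at a
    time.  If (x + t, A(x) y) lies in G, then A may be taken T-invariant and the
    product of its p translates is a scalar c, invariant under T and t.  Invariant
    functions are, up to constants, quotients of products of orbit polynomials
    prod_(r in T) (x - a - r), so c is the norm of a T-invariant function; dividing A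
    by that function makes it a cocycle of Z/p, which is trivial by Hilbert 90.
    When no t is left, there remain commuting T-invariant matrices A(x) with scalar
    p-th powers.  If one of them is not scalar and its p-th power is a p-th power, all
    are simultaneously unipotent; otherwise p = 2, that power is h^2 g with g
    square-free, and the centralizer is the torus of the statement.

    Part 2.  The elements of a Klein subgroup are transvections 1 + u f with f u = 0,
    and the classification reduces to the position of two such pairs.  If G1 and G2
    were birationally conjugate, there would be generators f, h of k(x, y) and
    translations y + s1(x), y + s2(x) with s2 / s1 not constant, the first one mapping
    (f, h) to (f + 1, h), the second one to (f, h + 1).  In characteristic 2, only an
    element of odd degree m in y, with leading coefficient l, is changed in degree
    m - 1 by y + s, and by l s.  Hence f, and so k(f), has even degrees.  Let phi be
    monic in h over k(f), of odd degree in y and of least degree d in h.  Its two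
    differences Q1, Q2 have degree less than d in h, hence even degree in y, and their
    leading coefficients have ratio s2 / s1.  By minimality, reduction modulo phi does
    not affect leading terms, so a linear relation over k(f) between the d + 1 elements
    Q1^(d - i) Q2^i modulo phi gives an algebraic relation over k for s2 / s1, which is
    impossible. *)

Set Implicit Arguments.
Unset Strict Implicit.
Unset Printing Implicit Defensive.

Import Order.TTheory GRing.Theory Num.Theory.
Local Open Scope classical_set_scope.
Local Open Scope ring_scope.
Local Open Scope quotient_scope.

(** * Conjugation of subgroups, and projective linear groups *)

Section GroupSets.
Variable G : groupType.
Implicit Types (H J K : set G) (g h a b : G).
Local Open Scope group_scope.

Lemma conj_in_trans J H K M : subgroup J ->
  conjugate_in J H K -> conjugate_in J K M -> conjugate_in J H M.
Proof.
move=> [_ JM _] [g Jg <-] [h Jh <-]; exists (g * h); first exact: JM.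
rewrite eqEsubset; split=> x.
- by move=> [y Hy <-]; exists (y ^ g); [exists y|rewrite conjgM].
- by move=> [_ [y Hy <-] <-]; exists y; rewrite ?conjgM.
Qed.

Lemma subgroupT : subgroup [set: G].
Proof. by []. Qed.

Lemma conjugate_trans H K M :
  conjugate H K -> conjugate K M -> conjugate H M.
Proof. exact/conj_in_trans/subgroupT. Qed.

Lemma conjugate_sym H K : conjugate H K -> conjugate K H.
Proof.
move=> [g _ <-]; exists g^-1 => //.
rewrite eqEsubset; split=> x.
- by move=> [_ [y Hy <-] <-]; rewrite -conjgM mulgV conjg1.
- by move=> Hx; exists (x ^ g); [exists x|rewrite -conjgM mulgV conjg1].
Qed.

Lemma conj_subgroup g H : subgroup H -> subgroup [set h ^ g | h in H].
Proof.
move=> [H1 HM HV]; split.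
- by exists 1; rewrite ?conj1g.
- by move=> _ _ [x Hx <-] [y Hy <-]; exists (x * y); rewrite ?conjMg //; apply: HM.
- by move=> _ [x Hx <-]; exists x^-1; rewrite ?conjVg //; apply: HV.
Qed.

Definition klein_set a b : set G := [set x | [\/ x = 1, x = a, x = b | x = a * b]].

Lemma generated_klein a b : a * a = 1 -> b * b = 1 -> a * b = b * a ->
  generated [set a; b] = klein_set a b.
Proof.
move=> aa bb ab.
have aV : a^-1 = a by apply: (mulgI a); rewrite mulgV aa.
have bV : b^-1 = b by apply: (mulgI b); rewrite mulgV bb.
rewrite eqEsubset; split.
- apply: smallest_sub; last by move=> x [->|->]; [constructor 2|constructor 3].
  split; first by constructor 1.
  + have aab : a * (a * b) = b by rewrite mulgA aa mul1g.
    have bab : b * (a * b) = a by rewrite ab mulgA bb mul1g.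
    have aba : a * b * a = b by rewrite ab -mulgA aa mulg1.
    have abb : a * b * b = a by rewrite -mulgA bb mulg1.
    have abab : a * b * (a * b) = 1 by rewrite mulgA aba bb.
    move=> x y [] -> [] ->; rewrite ?mul1g ?mulg1 ?aa ?bb ?aab ?bab ?aba ?abb ?abab;
      first [by constructor 1|by constructor 2|by constructor 3|by constructor 4].
  + move=> x [] ->; rewrite ?invg1 ?invgM ?aV ?bV -?ab;
    first [by constructor 1|by constructor 2|by constructor 3|by constructor 4].
- move=> x; rewrite /generated => xk K [[K1 KM KV] sK].
  have Ka : K a by apply: sK; left.
  have Kb : K b by apply: sK; right.
  by case: xk => -> //; apply: KM.
Qed.

Lemma conj_klein g a b :
  [set h ^ g | h in klein_set a b] = klein_set (a ^ g) (b ^ g).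
Proof.
rewrite eqEsubset; split=> x.
- move=> [y [] -> <-]; rewrite ?conj1g ?conjMg;
    first [by constructor 1|by constructor 2|by constructor 3|by constructor 4].
- case=> ->.
  + by exists 1; rewrite ?conj1g //; constructor 1.
  + by exists a => //; constructor 2.
  + by exists b => //; constructor 3.
  + by exists (a * b); rewrite ?conjMg //; constructor 4.
Qed.

Lemma conjugate_klein g a b a' b' : a * g = g * a' -> b * g = g * b' ->
  conjugate (klein_set a b) (klein_set a' b').
Proof.
have cj x y : x * g = g * y -> x ^ g = y.
  by move=> e; rewrite conjgE e mulgA mulVg mul1g.
by move=> /cj <- /cj <-; exists g => //; rewrite conj_klein.
Qed.

Lemma kleinE H : klein H -> exists a b,
  [/\ H = klein_set a b, a * a = 1, b * b = 1, a * b = b * a &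
      [/\ a <> 1, b <> 1 & a <> b]].
Proof.
move=> [sH [f [fD fI fH]]].
have f0 : f 0%R = 1.
  by apply: (mulgI (f 0%R)); rewrite -fD addr0 mulg1.
have ff u : f u * f u = 1.
  rewrite -fD -f0; congr f; apply/rowP => i; rewrite !mxE.
  by case: (u 0%R i) => -[|[|//]] ?; apply/val_inj.
pose e1 : 'rV['F_2]_2 := delta_mx 0 0; pose e2 : 'rV['F_2]_2 := delta_mx 0 1%R.
have ne (u v : 'rV['F_2]_2) i : u 0%R i != v 0%R i -> f u <> f v.
  by move=> uv /fI e; rewrite e eqxx in uv.
exists (f e1), (f e2); split=> //.
- rewrite -fH eqEsubset; split=> x.
  + move=> [u _ <-].
    have h (v w : 'rV['F_2]_2) : v 0%R 0%R = w 0%R 0%R -> v 0%R 1%R = w 0%R 1%R -> v = w.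
      move=> h0 h1; apply/rowP => -[[|[|//]] i].
      * by rewrite (_ : Ordinal i = 0%R) //; apply/val_inj.
      * by rewrite (_ : Ordinal i = 1%R) //; apply/val_inj.
    case u0 : (u 0%R 0%R) => [[|[|//]] i0]; case u1 : (u 0%R 1%R) => [[|[|//]] i1].
    * constructor 1; rewrite -f0; congr f; apply: h; rewrite !mxE ?u0 ?u1; exact: val_inj.
    * constructor 3; congr f; apply: h; rewrite !mxE ?u0 ?u1; exact: val_inj.
    * constructor 2; congr f; apply: h; rewrite !mxE ?u0 ?u1; exact: val_inj.
    * constructor 4; rewrite -fD; congr f; apply: h; rewrite !mxE ?u0 ?u1; exact: val_inj.
  + case=> ->; [exists 0%R => //|by exists e1|by exists e2|].
    by exists (e1 + e2)%R => //; rewrite fD.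
- by rewrite -!fD addrC.
- by split; rewrite -?f0; [apply: (ne _ _ 0%R)|apply: (ne _ _ 1%R)|apply: (ne _ _ 0%R)];
    rewrite !mxE.
Qed.

Lemma klein_set_swap a b : a * b = b * a -> klein_set a b = klein_set b a.
Proof.
by move=> ab; rewrite eqEsubset; split=> x; rewrite /klein_set /= -?ab;
  case=> ->; do [by constructor 1|by constructor 2|by constructor 3|by constructor 4].
Qed.

End GroupSets.

Section PGLTheory.
Variables (n : nat) (F : fieldType).
Implicit Types (A B : 'M[F]_n).

Lemma pgl_pi A (uA : A \in unitmx) : pgl A = \pi_(PGL n F) (MkGL uA).
Proof. by rewrite /pgl; congr (\pi_(PGL n F) _); apply: val_inj; rewrite insubdK. Qed.

Lemma pgl_repr A : A \in unitmx ->
  exists2 c : F, c != 0 & glval (repr (pgl A)) = c *: A.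
Proof. by move=> uA; rewrite (pgl_pi uA); apply: PGL_reprP. Qed.

Lemma reprK_pgl (u : PGL n F) : pgl (glval (repr u)) = u.
Proof.
rewrite (pgl_pi (glvalP (repr u))) -[RHS]reprK; congr (\pi_(PGL n F) _).
exact: val_inj.
Qed.

Lemma pglP (u : PGL n F) : exists2 A, A \in unitmx & u = pgl A.
Proof. by exists (glval (repr u)); rewrite ?reprK_pgl ?glvalP. Qed.

Lemma pgl_eq A B : A \in unitmx -> B \in unitmx ->
  pgl A = pgl B <-> exists2 c : F, c != 0 & A = c *: B.
Proof.
move=> uA uB; rewrite (pgl_pi uA) (pgl_pi uB).
by split=> [/eqP/PGL_eqP|h]; last apply/eqP/PGL_eqP.
Qed.

Lemma pglM A B : A \in unitmx -> B \in unitmx -> (pgl A * pgl B)%g = pgl (A *m B).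
Proof.
move=> uA uB; have uAB : A *m B \in unitmx by rewrite unitmx_mul uA.
rewrite (pgl_pi uAB); apply/eqP/PGL_eqP => /=.
have [c c0 ->] := pgl_repr uA; have [d d0 ->] := pgl_repr uB.
by exists (c * d); rewrite ?mulf_neq0 // -scalemxAr -scalemxAl scalerA mulrC.
Qed.

Lemma pgl1 : pgl 1%:M = 1%g :> PGL n F.
Proof.
by rewrite (pgl_pi (unitmx1 F n)); congr (\pi_(PGL n F) _); apply: val_inj.
Qed.

Lemma pglV A : A \in unitmx -> (pgl A)^-1%g = pgl (invmx A).
Proof.
move=> uA; have uV : invmx A \in unitmx by rewrite unitmx_inv.
by apply: (mulgI (pgl A)); rewrite mulgV pglM // mulmxV // pgl1.
Qed.

Lemma pglZ (c : F) A : c != 0 -> A \in unitmx -> pgl (c *: A) = pgl A.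
Proof.
move=> c0 uA; apply/pgl_eq => //; last by exists c.
by rewrite -mul_scalar_mx unitmx_mul uA unitmxE det_scalar unitrX // unitfE.
Qed.

End PGLTheory.

Section TranslationMatrices.
Variable F : fieldType.

Definition tr_mx (t : F) : 'M[F]_2 := mx_of_rows 2 [:: [:: 1; t]; [:: 0; 1]].

Lemma tr_mxD s t : tr_mx s *m tr_mx t = tr_mx (s + t).
Proof.
apply/matrixP => -[[|[|//]] i] [[|[|//]] j]; rewrite !mxE big_ord_recl big_ord1 !mxE /=;
  by rewrite ?(mulr0, mul0r, mulr1, mul1r, addr0, add0r) // addrC.
Qed.

Lemma tr_mx0 : tr_mx 0 = 1%:M.
Proof. by apply/matrixP => -[[|[|//]] i] [[|[|//]] j]; rewrite !mxE. Qed.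

Lemma tr_mx_unit t : tr_mx t \in unitmx.
Proof. by have := mulmx1_unit (etrans (tr_mxD t (- t)) _); rewrite subrr tr_mx0 => -[]. Qed.

Lemma tr_mxV t : invmx (tr_mx t) = tr_mx (- t).
Proof.
have u := tr_mx_unit t; apply: (can_inj (mulKmx u)).
by rewrite mulmxV // tr_mxD subrr tr_mx0.
Qed.

End TranslationMatrices.

Lemma det2E (R : comPzRingType) (A : 'M[R]_2) : \det A = A 0 0 * A 1 1 - A 0 1 * A 1 0.
Proof.
rewrite (expand_det_row _ 0) !big_ord_recl big_ord0 /cofactor !det_mx11 !mxE /=.
have l1 : lift ord0 ord0 = 1 :> 'I_2 by apply: val_inj.
have l0 : lift (lift ord0 ord0 : 'I_2) ord0 = 0 :> 'I_2 by apply: val_inj.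
by rewrite !l1 -l1 l0 l1 expr0 expr1 mul1r mulN1r mulrN addr0.
Qed.

Lemma mx2_unitE (F : fieldType) (A : 'M[F]_2) :
  (A \in unitmx) = (A 0 0 * A 1 1 - A 0 1 * A 1 0 != 0).
Proof. by rewrite unitmxE det2E unitfE. Qed.

(** * Leading terms of fractions in y *)

Lemma coefM_top (R : nzRingType) (p q : {poly R}) i j :
  (size p <= i.+1)%N -> (size q <= j.+1)%N -> (p * q)`_(i + j) = p`_i * q`_j.
Proof.
move=> sp sq; rewrite coefM.
have li : (i < (i + j).+1)%N by rewrite ltnS leq_addr.
rewrite (bigD1 (Ordinal li)) //= addKn big1 ?addr0 // => -[h hl] /= ne.
have {ne} ne : h != i by apply: contraNneq ne => e; apply/eqP/val_inj.
case: (ltngtP h i) ne => // hi _.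
- by rewrite [q`_ _]nth_default ?mulr0 //= (leq_trans sq) //; lia.
- by rewrite nth_default ?mul0r //= (leq_trans sp).
Qed.

(** Quotient rule for the difference operator [g - 1]. The factor [g b] is left as [g b - b + b]
    because its leading term is known only by adding the one of [b] to a difference of lower
    degree. *)
Lemma rmorph_quotient_difference (L : fieldType) (g : {rmorphism L -> L}) (a b : L) :
  b != 0 -> g (a / b) - a / b =
    ((g a - a) * b - a * (g b - b)) * ((g b - b + b) * b)^-1.
Proof.
move=> b0; have gb0 : g b != 0 by rewrite fmorph_eq0.
by rewrite fmorph_div subrK; field; rewrite b0 gb0.
Qed.

(** The same rule on leading coefficients: the degrees [m] and [n] of numerator and denominator
    enter only through the degree [m - n] of the quotient. *)
Lemma lead_shift_coef (L : fieldType) (a b c : L) (m n : nat) : b != 0 ->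
  ((a * c) *+ m * b - a * ((b * c) *+ n)) * (b * b)^-1 =
  a / b * c *~ (m%:Z - n%:Z).
Proof.
move=> b0; rewrite -mulrzr mulrzBr -!pmulrn -(mulr_natr (a * c)) -(mulr_natr (b * c)).
by field.
Qed.

Lemma shift_step_identity (L : comNzRingType) (a b x s c : L) :
  a * (x + s) + c - (b * x + c) = (a - b) * (x + s) + b * s.
Proof. by ring. Qed.

Section LeadingTerms.
Variable R : idomainType.
Local Notation K := {fraction R}.
Local Notation F := {fraction {poly R}}.
Implicit Types (f g : F) (m n : int) (l : K).

(* f has degree at most m, with coefficient l (possibly 0) in degree m *)
Definition lead f m l : Prop := exists (p d : {poly R}) (N : nat),
  [/\ d != 0, f = tofrac p / tofrac d, (size p <= N.+1)%N,
      m = N%:Z - (size d).-1%:Z & l = tofrac p`_N / tofrac (lead_coef d)].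

Lemma lead_cast f m n l l' : lead f m l -> m = n -> l = l' -> lead f n l'.
Proof. by move=> h <- <-. Qed.

Lemma lead_tofrac (p : {poly R}) N : (size p <= N.+1)%N ->
  lead (tofrac p) N (tofrac p`_N).
Proof.
move=> sp; exists p, 1, N; split=> //; rewrite ?oner_eq0 // ?lead_coef1 ?tofrac1 ?divr1 //.
by rewrite size_poly1 subr0.
Qed.

Lemma leadM f g m n l l' : lead f m l -> lead g n l' -> lead (f * g) (m + n) (l * l').
Proof.
move=> [p [d [N [d0 -> sp -> ->]]]] [p' [d' [N' [d0' -> sp' -> ->]]]].
exists (p * p'), (d * d'), (N + N')%N; split.
- by rewrite mulf_neq0.
- by rewrite mulf_div !tofracM.
- by rewrite (leq_trans (size_polyMleq _ _)) //; lia.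
- rewrite size_mul //; have := size_poly_gt0 d; have := size_poly_gt0 d'.
  by rewrite d0 d0'; lia.
- by rewrite mulf_div -!tofracM lead_coefM coefM_top.
Qed.

Lemma leadD f g m l l' : lead f m l -> lead g m l' -> lead (f + g) m (l + l').
Proof.
move=> [p [d [N [d0 -> sp -> ->]]]] [p' [d' [N' [d0' -> sp' e ->]]]].
have sd : (0 < size d)%N by rewrite size_poly_gt0.
have sd' : (0 < size d')%N by rewrite size_poly_gt0.
have eN : (N + (size d').-1 = N' + (size d).-1)%N by lia.
exists (p * d' + p' * d), (d * d'), (N + (size d').-1)%N; split.
- by rewrite mulf_neq0.
- by rewrite addf_div ?tofrac_eq0 // tofracD !tofracM.
- rewrite (leq_trans (size_polyD _ _)) // geq_max.
  by rewrite !(leq_trans (size_polyMleq _ _)) //; lia.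
- by rewrite size_mul //; lia.
- rewrite addf_div ?tofrac_eq0 ?lead_coef_eq0 // lead_coefM tofracM; congr (_ / _).
  rewrite coefD coefM_top ?prednK //.
  by rewrite eN coefM_top ?prednK // tofracD !tofracM.
Qed.

Lemma lead_lower f m n l : lead f m l -> m < n -> lead f n 0.
Proof.
move=> [p [d [N [d0 -> sp -> _]]]] mn.
exists p, d, (N + `|(n - (N%:Z - (size d).-1%:Z))%R|)%N; split=> //.
- by apply: leq_trans sp _; lia.
- by lia.
- by rewrite nth_default ?tofrac0 ?mul0r //; apply: leq_trans sp _; lia.
Qed.

Lemma lead_uniq f m l l' : lead f m l -> lead f m l' -> l = l'.
Proof.
move=> [p [d [N [d0 -> sp -> ->]]]] [p' [d' [N' [d0' + sp' e ->]]]].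
have sd : (0 < size d)%N by rewrite size_poly_gt0.
have sd' : (0 < size d')%N by rewrite size_poly_gt0.
have eN : (N + (size d').-1 = N' + (size d).-1)%N by lia.
move/eqP; rewrite eqr_div ?tofrac_eq0 // -!tofracM tofrac_eq => /eqP E.
apply/eqP; rewrite eqr_div ?tofrac_eq0 ?lead_coef_eq0 // -!tofracM tofrac_eq.
apply/eqP; rewrite !lead_coefE -coefM_top ?prednK // E eN.
by rewrite coefM_top ?prednK.
Qed.

Lemma lead0 m : lead 0 m 0.
Proof.
have h : lead (tofrac 0) 0%N (tofrac (0 : {poly R})`_0).
  by apply: lead_tofrac; rewrite size_poly0.
rewrite coef0 !tofrac0 in h; case: (ltP 0 m) => [m0|].
  exact: lead_lower h m0.
(* The bound on the numerator is a natural number, so a nonpositive degree must come from the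
   denominator. *)
move=> m0; exists 0, ('X ^+ `|m|), 0; split=> //.
- by rewrite expf_neq0 ?polyX_eq0.
- by rewrite tofrac0 mul0r.
- by rewrite size_poly0.
- by rewrite size_polyXn /=; lia.
- by rewrite coef0 tofrac0 mul0r.
Qed.

Lemma lead_exists f : f != 0 -> exists m l, lead f m l /\ l != 0.
Proof.
move=> f0; rewrite (fracE f) in f0 *.
set p := \n_(repr f) in f0 *; set d := \d_(repr f) in f0 *.
have d0 : d != 0 by apply: denom_ratioP.
have p0 : p != 0 by apply: contra_neq f0 => ->; rewrite tofrac0 mul0r.
exists ((size p).-1%:Z - (size d).-1%:Z), (tofrac (lead_coef p) / tofrac (lead_coef d)).
split; first by exists p, d, (size p).-1; split=> //; apply: leqSpred.
by rewrite mulf_neq0 ?invr_eq0 ?tofrac_eq0 ?lead_coef_eq0.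
Qed.

(** Since [l] is nonzero, the bound [N] on the degree of the numerator is attained, and numerator
    and denominator may be exchanged. *)
Lemma leadV f m l : l != 0 -> lead f m l -> lead f^-1 (- m) l^-1.
Proof.
move=> l0 [p [d [N [d0 -> sp -> e]]]].
have pN : p`_N != 0.
  by apply: contra_neq l0 => pN; rewrite e pN tofrac0 mul0r.
have sp' : size p = N.+1.
  apply/eqP; rewrite eqn_leq sp /= ltnNge; apply: contra pN => h.
  by rewrite nth_default.
exists d, p, (size d).-1; split.
- by apply: contra_neq pN => ->; rewrite coef0.
- by rewrite invf_div.
- exact: leqSpred.
- by rewrite sp' /=; lia.
- by rewrite e invf_div !lead_coefE sp'.
Qed.

Lemma leadN f m l : lead f m l -> lead (- f) m (- l).
Proof.
move=> [p [d [N [d0 -> sp -> ->]]]]; exists (- p), d, N; split=> //.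
- by rewrite tofracN mulNr.
- by rewrite size_polyN.
- by rewrite coefN tofracN mulNr.
Qed.

Lemma lead1 : lead 1 0 1.
Proof.
by have := @lead_tofrac 1 0%N; rewrite size_poly1 coef1 !tofrac1; apply.
Qed.

Lemma leadX f m l (n : nat) : lead f m l -> lead (f ^+ n) (m *+ n) (l ^+ n).
Proof.
move=> h; elim: n => [|n IH]; first exact: lead1.
by rewrite !exprS mulrS; apply: leadM.
Qed.

Variables (s : R) (g : {rmorphism F -> F}).
Hypothesis gE : forall p, g (tofrac p) = tofrac (p \Po ('X + s%:P)).

(** On leading terms the difference acts as the derivation with value [s] at y: along Horner's
    scheme, each step adds one copy of the top coefficient times [s]. *)
Lemma lead_shift_poly (p : {poly R}) N : (size p <= N.+1)%N ->
  lead (g (tofrac p) - tofrac p) (N%:Z - 1) (tofrac (p`_N * s) *+ N).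
Proof.
rewrite gE; elim/poly_ind: p N => [|p c IH] N sp.
  by rewrite comp_poly0 coef0 mul0r tofrac0 mul0rn subrr; apply: lead0.
have -> : tofrac ((p * 'X + c%:P) \Po ('X + s%:P)) - tofrac (p * 'X + c%:P) =
    (tofrac (p \Po ('X + s%:P)) - tofrac p) * tofrac ('X + s%:P)
    + tofrac (p * s%:P) :> F.
  rewrite comp_polyD comp_polyM comp_polyX comp_polyC !(tofracD, tofracM).
  exact: shift_step_identity.
case: N sp => [|N] sp.
  have -> : p = 0.
    apply/eqP; apply: contraTT sp => p0; rewrite -ltnNge size_MXaddC (negPf p0) /=.
    by rewrite ltnS size_poly_gt0.
  by rewrite comp_poly0 tofrac0 subrr !mul0r tofrac0 addr0 mulr0n; apply: lead0.
have sp1 : (size p <= N.+1)%N.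
  by move: sp; rewrite size_MXaddC; case: ifP => [/andP[/eqP-> _]|_ //]; rewrite size_poly0.
have -> : (p * 'X + c%:P)`_N.+1 = p`_N by rewrite coefD coefMX coefC addr0.
have h1 : lead (tofrac ('X + s%:P)) 1 1.
  have := @lead_tofrac ('X + s%:P) 1; rewrite size_XaddC => /(_ isT).
  by rewrite coefD coefX coefC addr0 tofrac1.
have h2 : lead (tofrac (p * s%:P)) N (tofrac (p`_N * s)).
  rewrite -coefMC; apply: lead_tofrac.
  by rewrite mulrC mul_polyC (leq_trans (size_scale_leq _ _)).
have h3 := leadM (IH _ sp1) h1.
have {}h3 := lead_cast h3 (_ : _ = N%:Z) erefl.
apply: (lead_cast (leadD (h3 _) h2)); first by lia.
- by lia.
- by rewrite mulr1 -mulrSr.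
Qed.

(** For nonzero [l] and [s] in characteristic 2, the new coefficient is nonzero exactly when [m] is
    odd; this is how parity of degrees enters. *)
Lemma lead_shift f m l : lead f m l -> lead (g f - f) (m - 1) (l * tofrac s *~ m).
Proof.
move=> [p [d [N [d0 -> sp -> ->]]]].
have sd : (0 < size d)%N by rewrite size_poly_gt0.
set D := (size d).-1; have sD : (size d <= D.+1)%N by rewrite /D prednK.
have hp := lead_shift_poly sp; have hd := lead_shift_poly sD.
have lp := lead_tofrac sp; have ld := lead_tofrac sD.
have dD : d`_D = lead_coef d by [].
have td : tofrac d != 0 :> F by rewrite tofrac_eq0.
rewrite (rmorph_quotient_difference g _ td).
have cD : tofrac (lead_coef d) != 0 :> K by rewrite tofrac_eq0 lead_coef_eq0.
have h1 : lead (g (tofrac d) - tofrac d + tofrac d) D (tofrac (lead_coef d)).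
  have := leadD (lead_lower hd (_ : _ < D%:Z)) ld; rewrite add0r; apply; lia.
have h2 := leadV _ (leadM h1 ld).
have h3 := leadM hp ld; have h4 := leadN (leadM lp hd).
have {}h4 := lead_cast h4 (_ : _ = N%:Z - 1 + D%:Z) erefl.
have {}h4 := h4 ltac:(lia).
apply: (lead_cast (leadM (leadD h3 h4) (h2 _))); first by rewrite dD mulf_neq0.
- by lia.
- by rewrite dD !tofracM; apply: lead_shift_coef.
Qed.

End LeadingTerms.

(** * Two translations in independent directions *)

Definition fracmap_rmorphism (R : idomainType) (L : fieldType)
    (e : {rmorphism R -> L}) (e_inj : forall a, e a = 0 -> a = 0) :
  {rmorphism {fraction R} -> L} :=
  HB.pack_for {rmorphism {fraction R} -> L} (fracmap e)
    (GRing.isZmodMorphism.Build _ _ (fracmap e) (fracmap_zmod e_inj))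
    (GRing.isMonoidMorphism.Build _ _ (fracmap e) (fracmap_monoid e_inj)).

Lemma common_denominator (R : idomainType) (I : finType) (c : I -> {fraction R}) :
  exists (D : R) (p : I -> R), D != 0 /\ forall i, c i * tofrac D = tofrac (p i).
Proof.
pose d i := \d_(repr (c i)); have d0 i : d i != 0 by apply: denom_ratioP.
exists (\prod_i d i), (fun i => \n_(repr (c i)) * \prod_(j | j != i) d j); split.
  by apply/prodf_neq0 => i _.
move=> i; rewrite (bigD1 i) //= !tofracM {1}(fracE (c i)) -/(d i) mulrA divfK //.
by rewrite tofrac_eq0.
Qed.

Lemma mul_neq0_odd2 (K : fieldType) (h2 : 2%N \in [pchar K]) (a : K) (m : int) :
  odd `|m| -> a *~ m = a.
Proof.
have two : a *+ 2 = 0 by rewrite -mulr_natr (pcharf0 h2) mulr0.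
have nat n : odd n -> a *+ n = a.
  by move=> on; rewrite -(odd_double_half n) on -muln2 mulrnDr mulnC mulrnA two mul0rn addr0.
case: m => n /=; first exact: nat.
by move=> on; rewrite NegzE mulrNz -pmulrn nat // (oppr_pchar2 h2).
Qed.

Lemma odd_abszD (m n : int) : odd `|m + n| = odd `|m| (+) odd `|n|.
Proof.
have h (a : int) : odd `|a| = ((a %% 2)%Z == 1) by lia.
by rewrite !h; lia.
Qed.

Lemma rmorph_mulX_neq0 (K L : fieldType) (c : {rmorphism K -> L}) a x n :
  a != 0 -> x != 0 -> c a * x ^+ n != 0.
Proof. by move=> a0 x0; rewrite mulf_neq0 ?expf_neq0 // fmorph_eq0. Qed.

Lemma size_monic_sub (R : nzRingType) (p q : {poly R}) :
  p \is monic -> q \is monic -> size p = size q -> (size (p - q)%R < size q)%N.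
Proof.
move=> mp mq spq; have sq : (0 < size q)%N by rewrite size_poly_gt0 monic_neq0.
rewrite -[X in (_ < X)%N](prednK sq) ltnS; apply/leq_sizeP => i.
rewrite leq_eqVlt => /orP[/eqP <-|li]; rewrite coefB.
  have := monicP mp; have := monicP mq; rewrite !lead_coefE spq => -> ->.
  by rewrite subrr.
by rewrite !nth_default ?subrr ?spq // -(prednK sq).
Qed.

Lemma left_kernel_neq0 (K : fieldType) n (A : 'M[K]_(n.+1, n)) :
  exists2 c : 'rV_n.+1, c != 0 & c *m A = 0.
Proof.
have : kermx A != 0.
  rewrite kermx_eq0 /row_free; apply: contraTneq (rank_leq_col A) => ->.
  by rewrite -ltnNge.
by case/rowV0Pn => c /sub_kermxP cA c0; exists c.
Qed.

(** The relation says that [v / u] is a root of a nonzero polynomial over [k]. This polynomial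
    splits, so all its roots lie in the image of [k]. *)
Lemma closed_ratio_const (k : closedFieldType) (L : fieldType)
    (c : {rmorphism k -> L}) n (a : 'I_n -> k) (u v : L) :
    u != 0 -> (exists i, a i != 0) ->
    \sum_(i < n) c (a i) * (v ^+ i * u ^+ (n.-1 - i)) = 0 ->
  exists z, v = c z * u.
Proof.
move=> u0 [i0 ai0] e; pose p := \poly_(i < n) (if insub i is Some j then a j else 0).
have pE (i : 'I_n) : p`_i = a i by rewrite coef_poly ltn_ord valK.
have p0 : p != 0 by apply: contraNneq ai0 => p0; rewrite -pE p0 coef0.
have rp : root (map_poly c p) (v / u).
  have un : u ^+ n.-1 != 0 by rewrite expf_neq0.
  rewrite /root -(mulIr_eq0 _ (mulIf un)) -e.
  rewrite (@horner_coef_wide _ n); last first.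
    by rewrite size_map_poly size_poly.
  rewrite mulr_suml; apply/eqP/eq_bigr => i _; rewrite coef_map pE -mulrA; congr (_ * _).
  have -> : u ^+ n.-1 = u ^+ i * u ^+ (n.-1 - i).
    by rewrite -exprD subnKC // -ltnS (ltn_predK (ltn_ord i)) ltn_ord.
  by rewrite expr_div_n mulrA divfK // expf_neq0.
have [r pr] := closed_field_poly_normal p.
move: rp; rewrite pr map_polyZ /= rootZ ?fmorph_eq0 ?lead_coef_eq0 //.
rewrite rmorph_prod /= (_ : \prod_(i <- r) _ = \prod_(z <- map c r) ('X - z%:P)).
  by rewrite root_prod_XsubC => /mapP[z _ e']; exists z; rewrite -e' divfK.
rewrite big_map; apply: eq_bigr => z _.
by rewrite rmorphB /= map_polyX map_polyC.
Qed.

Lemma monic_normalize (K : fieldType) (p : {poly K}) :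
  p != 0 -> (lead_coef p)^-1 *: p \is monic.
Proof. by move=> p0; rewrite monicE lead_coefZ mulVf // lead_coef_eq0. Qed.

Lemma monic_comp_XaddC (R : idomainType) (p : {poly R}) c :
  p \is monic -> p \Po ('X + c%:P) \is monic.
Proof.
move=> mp; rewrite monicE lead_coef_comp ?size_XaddC // lead_coefXaddC.
by rewrite expr1n mulr1 -monicE.
Qed.

Lemma size_divpM_lt (K : fieldType) (p q d : {poly K}) :
  (size p < size d)%N -> (size q < size d)%N -> (size ((p * q) %/ d)%R < size d)%N.
Proof.
move=> sp sq; have d0 : d != 0 by rewrite -size_poly_gt0 (leq_trans _ sp).
rewrite size_divp //; have := size_polyMleq p q.
by move: (size (p * q)%R) (size p) (size q) (size d) sp sq => a b c e; lia.
Qed.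

Section TranslationPairs.
Variable k : closedFieldType.
Hypothesis pchar2 : 2%N \in [pchar k].
Local Notation kx := {fraction {poly k}}.
Local Notation F := {fraction {poly {poly k}}}.
Variables (s1 s2 : {poly k}) (g1 g2 : {rmorphism F -> F}).
Hypothesis g1E : forall p, g1 (tofrac p) = tofrac (p \Po ('X + s1%:P)).
Hypothesis g2E : forall p, g2 (tofrac p) = tofrac (p \Po ('X + s2%:P)).
Hypotheses (s1_neq0 : s1 != 0) (s2_neq0 : s2 != 0).
Hypothesis s12 : forall a : k, s2 != a *: s1.
Variables f h : F.
Hypotheses (g1f : g1 f = f + 1) (g2f : g2 f = f).
Hypotheses (g1h : g1 h = h) (g2h : g2 h = h + 1).
Hypothesis y_in : exists P Q : {poly {poly k}},
  kxy_y k = at2 (@kxy_cst k) f h P / at2 (@kxy_cst k) f h Q.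

Let pchar2x : 2%N \in [pchar kx].
Proof. by rewrite (fmorph_pchar (@kx_cst k)). Qed.

Variable ef : {rmorphism kx -> F}.
Hypothesis ef_tofrac : forall p, ef (tofrac p) = at1 (@kxy_cst k) f p.

(** As [ef] maps x to [f], the ring [{poly kx}] stands for k(f)[T] and [ev] sends T to [h]; degrees
    in [h] become sizes of polynomials. *)
Definition ev (P : {poly kx}) : F := (map_poly ef P).[h].

Lemma evD P Q : ev (P + Q) = ev P + ev Q.
Proof. by rewrite /ev rmorphD hornerD. Qed.
Lemma evN P : ev (- P) = - ev P.
Proof. by rewrite /ev rmorphN hornerN. Qed.
Lemma evM P Q : ev (P * Q) = ev P * ev Q.
Proof. by rewrite /ev rmorphM hornerM. Qed.
Lemma evC c : ev c%:P = ef c.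
Proof. by rewrite /ev map_polyC hornerC. Qed.
Lemma ev1 : ev 1 = 1.
Proof. by rewrite /ev rmorph1 hornerC. Qed.
Lemma ev0 : ev 0 = 0.
Proof. by rewrite /ev rmorph0 horner0. Qed.
Lemma evX : ev 'X = h.
Proof. by rewrite /ev map_polyX hornerX. Qed.

Lemma at2_ev P : at2 (@kxy_cst k) f h P = ev (map_poly (@tofrac {poly k}) P).
Proof.
rewrite /ev /at2 /= /horner_eval; congr (_.[h]).
by apply/polyP => i; rewrite !coef_map /= ef_tofrac.
Qed.

Lemma odd_shift_neq0 (g : {rmorphism F -> F}) s u m l :
    (forall p, g (tofrac p) = tofrac (p \Po ('X + s%:P))) ->
  lead u m l -> odd `|m| -> lead (g u - u) (m - 1) (l * tofrac s).
Proof.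
move=> gE lu om; have := lead_shift gE lu.
by rewrite (mul_neq0_odd2 pchar2x).
Qed.

(** In odd degree, [g2] would move [f]; in degree at most 0, the difference [g1 f - f = 1] would
    have negative degree. The form [j.*2.+2] records both evenness and positivity. *)
Lemma lead_f : exists (j : nat) (xi : kx), lead f (j.*2.+2)%:Z xi /\ xi != 0.
Proof.
have f0 : f != 0.
  by apply/eqP => f0; move: g1f; rewrite f0 rmorph0 add0r => /esym/eqP; rewrite oner_eq0.
have [m [xi [lf xi0]]] := lead_exists f0.
have em : ~~ odd `|m|.
  apply/negP => om; have := odd_shift_neq0 g2E lf om; rewrite g2f subrr => l0.
  have := lead_uniq l0 (lead0 _ _) => /eqP.
  by rewrite mulf_eq0 (negPf xi0) tofrac_eq0 (negPf s2_neq0).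
have m0 : 0 < m.
  rewrite ltNge; apply/negP => m0.
  have := lead_shift g1E lf; rewrite g1f addrAC subrr add0r => l1.
  have l2 := lead_lower l1 (_ : m - 1 < 0).
  have /eqP := lead_uniq (lead1 _) (l2 ltac:(lia)).
  by rewrite oner_eq0.
exists (`|m|./2).-1, xi; split=> //.
apply: (lead_cast lf) => //.
by have := odd_double_half `|m|; rewrite (negPf em) /=; lia.
Qed.

(** Zero counts as even, which makes these elements stable under products and inverses, and [odddeg]
    their exact complement. *)
Definition evendeg (u : F) : Prop :=
  u = 0 \/ exists (m : int) l, [/\ lead u m l, l != 0 & ~~ odd `|m|].
Definition odddeg (u : F) : Prop :=
  exists (m : int) l, [/\ lead u m l, l != 0 & odd `|m|].

Lemma even_or_odd u : evendeg u \/ odddeg u.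
Proof.
have [->|u0] := eqVneq u 0; first by left; left.
have [m [l [lu l0]]] := lead_exists u0.
by case om : (odd `|m|); [right|left; right]; exists m, l; rewrite ?om.
Qed.

Lemma lead_uniq_deg (u : F) m n l l' :
  lead u m l -> l != 0 -> lead u n l' -> l' != 0 -> m = n.
Proof.
move=> lu l0 lu' l0'; case: (ltgtP m n) => // mn.
- by move: l0'; rewrite (lead_uniq lu' (lead_lower lu mn)) eqxx.
- by move: l0; rewrite (lead_uniq lu (lead_lower lu' mn)) eqxx.
Qed.

Lemma not_even_odd u : evendeg u -> odddeg u -> False.
Proof.
move=> [->|[m [l [lu l0 em]]]] [n [l' [lu' l0' on]]].
  by move: l0'; rewrite (lead_uniq lu' (lead0 _ _)) eqxx.
by move: em; rewrite (lead_uniq_deg lu l0 lu' l0') on.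
Qed.

Lemma evendegM u v : evendeg u -> evendeg v -> evendeg (u * v).
Proof.
move=> [->|[m [l [lu l0 em]]]]; first by rewrite mul0r; left.
move=> [->|[n [l' [lv l0' en]]]]; first by rewrite mulr0; left.
right; exists (m + n), (l * l').
split; [exact (leadM lu lv)|exact (mulf_neq0 l0 l0')|].
by rewrite odd_abszD (negPf em) (negPf en).
Qed.

Lemma evendegV u : evendeg u -> evendeg u^-1.
Proof.
move=> [->|[m [l [lu l0 em]]]]; first by rewrite invr0; left.
right; exists (- m), l^-1; split; [exact: (leadV l0 lu)|by rewrite invr_eq0|].
by rewrite abszN.
Qed.

Lemma odddegM u v : evendeg u -> u != 0 -> odddeg v -> odddeg (u * v).
Proof.
move=> [->|[m [l [lu l0 em]]]]; first by rewrite eqxx.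
move=> _ [n [l' [lv l0' en]]].
exists (m + n), (l * l'); split; [exact (leadM lu lv)|exact (mulf_neq0 l0 l0')|].
by rewrite odd_abszD (negPf em) en.
Qed.

(** As [f] has positive degree in y, its powers have increasing degrees, and only the coefficient of
    degree [N] contributes in degree [m *+ N]. *)
Lemma lead_at1 m xi (p : {poly k}) N : lead f m xi -> (0 < m) -> (size p <= N.+1)%N ->
  lead (at1 (@kxy_cst k) f p) (m *+ N) (@kx_cst k p`_N * xi ^+ N).
Proof.
move=> lf m0; elim/poly_ind: p N => [|p c IH] N sp.
  by rewrite rmorph0 coef0 rmorph0 mul0r; apply: lead0.
rewrite rmorphD rmorphM /= at1X at1C.
have lc : lead (@kxy_cst k c) 0 (@kx_cst k c).
  have := @lead_tofrac _ c%:P%:P 0; rewrite size_polyC_leq1 => /(_ isT).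
  by rewrite coefC.
case: N sp => [|N] sp.
  have -> : p = 0.
    apply/eqP; apply: contraTT sp => p0; rewrite -ltnNge size_MXaddC (negPf p0) /=.
    by rewrite ltnS size_poly_gt0.
  by rewrite rmorph0 !mul0r !add0r coefC /= mulr1.
have sp1 : (size p <= N.+1)%N.
  by move: sp; rewrite size_MXaddC; case: ifP => [/andP[/eqP-> _]|_ //]; rewrite size_poly0.
have h1 := leadM (IH _ sp1) lf.
have h2 := lead_lower lc (_ : 0 < m *+ N + m).
apply: (lead_cast (leadD h1 (h2 _))).
- by lia.
- by rewrite mulrSr.
- by rewrite coefD coefMX coefC !addr0 exprSr mulrA.
Qed.

Lemma evendeg_ef c : evendeg (ef c).
Proof.
rewrite (fracE c) fmorph_div /=; have [j [xi [lf xi0]]] := lead_f.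
have even_poly p : evendeg (ef (tofrac p)).
  have [->|p0] := eqVneq p 0; first by rewrite tofrac0 rmorph0; left.
  right; exists ((j.*2.+2)%:Z *+ (size p).-1), (@kx_cst k (lead_coef p) * xi ^+ (size p).-1).
  split.
  - by rewrite ef_tofrac; apply: lead_at1 => //; apply: leqSpred.
  - by apply: rmorph_mulX_neq0; rewrite ?lead_coef_eq0.
  - by rewrite -mulr_natr natz abszM oddM /= odd_double.
by apply: evendegM => //; apply: evendegV.
Qed.

Variable sigma : {rmorphism kx -> kx}.
Hypothesis g1_ef : forall c, g1 (ef c) = ef (sigma c).
Hypothesis g2_ef : forall c, g2 (ef c) = ef c.

Lemma g1_ev P : g1 (ev P) = ev (map_poly sigma P).
Proof.
rewrite /ev -horner_map /= g1h; congr (_.[h]).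
by apply/polyP => i; rewrite !coef_map /= g1_ef.
Qed.

Lemma g2_ev P : g2 (ev P) = ev (P \Po ('X + 1%:P)).
Proof.
have evP Q R : ev (Q \Po R) = (map_poly ef Q).[ev R].
  by rewrite /ev map_comp_poly horner_comp.
rewrite evP evD evX ev1 /ev -horner_map /= g2h; congr (_.[_]).
by apply/polyP => i; rewrite !coef_map /= g2_ef.
Qed.

(** The variable y, of degree 1, is a quotient of values of [ev], so not all of these have even
    degree. An odd one of least size can be made monic, because its leading coefficient lies in k(f)
    and has even degree. *)
Lemma minimal_odd : exists phi : {poly kx}, [/\ phi \is monic, odddeg (ev phi) &
  forall P : {poly kx}, (size P < size phi)%N -> evendeg (ev P)].
Proof.
have ex : exists n, `[< exists2 P : {poly kx}, size P = n & odddeg (ev P) >].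
  have [[P oP]|nP] := pselect (exists P, odddeg (ev P)).
    by exists (size P); apply/asboolP; exists P.
  have allev P : evendeg (ev P).
    by case: (even_or_odd (ev P)) => // oP; case: nP; exists P.
  have [P [Q e]] := y_in; exfalso.
  apply: (@not_even_odd (kxy_y k)).
    by rewrite e !at2_ev; apply: evendegM => //; apply: evendegV.
  exists 1, 1; split; rewrite ?oner_eq0 //.
  have := @lead_tofrac _ ('X : {poly {poly k}}) 1.
  by rewrite size_polyX coefX tofrac1; apply.
case: (ex_minnP ex) => n /asboolP [P sP oP] min.
have P0 : P != 0.
  apply/eqP => P0; apply: (@not_even_odd 0); first by left.
  by rewrite -ev0 -P0.
have c0 : (lead_coef P)^-1 != 0 by rewrite invr_eq0 lead_coef_eq0.
exists ((lead_coef P)^-1 *: P); split.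
- exact: monic_normalize.
- rewrite -mul_polyC evM evC; apply: odddegM => //; last by rewrite fmorph_eq0.
  exact: evendeg_ef.
- move=> Q; rewrite size_scale // sP => sQ.
  have [//|oQ] := even_or_odd (ev Q).
  have := min (size Q) (asboolT (ex_intro2 _ _ Q erefl oQ)).
  by rewrite leqNgt sQ.
Qed.

Section Reduction.
Variable phi : {poly kx}.
Hypotheses (phi_monic : phi \is monic) (phi_odd : odddeg (ev phi)).
Hypothesis phi_min : forall P : {poly kx}, (size P < size phi)%N -> evendeg (ev P).

Let phi_neq0 : phi != 0. Proof. exact: monic_neq0. Qed.

(* By parity, reduction modulo phi never affects the leading term: the two parts
   of a Euclidean division have degrees of distinct parities. *)
Lemma lead_modp (A B : {poly kx}) (m n : int) a b : (size A < size phi)%N -> (size B < size phi)%N ->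
    lead (ev A) m a -> a != 0 -> ~~ odd `|m| ->
    lead (ev B) n b -> b != 0 -> ~~ odd `|n| ->
  lead (ev ((A * B) %% phi)) (m + n) (a * b).
Proof.
move=> sA sB lA a0 em lB b0 en; have lAB := leadM lA lB.
have ab0 := mulf_neq0 a0 b0.
have emn : ~~ odd `|m + n| by rewrite odd_abszD (negPf em) (negPf en).
set r := (A * B) %% phi; set q := (A * B) %/ phi.
have er : ev r = ev A * ev B - ev q * ev phi.
  rewrite -!evM -evN -evD; congr ev.
  by rewrite {1}(divp_eq (A * B) phi) -/q -/r addrC addKr.
have sr : (size r < size phi)%N by rewrite ltn_modp phi_neq0.
have sq : (size q < size phi)%N.
  exact: size_divpM_lt.
rewrite er; case: (phi_min sq) => [->|[i [c [lq c0 ei]]]].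
  by rewrite mul0r subr0.
have [j [d [lphi d0 oj]]] := phi_odd.
have lE := leadN (leadM lq lphi); have cd0 := mulf_neq0 c0 d0.
have oij : odd `|i + j| by rewrite odd_abszD (negPf ei) oj.
case: (ltgtP (i + j) (m + n)) => [lt|gt|eq].
- by have := leadD lAB (lead_lower lE lt); rewrite addr0.
- exfalso; apply: (not_even_odd (phi_min sr)); exists (i + j), (- (c * d)).
  rewrite oppr_eq0; split=> //; rewrite er.
  by have := leadD (lead_lower lAB gt) lE; rewrite add0r.
- by move: oij; rewrite eq (negPf emn).
Qed.

Fixpoint powmod (Q : {poly kx}) (n : nat) : {poly kx} :=
  if n is n'.+1 then (Q * powmod Q n') %% phi else 1 %% phi.

Lemma size_powmod Q n : (size (powmod Q n) < size phi)%N.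
Proof. by case: n => [|n] /=; rewrite ltn_modp. Qed.

(** The value of a constant polynomial lies in k(f), hence is even. *)
Lemma phi_gt1 : (1 < size phi)%N.
Proof.
rewrite ltnNge; apply/negP => /size1_polyC e; apply: (not_even_odd _ phi_odd).
by rewrite e evC; apply: evendeg_ef.
Qed.

Lemma even_mulrn (m : int) n : ~~ odd `|m| -> ~~ odd `|m *+ n|.
Proof. by move=> em; rewrite -mulr_natr natz abszM oddM (negPf em). Qed.

Lemma lead_powmod (Q : {poly kx}) n (m : int) a : (size Q < size phi)%N ->
    lead (ev Q) m a -> a != 0 -> ~~ odd `|m| ->
  lead (ev (powmod Q n)) (m *+ n) (a ^+ n).
Proof.
move=> sQ lQ a0 em; elim: n => [|n IH] /=.
  by rewrite modp_small ?size_poly1 ?phi_gt1 // ev1; apply: lead1.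
rewrite mulrS exprS; have an0 := expf_neq0 n a0.
exact (lead_modp sQ (size_powmod Q n) lQ a0 em IH an0 (even_mulrn n em)).
Qed.

Lemma no_transcendental_ratio (Q1 Q2 : {poly kx}) (m : int) a1 a2 :
    (size Q1 < size phi)%N -> (size Q2 < size phi)%N -> ~~ odd `|m| ->
    lead (ev Q1) m a1 -> a1 != 0 -> lead (ev Q2) m a2 -> a2 != 0 ->
  exists z, a2 = @kx_cst k z * a1.
Proof.
move=> sQ1 sQ2 em l1 a10 l2 a20; set d := (size phi).-1.
(* These [d + 1] polynomials of size at most [d] are linearly dependent over k(f), while all their
   values have degree [m *+ d] in y. *)
pose r (i : nat) := (powmod Q2 i * powmod Q1 (d - i)) %% phi.
have lr (i : 'I_d.+1) : lead (ev (r i)) (m *+ d) (a2 ^+ i * a1 ^+ (d - i)).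
  have := lead_modp (size_powmod _ _) (size_powmod _ _)
    (lead_powmod i sQ2 l2 a20 em) (expf_neq0 i a20) (even_mulrn i em)
    (lead_powmod (d - i) sQ1 l1 a10 em) (expf_neq0 (d - i) a10) (even_mulrn (d - i) em).
  by rewrite -mulrnDr subnKC // -ltnS ltn_ord.
have sr i : (size (r i) <= d)%N.
  by rewrite -ltnS /d prednK ?ltn_modp // size_poly_gt0.
have [c c0 cr] := left_kernel_neq0 (\matrix_i poly_rV (r i) : 'M[kx]_(d.+1, d)).
have sum0 : \sum_(i < d.+1) c 0 i *: r i = 0.
  apply/polyP => j; rewrite coef0 coef_sum.
  have [dj|jd] := leqP d j.
    by apply: big1 => i _; rewrite coefZ nth_default ?mulr0 // (leq_trans (sr i)).
  have /rowP /(_ (Ordinal jd)) := cr; rewrite !mxE => cr0; rewrite -[RHS]cr0.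
  by apply: eq_bigr => i _; rewrite coefZ !mxE.
have [D [p [D0 cp]]] := common_denominator (fun i => c 0 i).
(* [N] is the largest degree of the coefficients after clearing denominators: in this degree they do
   not all vanish, and all terms of the relation can be compared in the single degree
   [mu *+ N + m *+ d] of y. *)
pose N := (\max_(i < d.+1) size (p i)).-1.
have sp i : (size (p i) <= N.+1)%N.
  exact: leq_trans (leq_bigmax i) (leqSpred _).
have [j [xi [lf xi0]]] := lead_f; set mu := (j.*2.+2)%:Z in lf.
have ev0' : \sum_(i < d.+1) at1 (@kxy_cst k) f (p i) * ev (r i) = 0.
  rewrite (_ : \sum_i _ = ev (\sum_(i < d.+1) (tofrac D * c 0 i) *: r i)).
    rewrite (eq_bigr (fun i => tofrac D *: (c 0 i *: r i))).
      by rewrite -scaler_sumr sum0 scaler0 ev0.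
    by move=> i _; rewrite scalerA.
  rewrite (big_morph ev evD ev0); apply: eq_bigr => i _.
  by rewrite -mul_polyC evM evC mulrC [tofrac D * _]mulrC cp ef_tofrac mulrC.
have lsum : lead (\sum_(i < d.+1) at1 (@kxy_cst k) f (p i) * ev (r i))
    (mu *+ N + m *+ d)
    (\sum_(i < d.+1) @kx_cst k (p i)`_N * xi ^+ N * (a2 ^+ i * a1 ^+ (d - i))).
  apply: (big_ind2 (fun u l => lead u (mu *+ N + m *+ d) l)).
  - exact: lead0.
  - by move=> u l u' l'; apply: leadD.
  - by move=> i _; apply: leadM (lr i); apply: lead_at1.
rewrite ev0' in lsum; have := lead_uniq lsum (lead0 _ _) => e.
apply: (closed_ratio_const (n := d.+1) (a := fun i => (p i)`_N) a10).
- have [i ci] : exists i, c 0 i != 0.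
    apply/existsP; apply: contraNT c0; rewrite negb_exists => /forallP h0.
    by apply/eqP/rowP => i; rewrite mxE; apply/eqP; have := h0 i; rewrite negbK.
  have pi0 : (0 < \max_(i < d.+1) size (p i))%N.
    apply: leq_trans (leq_bigmax i); rewrite size_poly_gt0.
    apply: contraNneq ci => pi0; have := cp i; rewrite pi0 tofrac0 => /eqP.
    by rewrite mulf_eq0 tofrac_eq0 (negPf D0) orbF.
  have [|i' ei'] := bigop.eq_bigmax (fun i : 'I_d.+1 => size (p i)).
    by rewrite card_ord.
  exists i'; have pi' : p i' != 0 by rewrite -size_poly_gt0 -ei'.
  by rewrite /N ei' -lead_coefE lead_coef_eq0.
- have xiN := expf_neq0 N xi0; apply: (mulIf xiN); rewrite mul0r -[RHS]e mulr_suml.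
  by apply: eq_bigr => i _; rewrite mulrAC.
Qed.

End Reduction.

Lemma no_translation_pair : False.
Proof.
have [phi [mphi ophi min]] := minimal_odd.
have [m [l [lphi l0 om]]] := ophi.
have em : ~~ odd `|m - 1| by rewrite odd_abszD om.
(* The values of [Q1] and [Q2] are the differences of [ev phi] under [g1] and [g2]: the first map
   moves only the coefficients, the second only [h]. *)
pose Q1 := map_poly sigma phi - phi; pose Q2 := (phi \Po ('X + 1%:P)) - phi.
have sQ1 : (size Q1 < size phi)%N.
  by apply: size_monic_sub; rewrite ?map_monic ?size_map_poly.
have sQ2 : (size Q2 < size phi)%N.
  by apply: size_monic_sub; rewrite ?monic_comp_XaddC ?size_comp_poly2 ?size_XaddC.
have l1 : lead (ev Q1) (m - 1) (l * tofrac s1).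
  by rewrite evD evN -g1_ev; apply: odd_shift_neq0.
have l2 : lead (ev Q2) (m - 1) (l * tofrac s2).
  by rewrite evD evN -g2_ev; apply: odd_shift_neq0.
have t1 : tofrac s1 != 0 :> kx by rewrite tofrac_eq0.
have t2 : tofrac s2 != 0 :> kx by rewrite tofrac_eq0.
have a1 := mulf_neq0 l0 t1; have a2 := mulf_neq0 l0 t2.
have [z e] := no_transcendental_ratio mphi ophi min sQ1 sQ2 em l1 a1 l2 a2.
have {}e : tofrac s2 = @kx_cst k z * tofrac s1 by apply: (mulfI l0); rewrite e mulrCA.
move: e; rewrite /kx_cst /= -tofracM => /eqP; rewrite tofrac_eq mul_polyC.
by rewrite (negPf (s12 z)).
Qed.

End TranslationPairs.

(** * Linear and affine maps as elements of the Cremona group *)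

Lemma rmorph_at1 (k L L' : fieldType) (c : {rmorphism k -> L})
    (c' : {rmorphism k -> L'}) (g : {rmorphism L -> L'}) t p :
  (forall a, g (c a) = c' a) -> g (at1 c t p) = at1 c' (g t) p.
Proof.
move=> gc; elim/poly_ind: p => [|p a IH]; first by rewrite !rmorph0.
by rewrite !rmorphD !rmorphM /= !at1C !at1X IH gc.
Qed.

Lemma fraction_rmorph_ext (R : idomainType) (L : fieldType)
    (g g' : {rmorphism {fraction R} -> L}) :
  (forall p, g (tofrac p) = g' (tofrac p)) -> forall c, g c = g' c.
Proof. by move=> e c; rewrite (fracE c) !fmorph_div !e. Qed.

Section Linear.
Variable k : fieldType.
Local Notation F := {fraction {poly {poly k}}}.
Local Notation cst := (@kxy_cst k).
Local Notation x := (kxy_x k).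
Local Notation y := (kxy_y k).

Lemma lin_mapZ (c : k) (A : 'M[k]_3) : c != 0 -> lin_map (c *: A) = lin_map A.
Proof.
move=> c0; rewrite /lin_map map_mxZ -scalemxAl /affine_pt /=.
by congr pair; apply: scale_div; rewrite fmorph_eq0.
Qed.

Lemma lin_pgl (A : 'M[k]_3) : A \in unitmx -> crval (lin (pgl A)) = lin_map A.
Proof. by move=> uA; rewrite /lin /=; have [c c0 ->] := pgl_repr uA; apply: lin_mapZ. Qed.

Lemma linM (u v : PGL 3 k) : lin (u * v)%g = (lin u * lin v)%g.
Proof.
have [A uA ->] := pglP u; have [B uB ->] := pglP v; apply: val_inj.
change (crval (lin (pgl A * pgl B)%g) =
  ratmap_comp (crval (lin (pgl A))) (crval (lin (pgl B)))).
have uAB : A *m B \in unitmx by rewrite unitmx_mul uA.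
by rewrite (pglM uA uB) (lin_pgl uA) (lin_pgl uB) (lin_pgl uAB) lin_map_mul.
Qed.

Lemma lin1 : lin 1%g = 1%g :> Cr k.
Proof. by apply: (mulgI (lin 1%g)); rewrite -linM !mulg1. Qed.

Lemma linV (u : PGL 3 k) : lin u^-1%g = (lin u)^-1%g.
Proof. by apply: (mulgI (lin u)); rewrite -linM !mulgV lin1. Qed.

Lemma lin_klein a b : @lin k @` klein_set a b = klein_set (lin a) (lin b).
Proof.
rewrite eqEsubset; split=> z.
- by move=> [w [] -> <-]; rewrite ?lin1 ?linM;
    first [by constructor 1|by constructor 2|by constructor 3|by constructor 4].
- case=> ->.
  + by exists 1%g; rewrite ?lin1 //; constructor 1.
  + by exists a => //; constructor 2.
  + by exists b => //; constructor 3.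
  + by exists (a * b)%g; rewrite ?linM //; constructor 4.
Qed.

Definition affine_mx (a b e c d f : k) : 'M[k]_3 :=
  mx_of_rows 3 [:: [:: a; b; e]; [:: c; d; f]; [:: 0; 0; 1]].

Lemma mx_of_rowsM3 (M N : seq (seq k)) :
  mx_of_rows 3 M *m mx_of_rows 3 N = \matrix_(i, j)
    ((nth [::] M i)`_0 * (nth [::] N 0)`_j + (nth [::] M i)`_1 * (nth [::] N 1)`_j
      + (nth [::] M i)`_2 * (nth [::] N 2)`_j).
Proof.
by apply/matrixP => i j; rewrite !mxE !big_ord_recl big_ord0 !mxE /= addr0 addrA.
Qed.

Lemma affine_mxM a b e c d f a' b' e' c' d' f' :
  affine_mx a b e c d f *m affine_mx a' b' e' c' d' f' =
  affine_mx (a * a' + b * c') (a * b' + b * d') (a * e' + b * f' + e)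
            (c * a' + d * c') (c * b' + d * d') (c * e' + d * f' + f).
Proof.
rewrite /affine_mx mx_of_rowsM3; apply/matrixP => -[[|[|[|//]]] i] [[|[|[|//]]] j];
  by rewrite !mxE /= ?(mulr0, mul0r, addr0, add0r, mulr1).
Qed.

Lemma affine_mx1 : affine_mx 1 0 0 0 1 0 = 1%:M.
Proof. by apply/matrixP => -[[|[|[|//]]] i] [[|[|[|//]]] j]; rewrite !mxE. Qed.

Lemma lin_formE (A : 'M[k]_3) i :
  (map_mx cst A *m homogeneous_pt (@ratmap_id k)) i 0 =
  cst (A i 0) * x + cst (A i 1) * y + cst (A i 2).
Proof.
rewrite mxE (bigD1 0) // (bigD1 1) //= (bigD1 2) //= big1; last by case=> -[|[|[|]]].
by rewrite !mxE /= mulr1 addr0 addrA.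
Qed.

Lemma lin_map_affine a b e c d f : lin_map (affine_mx a b e c d f) =
  (cst a * x + cst b * y + cst e, cst c * x + cst d * y + cst f).
Proof.
set A := affine_mx _ _ _ _ _ _.
have A2 j : A 2 j = (j == 2)%:R by rewrite !mxE /=; case: j => -[|[|[|]]].
have d1 : (map_mx cst A *m homogeneous_pt (@ratmap_id k)) 2 0 = 1.
  by rewrite lin_formE !A2 /= !rmorph0 rmorph1 !mul0r !add0r.
rewrite /lin_map /affine_pt d1 !divr1 !lin_formE.
by rewrite /A /affine_mx !mxE.
Qed.

End Linear.

Section SubstitutionMorphism.
Variable k : fieldType.
Local Notation F := {fraction {poly {poly k}}}.
Local Notation cst := (@kxy_cst k).
Variables (v : F * F) (dv : dominant v).

Definition subst_rmorphism : {rmorphism F -> F} := fracmap_rmorphism dv.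

Lemma subst_rmorphismE u : kxy_subst v u = subst_rmorphism u.
Proof. by []. Qed.

Lemma subst_tofrac P : subst_rmorphism (tofrac P) = at2 cst v.1 v.2 P.
Proof. exact: fracmap_tofrac dv P. Qed.

Lemma subst_x : subst_rmorphism (kxy_x k) = v.1.
Proof. by rewrite /kxy_x subst_tofrac at2C at1X. Qed.

Lemma subst_y : subst_rmorphism (kxy_y k) = v.2.
Proof. by rewrite /kxy_y subst_tofrac at2X. Qed.

Lemma subst_cst a : subst_rmorphism (cst a) = cst a.
Proof. by rewrite subst_tofrac at2C at1C. Qed.

End SubstitutionMorphism.

(** * Pairs of translations in the Cremona group *)

Section NotBirationallyConjugate.
Variable k : closedFieldType.
Hypothesis pchar2 : 2%N \in [pchar k].
Local Notation kx := {fraction {poly k}}.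
Local Notation F := {fraction {poly {poly k}}}.
Local Notation cst := (@kxy_cst k).
Local Notation x := (kxy_x k).
Local Notation y := (kxy_y k).

Lemma subst_shift (s : {poly k}) (d : dominant (x, y + tofrac s%:P)) p :
  subst_rmorphism d (tofrac p) = tofrac (p \Po ('X + s%:P)).
Proof.
rewrite subst_tofrac /=; elim/poly_ind: p => [|p c IH].
  by rewrite rmorph0 comp_poly0 tofrac0.
rewrite comp_polyD comp_polyM comp_polyX comp_polyC !rmorphD !rmorphM /= IH.
by rewrite at2C at2X at1_kxy [in RHS]rmorphD.
Qed.

(** The components of [psi] serve as the generators [f] and [h] of k(x, y); the inverse of [psi]
    expresses y through them. On k(f), the first translation induces x -> x + 1. *)
Lemma no_translation_pair_Cr (psi w1 w2 : Cr k) (s1 s2 : {poly k}) :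
    s1 != 0 -> s2 != 0 -> (forall a : k, s2 != a *: s1) ->
    crval w1 = (x, y + tofrac s1%:P) -> crval w2 = (x, y + tofrac s2%:P) ->
    ratmap_comp (crval psi) (crval w1) = ((crval psi).1 + 1, (crval psi).2) ->
    ratmap_comp (crval psi) (crval w2) = ((crval psi).1, (crval psi).2 + 1) ->
  False.
Proof.
move=> s10 s20 s12 e1 e2.
have d1 := @Cr_dominant k w1; have d2 := @Cr_dominant k w2.
rewrite e1 in d1 *; rewrite e2 in d2 *; have dpsi := @Cr_dominant k psi.
move: (Cr_birational psi) dpsi; case: (crval psi) => f h /= [_ [w [dw _ wK]]] dpsi.
rewrite /ratmap_comp /= !(subst_rmorphismE d1) !(subst_rmorphismE d2).
move=> e1' e2'.
have f1 : subst_rmorphism d1 f = f + 1 by case: e1'.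
have h1 : subst_rmorphism d1 h = h by case: e1'.
have f2 : subst_rmorphism d2 f = f by case: e2'.
have h2 : subst_rmorphism d2 h = h + 1 by case: e2'.
have inj p : at1 cst f p = 0 -> p = 0.
  move=> p0; have := dpsi p%:P; rewrite /= at2C p0 => /(_ erefl)/eqP.
  by rewrite polyC_eq0 => /eqP.
have ufr := tr_mx_unit (1 : k).
have [ef efE] : exists ef : {rmorphism kx -> F}, forall p, ef (tofrac p) = at1 cst f p.
  by exists (fracmap_rmorphism inj) => p; exact: fracmap_tofrac inj p.
have [sg sgE] : exists sg : {rmorphism kx -> kx},
    forall p, sg (tofrac p) = at1 (@kx_cst k) (kx_x k + 1) p.
  exists (mobius_kx_rmorphism ufr) => p.
  rewrite -[LHS]/(mobius_kx _ (tofrac p)) /mobius_kx /kx_subst fracmap_tofrac.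
    by rewrite /= /mobius !mxE /= rmorph0 rmorph1 mul0r mul1r add0r divr1.
  exact: mobius_kx_inj ufr.
have g1c a : subst_rmorphism d1 (cst a) = cst a by exact: subst_cst.
have g2c a : subst_rmorphism d2 (cst a) = cst a by exact: subst_cst.
have efc a : ef (@kx_cst k a) = cst a.
  by rewrite -[RHS](at1C cst f) -efE.
have g1ef : forall c, subst_rmorphism d1 (ef c) = ef (sg c).
  apply: (@fraction_rmorph_ext _ _ (subst_rmorphism d1 \o ef) (ef \o sg)) => p.
  rewrite -[LHS]/(subst_rmorphism d1 (ef (tofrac p))) efE (rmorph_at1 f p g1c) f1.
  rewrite -[RHS]/(ef (sg (tofrac p))) sgE (rmorph_at1 _ p efc).
  by rewrite rmorphD rmorph1 efE at1X.
have g2ef : forall c, subst_rmorphism d2 (ef c) = ef c.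
  apply: (@fraction_rmorph_ext _ _ (subst_rmorphism d2 \o ef) ef) => p.
  by rewrite -[LHS]/(subst_rmorphism d2 (ef (tofrac p))) efE (rmorph_at1 f p g2c) f2.
apply: (no_translation_pair pchar2 (subst_shift d1) (subst_shift d2) s10 s20 s12
  f1 f2 h1 h2 _ efE g1ef g2ef).
by move: wK => [_ <-]; exists \n_(repr w.2), \d_(repr w.2).
Qed.

End NotBirationallyConjugate.

(** * The Klein subgroups of PGL(3, k) *)

Section UnitriangularMatrices.
Variable k : fieldType.

(* [1 a b; 0 1 c; 0 0 1] *)
Definition uni_mx (a b c : k) : 'M[k]_3 := affine_mx 1 a b 0 1 c.

Lemma uni_mxM a b c a' b' c' :
  uni_mx a b c *m uni_mx a' b' c' = uni_mx (a + a') (b + b' + a * c') (c + c').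
Proof. by rewrite /uni_mx affine_mxM; congr affine_mx; ring. Qed.

Lemma uni_mx0 : uni_mx 0 0 0 = 1%:M.
Proof. exact: affine_mx1. Qed.

Lemma uni_mx_unit a b c : uni_mx a b c \in unitmx.
Proof.
have : uni_mx a b c *m uni_mx (- a) (- b + a * c) (- c) = 1%:M.
  by rewrite -uni_mx0 uni_mxM; congr uni_mx; ring.
by case/mulmx1_unit.
Qed.

Lemma pgl_uniM a b c a' b' c' : (pgl (uni_mx a b c) * pgl (uni_mx a' b' c'))%g =
  pgl (uni_mx (a + a') (b + b' + a * c') (c + c')).
Proof. by rewrite pglM ?uni_mx_unit // uni_mxM. Qed.

Lemma pgl_uni0 : pgl (uni_mx 0 0 0) = 1%g.
Proof. by rewrite uni_mx0 pgl1. Qed.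

Lemma lin_uniE a b c : crval (lin (pgl (uni_mx a b c))) =
  (kxy_x k + @kxy_cst k a * kxy_y k + @kxy_cst k b, kxy_y k + @kxy_cst k c).
Proof.
by rewrite lin_pgl ?uni_mx_unit // lin_map_affine !rmorph1 !rmorph0 !mul1r mul0r add0r.
Qed.

End UnitriangularMatrices.

Lemma crvalM (k : fieldType) (u v : Cr k) :
  crval (u * v)%g = ratmap_comp (crval u) (crval v).
Proof. by []. Qed.

Section KleinGroups.
Variable k : closedFieldType.
Hypothesis pchar2 : 2%N \in [pchar k].
Local Notation x := (kxy_x k).
Local Notation y := (kxy_y k).

Let addkk (a : k) : a + a = 0.
Proof. by rewrite -mulr2n -mulr_natr (pcharf0 pchar2) mulr0. Qed.

Lemma generated_uni (a b c a' b' c' : k) : a * c = 0 -> a' * c' = 0 -> a * c' = a' * c ->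
  generated [set pgl (uni_mx a b c); pgl (uni_mx a' b' c')] =
  klein_set (pgl (uni_mx a b c)) (pgl (uni_mx a' b' c')).
Proof.
move=> ac ac' acc; apply: generated_klein; rewrite !pgl_uniM.
- by rewrite ac !addkk ?addr0 pgl_uni0.
- by rewrite ac' !addkk ?addr0 pgl_uni0.
- by rewrite acc addrC [b + _]addrC [c + _]addrC.
Qed.

Lemma kleinG1E : kleinG1 k = klein_set (pgl (uni_mx 0 0 1)) (pgl (uni_mx 0 1 0)).
Proof. by apply: generated_uni; rewrite ?mul0r ?mulr0. Qed.

Lemma kleinG2E : kleinG2 k = klein_set (pgl (uni_mx 1 0 0)) (pgl (uni_mx 0 1 0)).
Proof. by apply: generated_uni; rewrite ?mul0r ?mulr0. Qed.

Lemma kleinG3E (t : k) : kleinG3 t = klein_set (pgl (uni_mx 1 0 0)) (pgl (uni_mx t 0 0)).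
Proof. by apply: generated_uni; rewrite ?mul0r ?mulr0. Qed.

Lemma lin_uni_neq (a b c b' c' : k) : b != b' \/ c != c' ->
  lin (pgl (uni_mx a b c)) <> lin (pgl (uni_mx a b' c')).
Proof.
move=> ne /(congr1 (@crval k)); rewrite !lin_uniE => -[/addrI /fmorph_inj e1].
by move=> /addrI /fmorph_inj e2; case: ne; rewrite ?e1 ?e2 eqxx.
Qed.

(** After exchange of the two coordinates, the second group consists of maps (x, y + s(x)) with s in
    the F_2-span of x and 1. A conjugating map then provides the pair excluded by
    [no_translation_pair_Cr]. *)
Theorem G1_G2_not_birationally_conjugate :
  ~ birationally_conjugate (kleinG1 k) (kleinG2 k).
Proof.
move=> [phi _]; rewrite kleinG1E kleinG2E !lin_klein conj_klein.
set a := lin (pgl (uni_mx 0 0 1)); set b := lin (pgl (uni_mx 0 1 0)) => e.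
have mem2 u : klein_set (a ^ phi)%g (b ^ phi)%g u ->
    exists p q : bool, u = lin (pgl (uni_mx p%:R q%:R 0)).
  rewrite e /klein_set /= -lin1 -linM -pgl_uni0 pgl_uniM => -[] ->.
  - by exists false, false.
  - by exists true, false.
  - by exists false, true.
  - by exists true, true; rewrite !addr0 !add0r mulr0 addr0.
have [p2 [q2 ea]] := mem2 (a ^ phi)%g (Or42 _ _ _ erefl).
have [p1 [q1 eb]] := mem2 (b ^ phi)%g (Or43 _ _ _ erefl).
have conj_inj := @conjg_inj (Cr k) phi.
have a1 : a <> 1%g by rewrite -lin1 -pgl_uni0; apply: lin_uni_neq; right; rewrite oner_eq0.
have b1 : b <> 1%g by rewrite -lin1 -pgl_uni0; apply: lin_uni_neq; left; rewrite oner_eq0.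
have ab : a <> b by apply: lin_uni_neq; right; rewrite oner_eq0.
have ne1 : p1 || q1.
  apply/negPn; rewrite negb_or; apply/negP => /andP[/negPf p0 /negPf q0]; apply: b1.
  by apply: conj_inj; rewrite eb p0 q0 pgl_uni0 lin1 conj1g.
have ne2 : p2 || q2.
  apply/negPn; rewrite negb_or; apply/negP => /andP[/negPf p0 /negPf q0]; apply: a1.
  by apply: conj_inj; rewrite ea p0 q0 pgl_uni0 lin1 conj1g.
have ne12 : (p1 != p2) || (q1 != q2).
  apply/negPn; rewrite negb_or !negbK; apply/negP => /andP[/eqP ep /eqP eq].
  by apply: ab; apply: conj_inj; rewrite ea eb ep eq.
(* [S] exchanges the coordinates and turns [uni_mx p q 0], acting by (x + p y + q, y), into [W p q],
   acting by (x, y + p x + q). *)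
pose S : 'M[k]_3 := affine_mx 0 1 0 1 0 0.
pose W (p q : bool) : 'M[k]_3 := affine_mx 1 0 0 p%:R 1 q%:R.
pose s (p q : bool) : {poly k} := p%:R *: 'X + q%:R%:P.
have S2 : S *m S = 1%:M by rewrite affine_mxM -affine_mx1; congr affine_mx; ring.
have uS : S \in unitmx by case/mulmx1_unit: S2.
have SW (p q : bool) : uni_mx p%:R q%:R 0 *m S = S *m W p q.
  by rewrite !affine_mxM; congr affine_mx; ring.
have uW (p q : bool) : W p q \in unitmx.
  have : W p q \in unitmx = (S *m W p q \in unitmx) by rewrite unitmx_mul uS.
  by move=> ->; rewrite -SW unitmx_mul uS uni_mx_unit.
have Wmap (p q : bool) : crval (lin (pgl (W p q))) = (x, y + tofrac (s p q)%:P).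
  rewrite lin_pgl // lin_map_affine !rmorph0 !rmorph1 !mul1r mul0r !addr0.
  congr pair; rewrite -addrA [LHS]addrCA; congr (_ + _).
  by rewrite /s polyCD -mul_polyC !(tofracD, tofracM, polyCM).
pose psi : Cr k := (phi * lin (pgl S))%g.
have comm u (p q : bool) : (u ^ phi)%g = lin (pgl (uni_mx p%:R q%:R 0)) ->
    (psi * lin (pgl (W p q)) = u * psi)%g.
  move=> eu; rewrite /psi -mulgA -linM pglM // -SW -pglM ?uni_mx_unit // linM -eu.
  by rewrite conjgE !mulgA mulgV mul1g.
have s0 (p q : bool) : p || q -> s p q != 0.
  apply: contraTneq => s0; have := congr1 (fun r : {poly k} => r`_0) s0.
  have := congr1 (fun r : {poly k} => r`_1) s0.
  rewrite /s !(coefD, coefZ, coefX, coefC, coef0) /= !(mulr1, mulr0, addr0, add0r).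
  by case: p s0 => _; case: q => //= /eqP; rewrite ?oner_eq0 // => _ /eqP; rewrite oner_eq0.
apply: (@no_translation_pair_Cr _ pchar2 psi _ _ _ _ (s0 _ _ ne1) (s0 _ _ ne2) _ (Wmap p1 q1) (Wmap p2 q2)).
(* Two distinct nonzero vectors of F_2^2 have nonzero determinant, so [s p2 q2] is not a multiple of
   [s p1 q1]. *)
- move=> z; apply/eqP => sz; have e0 := congr1 (fun r : {poly k} => r`_0) sz.
  have e1 := congr1 (fun r : {poly k} => r`_1) sz.
  move: e0 e1; rewrite /s !(coefD, coefZ, coefX, coefC) /= !(mulr1, mulr0, addr0, add0r).
  move=> e0 e1; have : p2%:R * q1%:R = q2%:R * p1%:R :> k by rewrite e0 e1; ring.
  rewrite -!natrM !mulnb; move: ne1 ne2 ne12.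
  by case: (p1); case: (q1); case: (p2); case: (q2) => //= _ _ _ /eqP;
    rewrite ?(eq_sym 0) oner_eq0.
- rewrite -crvalM (comm _ _ _ eb) crvalM.
  rewrite lin_uniE rmorph0 rmorph1 mul0r !addr0 /ratmap_comp.
  have d := @Cr_dominant k psi; rewrite !(subst_rmorphismE d).
  by rewrite -[(_, _).1]/(x + 1) rmorphD rmorph1 subst_x subst_y.
- rewrite -crvalM (comm _ _ _ ea) crvalM.
  rewrite lin_uniE rmorph0 rmorph1 mul0r !addr0 /ratmap_comp.
  have d := @Cr_dominant k psi; rewrite !(subst_rmorphismE d).
  by rewrite -[(_, _).2]/(y + 1) rmorphD rmorph1 subst_x subst_y.
Qed.

End KleinGroups.

Lemma birational_of_conjugate (k : fieldType) (H H' : set (PGL 3 k)) :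
  conjugate H H' -> birationally_conjugate H H'.
Proof.
move=> [g _ <-]; exists (lin g) => //; rewrite eqEsubset; split=> z.
- move=> [_ [h Hh <-] <-]; exists (h ^ g)%g; first by exists h.
  by rewrite !conjgE !linM linV.
- move=> [_ [h Hh <-] <-]; exists (lin h); first by exists h.
  by rewrite !conjgE !linM linV.
Qed.

(** * Conjugacy among the three types in PGL(3, k) *)

Section Transvections.
Variable k : closedFieldType.
Hypothesis pchar2 : 2%N \in [pchar k].

Let addkk (a : k) : a + a = 0.
Proof. by rewrite -mulr2n -mulr_natr (pcharf0 pchar2) mulr0. Qed.

Lemma mxtrace_uni (a b c : k) : \tr (uni_mx a b c) = 1.
Proof.
by rewrite /mxtrace !big_ord_recl big_ord0 !mxE /= addr0 addkk addr0.
Qed.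

(** Equality in PGL leaves a scalar, and comparison of traces shows that it is 1: the trace 3 of a
    unitriangular matrix is 1 in characteristic 2. *)
Lemma conj_uni_eq (a b c a' b' c' : k) (P : 'M[k]_3) : P \in unitmx ->
    (pgl (uni_mx a b c) * pgl P = pgl P * pgl (uni_mx a' b' c'))%g ->
  uni_mx a b c *m P = P *m uni_mx a' b' c'.
Proof.
move=> uP; have uU := uni_mx_unit a b c; have uU' := uni_mx_unit a' b' c'.
rewrite !pglM // => /pgl_eq; rewrite !unitmx_mul uP uU uU' => /(_ isT isT) [d d0 e].
suff d1 : d = 1 by rewrite e d1 scale1r.
have eU : uni_mx a b c = d *: (P *m uni_mx a' b' c') *m invmx P by rewrite -e mulmxK.
by rewrite -(mxtrace_uni a b c) eU -scalemxAl mxtraceZ mxtrace_mulC mulKmx // mxtrace_uni mulr1.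
Qed.

Lemma uni_mx_mulE (a b c : k) (P : 'M[k]_3) i j : (uni_mx a b c *m P) i j =
  [:: P 0 j + a * P 1 j + b * P 2 j; P 1 j + c * P 2 j; P 2 j]`_i.
Proof.
rewrite !mxE !big_ord_recl big_ord0 !mxE /=.
have -> : lift ord0 ord0 = 1 :> 'I_3 by apply: val_inj.
have -> : lift ord0 (lift ord0 ord0) = 2 :> 'I_3 by apply: val_inj.
by case: i => -[|[|[|//]]] i /=; rewrite ?(mul1r, mul0r, addr0, add0r) ?addrA.
Qed.

Lemma mul_uni_mxE (a b c : k) (P : 'M[k]_3) i j : (P *m uni_mx a b c) i j =
  [:: P i 0; P i 0 * a + P i 1; P i 0 * b + P i 1 * c + P i 2]`_j.
Proof.
rewrite !mxE !big_ord_recl big_ord0 !mxE /=.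
have -> : lift ord0 ord0 = 1 :> 'I_3 by apply: val_inj.
have -> : lift ord0 (lift ord0 ord0) = 2 :> 'I_3 by apply: val_inj.
by case: j => -[|[|[|//]]] j /=; rewrite ?(mulr1, mulr0, addr0, add0r) ?addrA.
Qed.

Lemma unitmx_row_neq0 (P : 'M[k]_3) i : P \in unitmx -> ~ (forall j, P i j = 0).
Proof.
move=> uP Pi; have r0 : row i P = 0 by apply/rowP => j; rewrite !mxE.
have : row i (P *m invmx P) = 0 by rewrite row_mul r0 mul0mx.
by rewrite mulmxV // => /rowP /(_ i); rewrite !mxE eqxx => /eqP; rewrite oner_eq0.
Qed.

Lemma unitmx_col_neq0 (P : 'M[k]_3) j : P \in unitmx -> ~ (forall i, P i j = 0).
Proof.
rewrite -unitmx_tr => uP Pj; apply: (unitmx_row_neq0 (i := j) uP) => i.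
by rewrite mxE.
Qed.

Lemma klein3_mem (t : k) u :
  klein_set (pgl (uni_mx 1 0 0)) (pgl (uni_mx t 0 0)) u ->
  exists2 s : k, s \in [:: 0; 1; t; t + 1] & u = pgl (uni_mx s 0 0).
Proof.
case=> ->.
- by exists 0; rewrite ?inE ?eqxx // pgl_uni0.
- by exists 1; rewrite ?inE ?eqxx ?orbT.
- by exists t; rewrite ?inE ?eqxx ?orbT.
- by exists (t + 1); rewrite ?inE ?eqxx ?orbT // pgl_uniM !(addr0, mulr0) addrC.
Qed.

(** Comparison of entries in the two intertwining relations makes the last row of [P] vanish. *)
Lemma G1_G3_not_conjugate (t : k) : ~ conjugate (kleinG1 k) (kleinG3 t).
Proof.
rewrite kleinG1E // kleinG3E // => -[g _]; rewrite conj_klein => e.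
have [P uP eg] := pglP g.
have cj u : klein_set (pgl (uni_mx 0 0 1) ^ g)%g (pgl (uni_mx 0 1 0) ^ g)%g (u ^ g)%g ->
    exists s : k, (u * pgl P = pgl P * pgl (uni_mx s 0 0))%g.
  rewrite e => /klein3_mem [s _ eu]; exists s; rewrite -eu conjgE eg.
  by rewrite !mulgA mulgV mul1g.
have [s es] := cj _ (Or42 _ _ _ erefl); have [r er] := cj _ (Or43 _ _ _ erefl).
have E i j := congr1 (fun M : 'M_3 => M i j) (conj_uni_eq uP es).
have E' i j := congr1 (fun M : 'M_3 => M i j) (conj_uni_eq uP er).
have {}E i j := etrans (esym (uni_mx_mulE _ _ _ P i j)) (etrans (E i j) (mul_uni_mxE _ _ _ P i j)).
have {}E' i j := etrans (esym (uni_mx_mulE _ _ _ P i j)) (etrans (E' i j) (mul_uni_mxE _ _ _ P i j)).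
have e10 := E 1 0; have e12 := E 1 2; have e11 := E 1 1; have e01 := E 0 1.
have f01 := E' 0 1; have f11 := E' 1 1.
move: e10 e12 e11 e01 f01 f11.
rewrite /= !mul1r !mul0r !mulr0 !addr0 !add0r => e10 e12 e11 e01 f01 f11.
have P20 : P 2 0 = 0 by apply: (addrI (P 1 0)); rewrite e10 addr0.
have P22 : P 2 2 = 0 by apply: (addrI (P 1 2)); rewrite e12 addr0.
have {e11}P21 : P 2 1 = P 1 0 * s by apply: (addrI (P 1 1)); rewrite e11 addrC.
have {f01}P21' : P 2 1 = P 0 0 * r by apply: (addrI (P 0 1)); rewrite f01 addrC.
have {e01}s0 : P 0 0 * s = 0 by apply: (addIr (P 0 1)); rewrite add0r.
have {f11}r0 : P 1 0 * r = 0 by apply: (addIr (P 1 1)); rewrite add0r.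
(* The two expressions of [P 2 1] multiply to a product containing the vanishing terms [P 0 0 * s]
   and [P 1 0 * r]. *)
have P21_0 : P 2 1 = 0.
  apply/eqP; rewrite -sqrf_eq0 expr2 {1}P21 P21'.
  have -> : P 1 0 * s * (P 0 0 * r) = P 0 0 * s * (P 1 0 * r) by ring.
  by rewrite s0 mul0r.
apply: (unitmx_row_neq0 (i := 2) uP) => -[[|[|[|//]]] i].
- by rewrite -[RHS]P20; congr (P _ _); apply: val_inj.
- by rewrite -[RHS]P21_0; congr (P _ _); apply: val_inj.
- by rewrite -[RHS]P22; congr (P _ _); apply: val_inj.
Qed.

Lemma pgl_uni_inj (s s' : k) : pgl (uni_mx s 0 0) = pgl (uni_mx s' 0 0) -> s = s'.
Proof.
move/pgl_eq => /(_ (uni_mx_unit _ _ _) (uni_mx_unit _ _ _)) [c _ e].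
have := congr1 (fun M : 'M_3 => M 0 0) e; have := congr1 (fun M : 'M_3 => M 0 1) e.
by rewrite !mxE /= mulr1 => -> <-; rewrite mul1r.
Qed.

Definition klein3 (s t : k) : set (PGL 3 k) :=
  klein_set (pgl (uni_mx s 0 0)) (pgl (uni_mx t 0 0)).

Lemma klein3_swap s t : klein3 s t = klein3 t s.
Proof. by apply: klein_set_swap; rewrite !pgl_uniM !(addr0, mulr0) addrC. Qed.

Lemma klein3_shear s t : klein3 s t = klein3 s (s + t).
Proof.
have e u v : (pgl (uni_mx u 0 0) * pgl (uni_mx v 0 0))%g = pgl (uni_mx (u + v) 0 0).
  by rewrite pgl_uniM !(addr0, mulr0).
rewrite eqEsubset; split=> x; rewrite /klein3 /klein_set /= !e addrA addkk add0r;
  case=> ->; by [constructor 1|constructor 2|constructor 3|constructor 4].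
Qed.

(** Conjugation by the diagonal matrix with entries 1, s, 1 multiplies the parameter of the
    transvections by [s]. *)
Lemma klein3_scale (s t : k) : s != 0 -> conjugate (kleinG3 t) (klein3 s (t * s)).
Proof.
move=> s0; rewrite kleinG3E //; pose P : 'M[k]_3 := affine_mx 1 0 0 0 s 0.
have uP : P \in unitmx.
  have : P *m affine_mx 1 0 0 0 s^-1 0 = 1%:M.
    by rewrite affine_mxM -affine_mx1; congr affine_mx; rewrite ?mulfV //; ring.
  by case/mulmx1_unit.
apply: (@conjugate_klein _ (pgl P)); rewrite !pglM ?uni_mx_unit // ?uP //;
  by congr pgl; rewrite !affine_mxM; congr affine_mx; ring.
Qed.

(** A conjugation multiplies all parameters of the transvections by one constant. The six values of
    [t'] correspond to the six ordered pairs of distinct nonzero elements of {0, 1, t', t' + 1}, as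
    parameters of the images of the two generators. *)
Lemma G3_conjugate (t t' : k) : t != 0 -> t != 1 -> t' != 0 -> t' != 1 ->
  conjugate (kleinG3 t) (kleinG3 t') <->
  t' \in [:: t; t + 1; t^-1; (t + 1) / t; (t + 1)^-1; t / (t + 1)].
Proof.
move=> t0 t1 t0' t1'.
have add1 (u : k) : u != 1 -> u + 1 != 0.
  by rewrite addr_eq0 (oppr_pchar2 pchar2).
have t10 := add1 _ t1; have t10' := add1 _ t1'.
split.
- rewrite kleinG3E // kleinG3E // => -[g _]; rewrite conj_klein => e.
  have [P uP eg] := pglP g.
  have cj u : klein_set (pgl (uni_mx 1 0 0) ^ g)%g (pgl (uni_mx t 0 0) ^ g)%g (u ^ g)%g ->
      exists2 s : k, s \in [:: 0; 1; t'; t' + 1] &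
        (u ^ g)%g = pgl (uni_mx s 0 0) /\ (u * pgl P = pgl P * pgl (uni_mx s 0 0))%g.
    rewrite e => /klein3_mem [s ins eu]; exists s => //; split=> //; rewrite -eu conjgE eg.
    by rewrite !mulgA mulgV mul1g.
  have [s ins [es1 es]] := cj _ (Or42 _ _ _ erefl).
  have [r inr [er1 er]] := cj _ (Or43 _ _ _ erefl).
  have conj_inj := @conjg_inj (PGL 3 k) g.
  have s0 : s != 0.
    apply/eqP => s0; have : pgl (uni_mx 1 0 0) = pgl (uni_mx 0 0 0) :> PGL 3 k.
      by apply: conj_inj; rewrite es1 s0 pgl_uni0 conj1g.
    by move/pgl_uni_inj/eqP; rewrite oner_eq0.
  have rs : r != s.
    apply/eqP => rs; have : pgl (uni_mx 1 0 0) = pgl (uni_mx t 0 0) :> PGL 3 k.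
      by apply: conj_inj; rewrite es1 er1 rs.
    by move/pgl_uni_inj/eqP; rewrite eq_sym (negPf t1).
  have E i j := congr1 (fun M : 'M_3 => M i j) (conj_uni_eq uP es).
  have E' i j := congr1 (fun M : 'M_3 => M i j) (conj_uni_eq uP er).
  have {}E i j := etrans (esym (uni_mx_mulE _ _ _ P i j)) (etrans (E i j) (mul_uni_mxE _ _ _ P i j)).
  have {}E' i j := etrans (esym (uni_mx_mulE _ _ _ P i j)) (etrans (E' i j) (mul_uni_mxE _ _ _ P i j)).
  have e01 := E 0 1; have e11 := E 1 1; have e21 := E 2 1; have f01 := E' 0 1.
  move: e01 e11 e21 f01.
  rewrite /= !mul1r !mul0r !addr0 => e01 e11 e21 f01.
  have {e01}P11 : P 1 1 = P 0 0 * s by apply: (addrI (P 0 1)); rewrite e01 addrC.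
  have {f01}P11' : t * P 1 1 = P 0 0 * r by apply: (addrI (P 0 1)); rewrite f01 addrC.
  have {e11}/eqP P10 : P 1 0 * s = 0 by apply: (addIr (P 1 1)); rewrite add0r -e11.
  have {e21}/eqP P20 : P 2 0 * s = 0 by apply: (addIr (P 2 1)); rewrite add0r -e21.
  move: P10 P20; rewrite !mulf_eq0 (negPf s0) !orbF => /eqP P10 /eqP P20.
  have P00 : P 0 0 != 0.
    apply/eqP => P00; apply: (unitmx_col_neq0 (j := 0) uP) => -[[|[|[|//]]] i].
    + by rewrite -[RHS]P00; congr (P _ _); apply: val_inj.
    + by rewrite -[RHS]P10; congr (P _ _); apply: val_inj.
    + by rewrite -[RHS]P20; congr (P _ _); apply: val_inj.
  have {P11 P11'}er2 : r = t * s.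
    by apply: (mulfI P00); rewrite -P11' P11 mulrCA.
  have r0 : r != 0 by rewrite er2 mulf_neq0.
  (* From here on [s] and [r = t * s] run through the pairs of distinct elements of {1, t', t' + 1},
     and each pair is solved for [t']. *)
  move: ins inr; rewrite !inE (negPf s0) (negPf r0) /=.
  move=> /or3P[]/eqP sE /or3P[]/eqP rE; move: rs er2; rewrite sE rE ?eqxx //= => _.
  + by rewrite mulr1 => ->; rewrite eqxx.
  + rewrite mulr1 => <-; rewrite -addrA addkk addr0 eqxx; by rewrite !orbT.
  + move=> h; have -> : t' = t^-1 by apply: (mulfI t0); rewrite -h mulfV.
    by rewrite eqxx !orbT.
  + move=> h; have -> : t' = (t + 1)^-1.
      apply: (mulfI t10); rewrite mulfV // mulrDl mul1r -h addrAC addkk add0r //.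
    by rewrite eqxx !orbT.
  + move=> h; have -> : t' = (t + 1) / t.
      apply: (mulIf t0); rewrite divfK // mulrC; apply: (addIr t).
      by rewrite -[X in _ + X]mulr1 -mulrDr -h addrAC addkk add0r.
    by rewrite eqxx !orbT.
  + move=> h; have -> : t' = t / (t + 1).
      apply: (mulIf t10); rewrite divfK // mulrDr mulr1 {2}h mulrDr mulr1 [t * t']mulrC.
      by rewrite addrA addkk add0r.
    by rewrite eqxx !orbT.
(* Conversely, rescaling by 1, 1/t and 1/(t + 1), combined with exchange and addition of generators,
   reaches all six values. *)
- have G3E (u : k) : kleinG3 u = klein3 1 u by rewrite kleinG3E.
  have c1 := @klein3_scale 1 t (oner_neq0 k); rewrite mulr1 in c1.
  have tV0 : t^-1 != 0 by rewrite invr_eq0.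
  have c2 := @klein3_scale t^-1 t tV0; rewrite mulfV // in c2.
  have tV10 : (t + 1)^-1 != 0 by rewrite invr_eq0.
  have c3 := @klein3_scale (t + 1)^-1 t tV10.
  have e1 : (t + 1)^-1 + t / (t + 1) = 1 by rewrite -{1}[_^-1]mul1r -mulrDl addrC mulfV.
  rewrite !inE !G3E in c1 c2 c3 * => /or3P[/eqP ->|/eqP ->|/or4P[]/eqP ->].
  + by exists 1%g => //; rewrite eqEsubset; split=> z;
      [move=> [y Hy <-]; rewrite conjg1|exists z; rewrite ?conjg1].
  + by rewrite (addrC t) -klein3_shear.
  + by rewrite (klein3_swap _ t^-1).
  + rewrite (_ : (t + 1) / t = 1 + t^-1); last by rewrite mulrDl mulfV // mul1r.
    by rewrite -klein3_shear (klein3_swap _ t^-1).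
  + suff <- : klein3 (t + 1)^-1 (t / (t + 1)) = klein3 1 (t + 1)^-1 by [].
    by rewrite klein3_shear e1 klein3_swap.
  + suff <- : klein3 (t + 1)^-1 (t / (t + 1)) = klein3 1 (t / (t + 1)) by [].
    by rewrite klein3_swap klein3_shear (addrC (t / (t + 1))) e1 klein3_swap.
Qed.

End Transvections.

(** * Vectors and linear forms in dimension three *)

Section LinearAlgebra3.
Variable F : fieldType.
Implicit Types (u v w z : 'cV[F]_3) (f g : 'rV[F]_3).

(** In dimension 3, the relation N^2 = 0 bounds twice the rank by 3. Hence the rank is 1, and [N] is
    the product of its column and row bases. *)
Lemma rank1_factor (N : 'M[F]_3) : N *m N = 0 -> N != 0 ->
  exists u f, [/\ N = u *m f, u != 0, f != 0 & f *m u = 0].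
Proof.
move=> NN N0; have r3 := mulmx0_rank_max NN.
have r0 : (0 < \rank N)%N by rewrite lt0n mxrank_eq0.
have r1 : \rank N = 1%N by move: r3 r0; case: (\rank N) => [|[|r]] //; rewrite addSnnS; lia.
move: (col_base N) (row_base N) (mulmx_base N); rewrite r1 => u f e.
have u0 : u != 0 by apply: contraNneq N0 => u0; rewrite -e u0 mul0mx.
have f0 : f != 0 by apply: contraNneq N0 => f0; rewrite -e f0 mulmx0.
exists u, f; split=> //.
apply/eqP; apply: contraNT N0 => fu0.
have : u *m (f *m u) *m f == 0 by rewrite mulmxA -mulmxA e NN.
rewrite [f *m u]mx11_scalar mul_mx_scalar -scalemxAl e scaler_eq0 => /orP[/eqP fu|//].
by case/eqP: fu0; rewrite [f *m u]mx11_scalar fu raddf0.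
Qed.

Lemma mulmx_cr_neq0 u f : u != 0 -> f != 0 -> u *m f != 0.
Proof.
move=> /eqP u0 /eqP f0; apply/eqP => e.
have [i ui] : exists i, u i 0 != 0.
  apply: contra_notP u0 => h; apply/colP => i; rewrite mxE; apply/eqP.
  by apply: contra_notT h => ?; exists i.
apply: f0; apply/rowP => j; have /matrixP/(_ i j)/eqP := e.
by rewrite !mxE big_ord1 mulf_eq0 (negPf ui) => /eqP.
Qed.

Lemma functional_onto f : f != 0 -> exists w, f *m w = 1%:M.
Proof.
move=> f0; have /row_freeP [w] : row_free f by rewrite /row_free rank_rV f0.
by exists w.
Qed.

(** The matrix with rows [f] and [g] has full row rank; [w] and [z] are the columns of a right
    inverse. *)
Lemma dual_pair f g : f != 0 -> (forall a, g != a *: f) ->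
  exists w z, [/\ f *m w = 1%:M, f *m z = 0, g *m w = 0 & g *m z = 1%:M].
Proof.
move=> f0 fg; have : row_free (col_mx f g).
  apply: inj_row_free => v; rewrite -[v]hsubmxK mul_row_col.
  rewrite [lsubmx v]mx11_scalar [rsubmx v]mx11_scalar !mul_scalar_mx => e.
  set a := lsubmx v 0 0 in e *; set b := rsubmx v 0 0 in e *.
  have [b0|b0] := eqVneq b 0.
    move: e; rewrite b0 scale0r addr0 => /eqP; rewrite scaler_eq0 (negPf f0) orbF.
    by move=> /eqP ->; rewrite raddf0 row_mx0.
  have /eqP[] := fg (- (b^-1 * a)); apply: (scalerI b0).
  rewrite scalerA mulrN mulrA mulfV // mul1r scaleNr.
  by apply/eqP; rewrite -addr_eq0 addrC e.
move=> /row_freeP [B eB]; exists (lsubmx (B : 'M_(3, 1 + 1))), (rsubmx (B : 'M_(3, 1 + 1))).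
have := eB; rewrite -[B in LHS](@hsubmxK _ 3 1 1) mul_col_row -[X in _ = X](@submxK _ 1 1 1 1).
move=> /eq_block_mx [-> -> -> ->]; split; apply/matrixP => i j; rewrite !ord1 !mxE //=.
Qed.

Definition col3 u w z : 'M[F]_3 := \matrix_(i, j) [:: u i 0; w i 0; z i 0]`_j.

Lemma col3_mul u w z (x : 'cV[F]_3) :
  col3 u w z *m x = x 0 0 *: u + x 1 0 *: w + x 2 0 *: z.
Proof.
apply/colP => i; rewrite !mxE !big_ord_recl big_ord0 !mxE /= addr0 addrA.
have -> : lift ord0 ord0 = 1 :> 'I_3 by apply: val_inj.
have -> : lift ord0 (lift ord0 ord0) = 2 :> 'I_3 by apply: val_inj.
by rewrite ![_ * x _ _]mulrC.
Qed.

Lemma mul_col3 f u w z i : (f *m col3 u w z) 0 i =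
  [:: (f *m u) 0 0; (f *m w) 0 0; (f *m z) 0 0]`_i.
Proof. by case: i => -[|[|[|//]]] i; rewrite !mxE; apply: eq_bigr => j _; rewrite !mxE. Qed.

Lemma col3_unit u w z :
    (forall a b c, a *: u + b *: w + c *: z = 0 -> [/\ a = 0, b = 0 & c = 0]) ->
  col3 u w z \in unitmx.
Proof.
move=> h; rewrite -unitmx_tr -row_free_unit; apply: inj_row_free => v e.
have : col3 u w z *m v^T = 0 by rewrite -[LHS]trmxK trmx_mul trmxK e trmx0.
rewrite col3_mul => /h; rewrite !mxE => -[v0 v1 v2].
apply/rowP => -[[|[|[|//]]] i]; rewrite mxE.
- by rewrite -[RHS]v0; congr (v _ _); apply: val_inj.
- by rewrite -[RHS]v1; congr (v _ _); apply: val_inj.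
- by rewrite -[RHS]v2; congr (v _ _); apply: val_inj.
Qed.

(** Applying [f] and [g] to a linear relation kills the coefficients of [w] and [z], after which [u]
    alone remains. *)
Lemma col3_unit_dual u f g w z : u != 0 -> f *m u = 0 -> g *m u = 0 ->
    f *m w = 1%:M -> f *m z = 0 -> g *m w = 0 -> g *m z = 1%:M ->
  col3 u w z \in unitmx.
Proof.
move=> u0 fu gu fw fz gw gz; apply: col3_unit => a b c e.
have := congr1 (fun x => (f *m x) 0 0) e; have := congr1 (fun x => (g *m x) 0 0) e.
rewrite !mulmxDr -!scalemxAr fu gu fw fz gw gz !mulmx0 !mxE /= !mulr0 !mulr1 !addr0 !add0r.
move=> c0 b0; move: e; rewrite c0 b0 !scale0r !addr0 => /eqP.
by rewrite scaler_eq0 (negPf u0) orbF => /eqP.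
Qed.

(** The forms vanishing on [u] make up a plane, which is not contained in the line of [f]. *)
Lemma functional_through u f : u != 0 -> f != 0 ->
  exists2 g : 'rV[F]_3, g *m u = 0 & forall a, g != a *: f.
Proof.
move=> u0 f0; have ru : \rank u = 1%N.
  by rewrite -mxrank_tr rank_rV trmx_eq0 u0.
have nsub : ~~ (kermx u <= f)%MS.
  apply/negP => /mxrankS; rewrite mxrank_ker ru rank_rV f0 //.
have [i ni] := row_subPn nsub; exists (row i (kermx u)).
  by rewrite -row_mul mulmx_ker row0.
move=> a; apply: contraNneq ni => ->; exact: scalemx_sub.
Qed.

Lemma transvection_mul u f (P : 'M[F]_3) i j : P *m delta_mx i 0 = u ->
    f *m P = delta_mx 0 j ->
  (1%:M + u *m f) *m P = P *m (1%:M + delta_mx i j).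
Proof.
move=> Pu fP; rewrite mulmxDl mulmxDr mul1mx mulmx1 -mulmxA fP -Pu; congr (_ + _).
by rewrite -mulmxA mul_delta_mx.
Qed.

End LinearAlgebra3.

(** * Classification of the Klein subgroups *)

Section Classification.
Variable k : closedFieldType.
Hypothesis pchar2 : 2%N \in [pchar k].

Let addkk (a : k) : a + a = 0.
Proof. by rewrite -mulr2n -mulr_natr (pcharf0 pchar2) mulr0. Qed.

Let addMM m n (A : 'M[k]_(m, n)) : A + A = 0.
Proof. by apply/matrixP => i j; rewrite !mxE addkk. Qed.

Lemma sqrt_exists (c : k) : exists d, d ^+ 2 = c.
Proof.
have [d e] := @solve_monicpoly k 2 (fun i => if i == 0%N then c else 0) isT.
by exists d; rewrite e !big_ord_recl big_ord0 /= mulr1 mul0r !addr0.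
Qed.

Lemma transvection_unit (u : 'cV[k]_3) (f : 'rV[k]_3) : f *m u = 0 ->
  1%:M + u *m f \in unitmx.
Proof.
move=> fu; have : (1%:M + u *m f) *m (1%:M + u *m f) = 1%:M.
  rewrite mulmxDl mul1mx mulmxDr mulmx1 -[u *m f *m (_ *m _)]mulmxA (mulmxA f u f) fu.
  by rewrite mul0mx mulmx0 addr0 -addrA addMM addr0.
by case/mulmx1_unit.
Qed.

(** Dividing a representative by a square root of its scalar square gives [A'] with A'^2 = 1; in
    characteristic 2, the matrix 1 + A' then has square zero, and [rank1_factor] applies. *)
Lemma involution_transvection (a : PGL 3 k) : (a * a)%g = 1%g -> a <> 1%g ->
  exists (u : 'cV[k]_3) (f : 'rV[k]_3),
    [/\ a = pgl (1%:M + u *m f), u != 0, f != 0 & f *m u = 0].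
Proof.
have [A uA ->] := pglP a; rewrite pglM // -pgl1.
move=> /pgl_eq; rewrite unitmx_mul uA unitmx1 => /(_ isT isT) [c c0 eA] a1.
have [d dc] := sqrt_exists c.
have d0 : d != 0 by apply: contra_neq c0 => d0; rewrite -dc d0 expr0n.
pose A' := d^-1 *: A; have dV0 : d^-1 != 0 by rewrite invr_eq0.
have A'2 : A' *m A' = 1%:M.
  rewrite /A' -scalemxAl -scalemxAr eA !scalerA -dc expr2.
  by rewrite -[_ * _ * _]mulrA mulKf ?mulVf // scale1r.
have aA' : pgl A = pgl A' by rewrite pglZ.
have uA' : A' \in unitmx by case/mulmx1_unit: A'2.
have [||u [f [eN u0 f0 fu]]] := @rank1_factor _ (1%:M + A').
- rewrite mulmxDl mul1mx mulmxDr mulmx1 A'2 -[X in X + _]addrC.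
  by rewrite [A' + 1%:M]addrC addMM.
- apply/eqP => A1; apply: a1; rewrite aA'; congr pgl.
  by apply: (addrI 1%:M); rewrite A1 addMM.
exists u, f; split=> //; rewrite aA'; congr pgl; by rewrite -eN addrA addMM add0r.
Qed.

(** Because [A] is an involution, the scalar relating the two products has square 1, so it is 1 in
    characteristic 2. *)
Lemma commuting_involutions (A B : 'M[k]_3) : A \in unitmx -> B \in unitmx ->
    A *m A = 1%:M -> (pgl A * pgl B = pgl B * pgl A)%g ->
  A *m B = B *m A.
Proof.
move=> uA uB A2; rewrite !pglM // => /pgl_eq; rewrite !unitmx_mul uA uB.
move=> /(_ isT isT) [c c0 e].
suff c1 : c = 1 by rewrite e c1 scale1r.
have e2 : B *m A = c *: (A *m B).
  have := congr1 (fun M => A *m M *m A) e.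
  by rewrite !mulmxA A2 mul1mx -scalemxAr -scalemxAl -!mulmxA A2 mulmx1.
have AB0 : A *m B != 0.
  apply/eqP => AB0; have : A *m B \in unitmx by rewrite unitmx_mul uA uB.
  by rewrite AB0 unitmxE det0 unitr0.
have cc : c * c = 1.
  have : A *m B = (c * c) *: (A *m B) by rewrite -scalerA -e2.
  move=> /eqP; rewrite -{1}[A *m B]scale1r -subr_eq0 -scalerBl scaler_eq0 (negPf AB0) orbF.
  by rewrite subr_eq0 => /eqP.
apply/eqP; rewrite -subr_eq0 -sqrf_eq0 sqrrB1 expr2 cc mulr2n addkk subr0.
by rewrite addkk.
Qed.

(** For two transvections 1 + u f and 1 + v g, commutation forces f v = 0 and g u = 0. The third
    type occurs when both forms and vectors are proportional, the first when only the forms are, the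
    second when the forms are independent. *)
Lemma klein_classification (H : set (PGL 3 k)) : klein H ->
  [\/ conjugate H (kleinG1 k), conjugate H (kleinG2 k) |
      exists t : k, [/\ t != 0, t != 1 & conjugate H (kleinG3 t)]].
Proof.
move=> /kleinE [a [b [-> aa bb ab [a1 b1 neab]]]].
have [u [f [ea u0 f0 fu]]] := involution_transvection aa a1.
have [v [g [eb v0 g0 gv]]] := involution_transvection bb b1.
have uA := transvection_unit fu; have uB := transvection_unit gv.
have T2 (x : 'cV[k]_3) (h : 'rV[k]_3) : h *m x = 0 ->
    (1%:M + x *m h) *m (1%:M + x *m h) = 1%:M.
  move=> hx; rewrite mulmxDl mul1mx mulmxDr mulmx1 -[x *m h *m (_ *m _)]mulmxA (mulmxA h x h) hx.
  by rewrite mul0mx mulmx0 addr0 -addrA addMM addr0.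
rewrite ea eb in ab neab aa bb a1 b1 *.
have := commuting_involutions uA uB (T2 _ _ fu) ab.
rewrite !(mulmxDl, mulmxDr) !mulmx1 !mul1mx => /eqP.
rewrite -!addrA (inj_eq (addrI _)) addrA addrCA -!addrA !(inj_eq (addrI _)) => /eqP e.
have {}e : (f *m v) 0 0 *: (u *m g) = (g *m u) 0 0 *: (v *m f).
  have := e; rewrite -!mulmxA (mulmxA f v g) (mulmxA g u f).
  rewrite [f *m v]mx11_scalar [g *m u]mx11_scalar !mul_scalar_mx -!scalemxAr.
  by rewrite !mxE /= !mulr1n.
(* Otherwise, multiplying the relation by [f] on the left gives g u = 0, since f u = 0; the relation
   is then left with [u *m g = 0], which is absurd. *)
have s0 : f *m v = 0.
  apply/eqP; rewrite [f *m v]mx11_scalar; apply/negPn/negP => s0.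
  have {}s0 : (f *m v) 0 0 != 0.
    by apply: contraNneq s0 => ->; rewrite raddf0.
  have := congr1 (fun M => f *m M) e; rewrite -!scalemxAr !mulmxA fu mul0mx scaler0.
  rewrite [f *m v]mx11_scalar mul_scalar_mx scalerA => /esym/eqP.
  rewrite scaler_eq0 (negPf f0) orbF mulf_eq0 (negPf s0) orbF => /eqP r0.
  move: e; rewrite r0 scale0r => /eqP; rewrite scaler_eq0 (negPf s0) /=.
  by apply/negP/mulmx_cr_neq0.
have r0 : g *m u = 0.
  move: e; rewrite s0 mxE scale0r => /esym/eqP; rewrite scaler_eq0.
  rewrite (negPf (mulmx_cr_neq0 v0 f0)) orbF => /eqP e.
  by rewrite [g *m u]mx11_scalar e raddf0.
have P0 (x w z : 'cV[k]_3) : col3 x w z *m delta_mx 0 0 = x.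
  by rewrite col3_mul !mxE /= scale1r !scale0r !addr0.
have P1 (x w z : 'cV[k]_3) : col3 x w z *m delta_mx 1 0 = w.
  by rewrite col3_mul !mxE /= scale1r !scale0r addr0 add0r.
have fP (h : 'rV[k]_3) (x w z : 'cV[k]_3) (j : 'I_3) :
    [:: (h *m x) 0 0; (h *m w) 0 0; (h *m z) 0 0] = [seq ((j == i :> nat)%:R : k) | i <- [:: 0; 1; 2]%N] ->
  h *m col3 x w z = delta_mx 0 j.
  move=> eh; apply/rowP => i; rewrite mul_col3 eh !mxE eqxx /= -val_eqE /=.
  by case: i => -[|[|[|//]]] i; rewrite /= eq_sym.
have D01 (t : k) : 1%:M + t *: delta_mx 0 1 = uni_mx t 0 0.
  by apply/matrixP => -[[|[|[|//]]] i] [[|[|[|//]]] j]; rewrite !mxE /= ?(mulr0, mulr1, addr0, add0r).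
have D02 : 1%:M + delta_mx 0 2 = uni_mx 0 1 0 :> 'M[k]_3.
  by apply/matrixP => -[[|[|[|//]]] i] [[|[|[|//]]] j]; rewrite !mxE /= ?(mulr0, mulr1, addr0, add0r).
have D12 : 1%:M + delta_mx 1 2 = uni_mx 0 0 1 :> 'M[k]_3.
  by apply/matrixP => -[[|[|[|//]]] i] [[|[|[|//]]] j]; rewrite !mxE /= ?(mulr0, mulr1, addr0, add0r).
have cj (P A U : 'M[k]_3) : P \in unitmx -> A \in unitmx -> U \in unitmx -> A *m P = P *m U ->
    (pgl A * pgl P = pgl P * pgl U)%g.
  by move=> uP uA' uU eAP; rewrite !pglM // eAP.
have [[l el]|nfg] := pselect (exists l, g = l *: f).
- have l0 : l != 0 by apply: contra_neq g0 => l0; rewrite el l0 scale0r.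
  have fv : f *m v = 0 by [].
  have vg : v *m g = (l *: v) *m f by rewrite el -scalemxAr -scalemxAl.
  have [[t et]|nuv] := pselect (exists t, l *: v = t *: u).
  + have t0 : t != 0.
      apply/eqP => t0; have /eqP := et; rewrite t0 scale0r scaler_eq0 (negPf l0).
      by rewrite (negPf v0).
    have t1 : t != 1.
      apply/eqP => t1; apply: neab; rewrite vg et t1 scale1r //.
    constructor 3; exists t; split=> //.
    have [h hu hf] := functional_through u0 f0.
    have [w [z [fw fz hw hz]]] := dual_pair f0 hf.
    have uP := col3_unit_dual u0 fu hu fw fz hw hz.
    have fPe : f *m col3 u w z = delta_mx 0 1.
      by apply: fP; rewrite fu fw fz !mxE.
    rewrite kleinG3E //; apply: (@conjugate_klein _ (pgl (col3 u w z))).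
    * apply: cj; rewrite ?uni_mx_unit // -D01 scale1r.
      exact: transvection_mul.
    * apply: cj; rewrite ?uni_mx_unit // -D01 vg et -scalemxAl.
      rewrite mulmxDl mulmxDr mul1mx mulmx1 -scalemxAl -scalemxAr; congr (_ + _ *: _).
      by rewrite -{1}(P0 u w z) -!mulmxA fPe mul_delta_mx.
  + constructor 1; have [w fw] := functional_onto f0.
    have uP : col3 (l *: v) u w \in unitmx.
      apply: col3_unit => x y c ez.
      have := congr1 (fun x => (f *m x) 0 0) ez.
      rewrite !mulmxDr -!scalemxAr fu fv fw !scaler0 !add0r !mxE mulr1n mulr1 big1 ?mxE; last first.
        by move=> i _; rewrite mxE mulr0.
      move=> c0; rewrite c0 scale0r addr0 in ez *.
      have y0 : y = 0.
        apply/eqP/negPn/negP => y0; have [x0|x0] := eqVneq x 0.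
          move: ez; rewrite x0 scale0r add0r => /eqP.
          by rewrite scaler_eq0 (negPf y0) (negPf u0).
        apply: nuv; exists (- (x^-1 * y)); apply: (scalerI x0).
        rewrite [RHS]scalerA mulrN mulrA mulfV // mul1r scaleNr.
        by apply/eqP; rewrite -addr_eq0 ez.
      split=> //; move: ez; rewrite y0 scale0r addr0 => /eqP.
      by rewrite !scaler_eq0 (negPf l0) (negPf v0) !orbF => /eqP.
    have fPe : f *m col3 (l *: v) u w = delta_mx 0 2.
      by apply: fP; rewrite -scalemxAr fv fu fw scaler0 !mxE.
    rewrite kleinG1E //; apply: (@conjugate_klein _ (pgl (col3 (l *: v) u w))).
    * by apply: cj; rewrite ?uni_mx_unit // -D12; apply: transvection_mul.
    * by apply: cj; rewrite ?uni_mx_unit // -D02 vg; apply: transvection_mul.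
- have hg a' : g != a' *: f by apply/eqP => eg; apply: nfg; exists a'.
  have [w [z [fw fz gw gz]]] := dual_pair f0 hg.
  have uP := col3_unit_dual u0 fu r0 fw fz gw gz.
  constructor 2.
  have [x vE] : exists x : 'cV_3, v = x 0 0 *: u + x 1 0 *: w + x 2 0 *: z.
    by exists (invmx (col3 u w z) *m v); rewrite -col3_mul mulmxA mulmxV // mul1mx.
  (* Both forms kill [v], and their common kernel is the line of [u]. *)
  have ev : v = x 0 0 *: u.
    have := congr1 (fun x => (f *m x) 0 0) vE; have := congr1 (fun x => (g *m x) 0 0) vE.
    rewrite !mulmxDr -!scalemxAr fu s0 gv r0 fw fz gw gz !scaler0 !add0r !addr0 !mxE mulr1n !mulr1.
    by move=> x2 x1; rewrite {1}vE -x1 -x2 !scale0r !addr0.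
  set y := x 0 0 in ev; have y0 : y != 0.
    by apply: contra_neq v0 => y0; rewrite ev y0 scale0r.
  (* The factor is moved to the form, so that both transvections share the vector [u]; dual vectors
     are then chosen for [f] and [y *: g]. *)
  have vg : v *m g = u *m (y *: g) by rewrite ev -scalemxAl -scalemxAr.
  have hy a' : y *: g != a' *: f.
    apply: contra_neq (hg (y^-1 * a')) => e'; rewrite -scalerA -e' scalerA mulVf ?scale1r //.
  have [w' [z' [fw' fz' gw' gz']]] := dual_pair f0 hy.
  have yu : (y *: g) *m u = 0 by rewrite -scalemxAl r0 scaler0.
  have uP' := col3_unit_dual u0 fu yu fw' fz' gw' gz'.
  have fPe : f *m col3 u w' z' = delta_mx 0 1 by apply: fP; rewrite fu fw' fz' !mxE.
  have gPe : (y *: g) *m col3 u w' z' = delta_mx 0 2.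
    by apply: fP; rewrite yu gw' gz' !mxE.
  rewrite kleinG2E //; apply: (@conjugate_klein _ (pgl (col3 u w' z'))).
  + by apply: cj; rewrite ?uni_mx_unit // -D01 scale1r; apply: transvection_mul.
  + by apply: cj; rewrite ?uni_mx_unit // -D02 vg; apply: transvection_mul.
Qed.

End Classification.

(** * A birational conjugation between the first and third types *)

Section BirationalConjugation.
Variable k : fieldType.
Local Notation kx := {fraction {poly k}}.
Local Notation cst := (@kxy_cst k).
Local Notation x := (kxy_x k).
Local Notation y := (kxy_y k).

Lemma crvalM_subst (u v : Cr k) : crval (u * v)%g =
  (subst_rmorphism (@Cr_dominant k v) (crval u).1,
   subst_rmorphism (@Cr_dominant k v) (crval u).2).
Proof. by []. Qed.

Lemma fiberwise_affine (a b : kx) : a != 0 ->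
  exists u : Cr k, crval u = (x, @kx_kxy k a * y + @kx_kxy k b).
Proof.
move=> a0; pose A : 'M[kx]_2 := mx_of_rows 2 [:: [:: a; b]; [:: 0; 1]].
have uA : A \in unitmx.
  by rewrite mx2_unitE !mxE /= mulr1 mulr0 subr0.
have u1 := unitmx1 k 2; have bir := dJ_map_birational uA u1.
exists (MkCr (asboolT bir)); rewrite /= /dJ_map (mobius1 cst); congr pair.
by rewrite /mobius !mxE /= rmorph0 rmorph1 mul0r add0r divr1.
Qed.

(** This is (x, x y) conjugated by the exchange of coordinates. *)
Lemma multiplication_by_y : exists u : Cr k, crval u = (x * y, y).
Proof.
have x0 : kx_x k != 0 by rewrite tofrac_eq0 polyX_eq0.
have [d ed] := fiberwise_affine 0 x0.
pose S : 'M[k]_3 := affine_mx 0 1 0 1 0 0.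
have S2 : S *m S = 1%:M by rewrite affine_mxM -affine_mx1; congr affine_mx; ring.
have uS : S \in unitmx by case/mulmx1_unit: S2.
have eS : crval (lin (pgl S)) = (y, x).
  rewrite lin_pgl // lin_map_affine !rmorph0 !rmorph1 !mul1r !mul0r.
  by rewrite !addr0 !add0r.
exists (lin (pgl S) * (d * lin (pgl S)))%g.
rewrite crvalM_subst eS [(y, x).1]/= [(y, x).2]/= subst_x subst_y crvalM_subst ed.
rewrite [(_, _).1]/= [(x, _).2]/= rmorph0 addr0 /kx_x kx_kxy_tofrac -/x.
by rewrite rmorphM !subst_x subst_y eS mulrC.
Qed.

End BirationalConjugation.

Section G1G3.
Variable k : closedFieldType.
Hypothesis pchar2 : 2%N \in [pchar k].
Local Notation kx := {fraction {poly k}}.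
Local Notation cst := (@kxy_cst k).
Local Notation x := (kxy_x k).
Local Notation y := (kxy_y k).

Let addkk (a : k) : a + a = 0.
Proof. by rewrite -mulr2n -mulr_natr (pcharf0 pchar2) mulr0. Qed.

(** In characteristic 2 the function X -> d (X^2 + X) is additive; it vanishes at 1, and [d] is
    chosen so that it takes the value 1 at [t]. *)
Lemma shear_identity (L : fieldType) (c : {rmorphism k -> L}) (t : k) (X Y : L) :
  t != 0 -> t + 1 != 0 ->
  let d := c (t * (t + 1))^-1 in
  Y + d * (X * X + X) = Y + 1 + d * ((X + c t) * (X + c t) + (X + c t)).
Proof.
move=> t0 t1 d.
have two : (1 + 1 : L) = 0 by rewrite -(rmorph1 c) -rmorphD addkk rmorph0.
have dt : d * (c t * c t + c t) = 1.
  rewrite /d -rmorphM -rmorphD -rmorphM -[X in _ * (_ + X)]mulr1 -mulrDr.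
  by rewrite mulVf ?rmorph1 // mulf_neq0.
have -> : Y + 1 + d * ((X + c t) * (X + c t) + (X + c t)) =
  Y + d * (X * X + X) + (d * (c t * c t + c t) + 1) + d * X * c t * (1 + 1) by ring.
by rewrite dt two mulr0 !addr0.
Qed.

Lemma eq_lin_uni (a b c a' b' c' : k) : a = a' -> b = b' -> c = c' ->
  lin (pgl (uni_mx a b c)) = lin (pgl (uni_mx a' b' c')).
Proof. by move=> -> -> ->. Qed.

Lemma shear_one (L : fieldType) (X d : L) : 1 + 1 = 0 :> L ->
  d * (X * X + X) = 0 + d * ((X + 1) * (X + 1) + (X + 1)).
Proof.
move=> two; have -> : 0 + d * ((X + 1) * (X + 1) + (X + 1)) =
  d * (X * X + X) + (d * X + d) * (1 + 1) by ring.
by rewrite two mulr0 addr0.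
Qed.

(** Conjugation by [m] turns (x + s y, y) into (x + s, y). Conjugation by [h] then adds 1 to y when
    s = t and nothing when s = 1, by additivity of its polynomial. Finally a linear shear turns (x +
    t, y + 1) into (x, y + 1) and fixes (x + 1, y). *)
Theorem G1_G3_birationally_conjugate (t : k) : t != 0 -> t != 1 ->
  birationally_conjugate (kleinG1 k) (kleinG3 t).
Proof.
move=> t0 t1; have t10 : t + 1 != 0 by rewrite addr_eq0 (oppr_pchar2 pchar2).
rewrite /birationally_conjugate kleinG1E // kleinG3E // !lin_klein.
apply: conjugate_sym.
have [m em] := multiplication_by_y k.
pose d := (t * (t + 1))^-1.
have [h eh] := fiberwise_affine (tofrac (d%:P * ('X * 'X + 'X))) (oner_neq0 kx).
have {}eh : crval h = (x, y + cst d * (x * x + x)).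
  by rewrite eh rmorph1 mul1r kx_kxy_tofrac !(polyCM, polyCD, tofracM, tofracD).
have left a b c (v : Cr k) : crval (lin (pgl (uni_mx a b c)) * v)%g =
    ((crval v).1 + cst a * (crval v).2 + cst b, (crval v).2 + cst c).
  rewrite crvalM_subst lin_uniE; congr pair.
    by rewrite !rmorphD rmorphM !subst_cst subst_x subst_y.
  by rewrite rmorphD subst_cst subst_y.
have mE s : (lin (pgl (uni_mx s 0 0)) * m)%g = (m * lin (pgl (uni_mx 0 s 0)))%g.
  apply: val_inj; rewrite -[LHS]/(crval _) left -[RHS]/(crval _) crvalM_subst em.
  congr pair.
    rewrite rmorphM subst_x subst_y lin_uniE !rmorph0 mul0r !addr0.
    by rewrite -mulrDl.
  by rewrite subst_y lin_uniE !rmorph0 !addr0.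
have hE s r : cst d * (x * x + x) =
      cst r + cst d * ((x + cst s) * (x + cst s) + (x + cst s)) ->
    (lin (pgl (uni_mx 0 s 0)) * h)%g = (h * lin (pgl (uni_mx 0 s r)))%g.
  move=> e; apply: val_inj; rewrite -[LHS]/(crval _) left -[RHS]/(crval _) crvalM_subst eh.
  have e1 : (crval (lin (pgl (uni_mx 0 s r)))).1 = x + cst s.
    by rewrite lin_uniE rmorph0 mul0r addr0.
  have e2 : (crval (lin (pgl (uni_mx 0 s r)))).2 = y + cst r by rewrite lin_uniE.
  congr pair; first by rewrite subst_x e1 rmorph0 mul0r addr0.
  rewrite rmorphD rmorphM rmorphD rmorphM subst_cst subst_x subst_y e1 e2.
  by rewrite rmorph0 addr0 -[LHS]/(y + _) e addrA.
have nE : (lin (pgl (uni_mx 0 1 0)) * lin (pgl (uni_mx t 0 0)) =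
    lin (pgl (uni_mx t 0 0)) * lin (pgl (uni_mx 0 1 0)))%g.
  by rewrite -!linM !pgl_uniM; apply: eq_lin_uni; ring.
have nE' : (lin (pgl (uni_mx 0 t 1)) * lin (pgl (uni_mx t 0 0)) =
    lin (pgl (uni_mx t 0 0)) * lin (pgl (uni_mx 0 0 1)))%g.
  by rewrite -!linM !pgl_uniM; apply: eq_lin_uni; ring.
have h1 := hE 1 0; have ht := hE t 1.
rewrite (klein_set_swap (a := lin (pgl (uni_mx 0 0 1)))); last first.
  by rewrite -!linM !pgl_uniM; apply: eq_lin_uni; ring.
have two : (1 + 1 : {fraction {poly {poly k}}}) = 0.
  by rewrite -(rmorph1 cst) -rmorphD addkk rmorph0.
apply: (@conjugate_klein _ (m * (h * lin (pgl (uni_mx t 0 0))))%g).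
- rewrite !mulgA mE -[in LHS](mulgA m) h1; last first.
    by rewrite rmorph1 rmorph0; apply: shear_one.
  by rewrite -!mulgA nE.
- rewrite !mulgA mE -[in LHS](mulgA m) ht; last first.
    by rewrite rmorph1; apply: (addrI y); rewrite addrA; apply: shear_identity.
  by rewrite -!mulgA nE'.
Qed.

End G1G3.

(** * Commuting 2 x 2 matrices *)

Section Matrices2.
Variable F : fieldType.
Implicit Types (A B Q : 'M[F]_2).

Lemma mul2E A B i j : (A *m B) i j = A i 0 * B 0 j + A i 1 * B 1 j.
Proof.
by rewrite !mxE !big_ord_recl big_ord0 addr0; congr (_ + A _ _ * B _ _); apply: val_inj.
Qed.

Lemma mul2_colE A (x : 'cV[F]_2) i : (A *m x) i 0 = A i 0 * x 0 0 + A i 1 * x 1 0.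
Proof.
by rewrite !mxE !big_ord_recl big_ord0 addr0; congr (_ + A _ _ * x _ _); apply: val_inj.
Qed.

Lemma mx2P A B : A 0 0 = B 0 0 -> A 0 1 = B 0 1 -> A 1 0 = B 1 0 -> A 1 1 = B 1 1 -> A = B.
Proof.
move=> e0 e1 e2 e3; apply/matrixP => i j.
have [->|->] : i = 0 \/ i = 1 by case: i => -[|[|//]] ?; [left|right]; apply: val_inj.
  by have [->|->] : j = 0 \/ j = 1 by case: j => -[|[|//]] ?; [left|right]; apply: val_inj.
by have [->|->] : j = 0 \/ j = 1 by case: j => -[|[|//]] ?; [left|right]; apply: val_inj.
Qed.

Lemma upper_triangular_exp A n : A 1 0 = 0 ->
  [/\ (A ^+ n) 1 0 = 0, (A ^+ n) 0 0 = A 0 0 ^+ n & (A ^+ n) 1 1 = A 1 1 ^+ n].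
Proof.
move=> A10; elim: n => [|n [IH0 IH1 IH2]]; first by rewrite !expr0 !mxE.
rewrite !exprS -!mulmxE !mul2E A10 IH0 IH1 IH2.
by rewrite !mul0r !mulr0 !addr0 !add0r.
Qed.

Lemma conj_exp A Q U n : A *m Q = Q *m U -> A ^+ n *m Q = Q *m U ^+ n.
Proof.
move=> e; elim: n => [|n IH]; first by rewrite !expr0 mul1mx mulmx1.
by rewrite !exprS -!mulmxE -mulmxA IH mulmxA e !mulmxA.
Qed.

Lemma unitmx_unit A : (A \in unitmx) = (A \is a GRing.unit).
Proof. by []. Qed.

End Matrices2.

Lemma pchar_expI (F : fieldType) p (x y : F) : p \in [pchar F] -> x ^+ p = y ^+ p -> x = y.
Proof.
move=> hp e; apply/eqP; rewrite -subr_eq0.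
have : (x - y) ^+ p == 0.
  have := pFrobenius_autB_comm hp (mulrC x y); rewrite !pFrobenius_autE => ->.
  by rewrite e subrr.
by rewrite expf_eq0 => /andP[].
Qed.

(** The nonzero matrix [A0 - d] is nilpotent, and its kernel is a line stable under [MM]. A basis
    starting with this line makes all of [MM] triangular, and scalar p-th powers make the diagonals
    constant. Endomorphisms in [S] are carried along so that the change of basis can be chosen
    invariant. *)
Lemma simultaneously_unipotent (F : fieldType) (p : nat) (S : {rmorphism F -> F} -> Prop)
    (MM : set 'M[F]_2) (A0 : 'M[F]_2) (d : F) : p \in [pchar F] ->
    (forall A, MM A -> A \in unitmx) ->
    (forall A s, MM A -> S s -> map_mx s A = A) ->
    (forall A, MM A -> exists l : F, A0 *m A = l *: (A *m A0)) ->
    (forall A, MM A -> exists c : F, A ^+ p = c%:M) ->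
    MM A0 -> A0 ^+ p = (d ^+ p)%:M -> A0 != d%:M ->
  exists Q, [/\ Q \in unitmx, (forall s, S s -> map_mx s Q = Q) &
    forall A, MM A -> exists a b, a != 0 /\ A *m Q = Q *m (a *: tr_mx b)].
Proof.
move=> hp uM SM cM pM MA0 A0p A0d.
have hpM : p \in [pchar 'M[F]_2] by rewrite pchar_lalg.
pose N := A0 - d%:M.
have Np : N ^+ p = 0.
  have cm : GRing.comm A0 (d%:M : 'M_2) by apply: comm_mx_scalar.
  have := pFrobenius_autB_comm hpM cm; rewrite !pFrobenius_autE => ->.
  by rewrite A0p -rmorphXn subrr.
have N0 : N != 0 by rewrite subr_eq0.
have detN : N 0 0 * N 1 1 - N 0 1 * N 1 0 = 0.
  apply/eqP/negPn; rewrite -mx2_unitE; apply/negP; rewrite unitmx_unit => uN.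
  by have := unitrX p uN; rewrite Np unitr0.
have sd s : S s -> s d = d.
  move=> Ss; apply: (pchar_expI hp); rewrite -rmorphXn.
  have := congr1 (map_mx s) A0p; rewrite map_scalar_mx.
  have -> : map_mx s (A0 ^+ p) = A0 ^+ p by rewrite rmorphXn /= (SM _ _ MA0 Ss).
  rewrite A0p => /matrixP/(_ 0 0); rewrite !mxE /= !mulr1n.
  by move=> e; rewrite -e.
have sN s i j : S s -> s (N i j) = N i j.
  move=> Ss; have /matrixP/(_ i j) := SM _ _ MA0 Ss; rewrite mxE => e.
  by rewrite !mxE rmorphB e rmorphMn /= sd.
have eN : N = A0 - d%:M by [].
clearbody N.
(* The kernel vector is read off from a nonzero row of [N], hence is fixed by [S]. *)
have [w0 [w1 [wN sw Nw]]] : exists w0 w1, [/\ (w0 != 0) || (w1 != 0),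
    forall s, S s -> s w0 = w0 /\ s w1 = w1 &
    forall i, N i 0 * w0 + N i 1 * w1 = 0].
  have ord2 (i : 'I_2) : i = 0 \/ i = 1.
    by case: i => -[|[|//]] ?; [left|right]; apply: val_inj.
  have [nz|/norP[]] := boolP ((N 0 0 != 0) || (N 0 1 != 0)).
    exists (N 0 1), (- N 0 0); split.
    - by rewrite oppr_eq0 orbC.
    - by move=> s Ss; rewrite rmorphN !sN.
    - move=> i; have [->|->] := ord2 i; first by ring.
      by rewrite -[RHS]oppr0 -[in RHS]detN; ring.
  rewrite !negbK => /eqP n00 /eqP n01; exists (N 1 1), (- N 1 0); split.
  - rewrite oppr_eq0; apply: contraNT N0; rewrite negb_or !negbK => /andP[/eqP n11 /eqP n10].
    by apply/eqP/mx2P; rewrite ?n00 ?n01 ?n10 ?n11 mxE.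
  - by move=> s Ss; rewrite rmorphN !sN.
  - by move=> i; have [->|->] := ord2 i; [rewrite n00 n01|]; ring.
pose w : 'cV[F]_2 := \col_i (if i == 0 then w0 else w1).
have Nw' : N *m w = 0.
  by apply/colP => i; rewrite mul2_colE !mxE Nw.
have A0w : A0 *m w = d *: w.
  by apply/eqP; rewrite -subr_eq0 -mul_scalar_mx -mulmxBl -eN Nw'.
have w_neq0 : w != 0.
  apply: contraTneq wN => e; have := congr1 (fun x : 'cV_2 => x 0 0) e.
  have := congr1 (fun x : 'cV_2 => x 1 0) e; rewrite !mxE /= => -> ->.
  by rewrite eqxx.
have Aw A : MM A -> exists a, A *m w = a *: w.
  move=> MA; have [l el] := cM A MA; have uA := uM A MA.
  pose v := A *m w.
  have A0v : A0 *m v = (l * d) *: v.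
    by rewrite /v mulmxA el -scalemxAl -mulmxA A0w -scalemxAr scalerA.
  have v0 : v != 0.
    by apply: contraNneq w_neq0 => v0; rewrite -(mulKmx uA w) -/v v0 mulmx0.
  have A0n n : A0 ^+ n *m v = (l * d) ^+ n *: v.
    elim: n => [|n IH]; first by rewrite !expr0 mul1mx scale1r.
    by rewrite exprSr -mulmxE -mulmxA A0v -scalemxAr IH scalerA -exprS.
  (* [v] is an eigenvector of [A0] for [l * d], whose p-th power must be that of [d]; Frobenius is
     injective. *)
  have ld : l * d = d.
    apply: (pchar_expI hp); apply/eqP; have := A0n p.
    rewrite A0p mul_scalar_mx => /eqP; rewrite eq_sym -subr_eq0 -scalerBl.
    by rewrite scaler_eq0 (negPf v0) orbF subr_eq0.
  have Nv : N *m v = 0 by rewrite eN mulmxBl A0v ld mul_scalar_mx subrr.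
  have Nvi i : N i 0 * v 0 0 + N i 1 * v 1 0 = 0.
    by rewrite -mul2_colE Nv mxE.
  have dvw : w0 * v 1 0 = w1 * v 0 0.
    have row i : (N i 0 != 0) || (N i 1 != 0) -> w0 * v 1 0 = w1 * v 0 0.
      have e1 := Nw i; have e2 := Nvi i.
      case/orP => n0; apply: (mulfI n0); apply/eqP; rewrite -subr_eq0; apply/eqP.
        transitivity (v 1 0 * (N i 0 * w0 + N i 1 * w1) - w1 * (N i 0 * v 0 0 + N i 1 * v 1 0)).
          by ring.
        by rewrite e1 e2 !mulr0 subrr.
      transitivity (w0 * (N i 0 * v 0 0 + N i 1 * v 1 0) - v 0 0 * (N i 0 * w0 + N i 1 * w1)).
        by ring.
      by rewrite e1 e2 !mulr0 subrr.
    have [/row //|/norP[/negPn/eqP n00 /negPn/eqP n01]] := boolP ((N 0 0 != 0) || (N 0 1 != 0)).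
    apply: (row 1); apply: contraNT N0; rewrite negb_or !negbK => /andP[/eqP n10 /eqP n11].
    by apply/eqP/mx2P; rewrite ?n00 ?n01 ?n10 ?n11 mxE.
  have cv a : v 0 0 = a * w0 -> v 1 0 = a * w1 -> v = a *: w.
    move=> e0 e1; apply/colP => i; rewrite [RHS]mxE [w _ _]mxE.
    case: i => -[|[|//]] hi /=; rewrite -?e0 -?e1; congr (v _ _); exact: val_inj.
  case/orP: wN => wn.
    exists (v 0 0 / w0); apply: cv; first by rewrite divfK.
    by apply: (mulfI wn); rewrite dvw; field.
  exists (v 1 0 / w1); apply: cv; last by rewrite divfK.
  by apply: (mulfI wn); rewrite -dvw; field.
(* Completing [w] by a standard basis vector keeps [Q] fixed by [S]. *)
pose Q : 'M[F]_2 := if w0 != 0 then mx_of_rows 2 [:: [:: w0; 0]; [:: w1; 1]]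
  else mx_of_rows 2 [:: [:: w0; 1]; [:: w1; 0]].
have uQ : Q \in unitmx.
  rewrite mx2_unitE /Q; case: ifP wN => [w00 _|/negbFE/eqP -> /= w10]; rewrite !mxE /=.
    by rewrite mulr1 mul0r subr0.
  by rewrite mulr0 sub0r mul1r oppr_eq0.
have Q0 : Q *m delta_mx 0 0 = w.
  rewrite -colE; apply/colP => i; rewrite !mxE /Q; case: ifP => _; rewrite !mxE;
  by case: i => -[|[|//]] i.
exists Q; split=> //.
- move=> s Ss; have [sw0 sw1] := sw s Ss; apply/matrixP => i j; rewrite mxE /Q.
  by case: ifP => _; rewrite !mxE; case: i => -[|[|//]] i; case: j => -[|[|//]] j /=;
    rewrite ?rmorph0 ?rmorph1.
- move=> A MA; have [a ea] := Aw A MA.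
  have [U AQ] : exists U, A *m Q = Q *m U.
    by exists (invmx Q *m A *m Q); rewrite !mulmxA mulmxV // mul1mx.
  have Ucol : U *m delta_mx 0 0 = a *: delta_mx 0 0 :> 'cV_2.
    by rewrite -[LHS](mulKmx uQ) (mulmxA Q) -AQ -mulmxA Q0 ea -scalemxAr -Q0 mulKmx.
  have U00 : U 0 0 = a.
    by have := congr1 (fun x : 'cV_2 => x 0 0) Ucol; rewrite -colE !mxE /= mulr1.
  have U10 : U 1 0 = 0.
    by have := congr1 (fun x : 'cV_2 => x 1 0) Ucol; rewrite -colE !mxE /= mulr0.
  have [c Ap] := pM A MA.
  have Up : U ^+ p = c%:M.
    by rewrite -[LHS](mulKmx uQ) -(conj_exp p AQ) Ap mul_scalar_mx -scalemxAr mulVmx // scalemx1.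
  have [_ Up0 Up1] := upper_triangular_exp p U10.
  (* The diagonal entries have equal p-th powers, hence are equal. *)
  have U11 : U 1 1 = a.
    by apply: (pchar_expI hp); rewrite -U00 -Up0 -Up1 Up !mxE.
  have a0 : a != 0.
    apply/eqP => a0; have := uM A MA; have : A = Q *m U *m invmx Q by rewrite -AQ mulmxK.
    move=> ->; rewrite !unitmx_mul uQ unitmx_inv uQ andbT /= mx2_unitE U00 U10 a0 mul0r mulr0.
    by rewrite subr0 eqxx.
  exists a, (U 0 1 / a); split=> //; rewrite AQ; congr (_ *m _).
  by apply: mx2P; rewrite ?U00 ?U10 ?U11 !mxE /= ?mulr1 ?mulr0 // mulrC divfK.
Qed.

Lemma sum_rotate (V : zmodType) (f : nat -> V) n : (0 < n)%N -> f n = f 0 ->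
  \sum_(i < n) f i.+1 = \sum_(i < n) f i.
Proof.
case: n => // n _ fn; rewrite big_ord_recr /= fn [RHS]big_ord_recl addrC.
by congr (_ + _); apply: eq_bigr.
Qed.

(* W_j = sum_i sigma^i(z)^j D_i is fixed by X |-> M sigma(X), and Lagrange
   interpolation at z writes a nonzero scalar matrix as a combination of the W_j;
   hence two of their columns are independent. *)
Lemma hilbert90 (F : fieldType) (p : nat) (sigma : {rmorphism F -> F}) (z : F)
    (M : 'M[F]_2) (D : nat -> 'M[F]_2) : (0 < p)%N ->
    D 0 = 1%:M -> (forall i, D i.+1 = M *m map_mx sigma (D i)) -> D p = 1%:M ->
    iter p sigma z = z -> (forall i, (0 < i < p)%N -> iter i sigma z != z) ->
  exists P, [/\ P \in unitmx, M *m map_mx sigma P = P &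
    forall tau : {rmorphism F -> F}, (forall x, tau (sigma x) = sigma (tau x)) ->
      map_mx tau M = M -> tau z = z -> map_mx tau P = P].
Proof.
move=> p0 D0 DS Dp zp zi.
pose W j := \sum_(i < p) (iter i sigma z) ^+ j *: D i.
have MW j : M *m map_mx sigma (W j) = W j.
  rewrite raddf_sum mulmx_sumr.
  rewrite (eq_bigr (fun i : 'I_p => (iter i.+1 sigma z) ^+ j *: D i.+1)); last first.
    by move=> i _; rewrite /= map_mxZ -scalemxAr -DS rmorphXn.
  rewrite (@sum_rotate _ (fun i => iter i sigma z ^+ j *: D i) _ p0) //.
  by rewrite Dp zp D0.
have tauW (tau : {rmorphism F -> F}) j : (forall x, tau (sigma x) = sigma (tau x)) ->
    map_mx tau M = M -> tau z = z -> map_mx tau (W j) = W j.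
  move=> ts tM tz; have tD i : map_mx tau (D i) = D i.
    elim: i => [|i IH]; first by rewrite D0 map_mx1.
    rewrite DS map_mxM tM; congr (_ *m _); rewrite -[in RHS]IH.
    by apply/matrixP => a b; rewrite !mxE ts.
  have tzi i : tau (iter i sigma z) = iter i sigma z.
    by elim: i => //= i IH; rewrite ts IH.
  by rewrite raddf_sum; apply: eq_bigr => i _; rewrite /= map_mxZ rmorphXn /= tzi tD.
pose q := \prod_(i < p | (0 < i)%N) ('X - (iter i sigma z)%:P).
have qz : q.[z] != 0.
  rewrite horner_prod; apply/prodf_neq0 => i i0.
  by rewrite hornerXsubC subr_eq0 eq_sym zi // i0 ltn_ord.
have Wq : \sum_(j < size q) q`_j *: W j = q.[z]%:M.
  transitivity (\sum_(i < p) q.[iter i sigma z] *: D i).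
    rewrite (eq_bigr (fun j : 'I_(size q) =>
      \sum_(i < p) (q`_j * (iter i sigma z) ^+ j) *: D i)); last first.
      by move=> j _; rewrite scaler_sumr; apply: eq_bigr => i _; rewrite scalerA.
    rewrite exchange_big; apply: eq_bigr => i _.
    by rewrite -scaler_suml horner_coef.
  rewrite (bigD1 (Ordinal p0)) //= D0 scalemx1 big1 ?addr0 // => i i0.
  have i0' : (0 < i)%N by rewrite lt0n; apply: contra i0 => /eqP i0; apply/eqP/val_inj.
  rewrite horner_prod (bigD1 i) //= hornerXsubC subrr mul0r scale0r //.
clearbody W.
have [j [l [i Wji]]] : exists j l i, W j i l != 0.
  apply: contrapT => h; have Wz j : W j = 0.
    apply/matrixP => i l; rewrite mxE; apply: contrapT => ne; apply: h.
    by exists j, l, i; apply/eqP.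
  move: Wq; rewrite big1 => [/matrixP/(_ 0 0)/esym/eqP|j _]; last by rewrite Wz scaler0.
  by rewrite !mxE /= mulr1n (negPf qz).
pose dt (v : 'cV[F]_2) := W j 0 l * v 1 0 - W j 1 l * v 0 0.
have [j' [l' dt0]] : exists j' l', dt (col l' (W j')) != 0.
  apply: contrapT => h; have dz j' l' : dt (col l' (W j')) = 0.
    by apply: contrapT => ne; apply: h; exists j', l'; apply/eqP.
  have dq l' : dt (col l' q.[z]%:M) = 0.
    rewrite -Wq /dt !mxE !summxE mulr_sumr mulr_sumr -sumrB big1 // => i' _.
    have := dz i' l'; rewrite /dt !mxE => e.
    by rewrite mulrCA [X in _ - X]mulrCA -mulrBr e mulr0.
  have := dq 0; have := dq 1; rewrite /dt !mxE /= !mulr0 sub0r subr0 !mulr1n.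
  move=> /eqP; rewrite mulf_eq0 (negPf qz) orbF => /eqP W0.
  move=> /eqP; rewrite oppr_eq0 mulf_eq0 (negPf qz) orbF => /eqP W1.
  case/negP: Wji; apply/eqP; case: i => -[|[|//]] i.
    by rewrite -[RHS]W0; congr (W j _ _); apply: val_inj.
  by rewrite -[RHS]W1; congr (W j _ _); apply: val_inj.
pose P : 'M[F]_2 := \matrix_(a, b) (if b == 0 then W j a l else W j' a l').
have Pcol a b : P a b = if b == 0 then W j a l else W j' a l' by rewrite mxE.
exists P; split.
- by rewrite mx2_unitE !Pcol /= [X in _ - X]mulrC; move: dt0; rewrite /dt !mxE.
- apply/matrixP => a b; rewrite mul2E Pcol ![map_mx sigma P _ _]mxE !Pcol.
  case: ifP => _.
    by rewrite -[in RHS](MW j) mul2E ![map_mx sigma (W j) _ _]mxE.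
  by rewrite -[in RHS](MW j') mul2E ![map_mx sigma (W j') _ _]mxE.
- move=> tau ts tM tz; apply/matrixP => a b; rewrite mxE Pcol.
  case: ifP => _.
    by rewrite -[in RHS](tauW tau j) // mxE.
  by rewrite -[in RHS](tauW tau j') // mxE.
Qed.

(** * Invariant rational functions *)

Section Shift.
Variable k : fieldType.
Local Notation kx := {fraction {poly k}}.
Implicit Types (t : k) (f : kx) (p : {poly k}).

Fact shift_subproof t : {s : {rmorphism kx -> kx} | forall f, s f = mobius_kx (tr_mx t) f}.
Proof. by exists (mobius_kx_rmorphism (tr_mx_unit t)). Qed.

(* f(x) |-> f(x + t) *)
Definition shift t : {rmorphism kx -> kx} := sval (shift_subproof t).

Lemma shiftE t f : shift t f = mobius_kx (tr_mx t) f.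
Proof. exact: (svalP (shift_subproof t)). Qed.

Lemma shift_tofrac t p : shift t (tofrac p) = tofrac (p \Po ('X + t%:P)).
Proof.
rewrite shiftE /mobius_kx /kx_subst fracmap_tofrac; last exact: mobius_kx_inj (tr_mx_unit t).
have -> : mobius (@kx_cst k) (tr_mx t) (kx_x k) = tofrac ('X + t%:P).
  by rewrite /mobius !mxE /= rmorph0 rmorph1 mul0r mul1r add0r divr1 tofracD.
elim/poly_ind: p => [|p c IH]; first by rewrite rmorph0 comp_poly0 tofrac0.
rewrite rmorphD rmorphM /= IH at1X at1C comp_polyD comp_polyM comp_polyX comp_polyC.
by rewrite [in RHS]tofracD [in RHS]tofracM.
Qed.

Lemma shift_cst t a : shift t (@kx_cst k a) = @kx_cst k a.
Proof. by rewrite -[@kx_cst k a]/(tofrac a%:P) shift_tofrac comp_polyC. Qed.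

Lemma shiftD s t f : shift s (shift t f) = shift (s + t) f.
Proof.
have e p : shift s (shift t (tofrac p)) = shift (s + t) (tofrac p).
  rewrite !shift_tofrac -comp_polyA comp_polyD comp_polyX comp_polyC.
  by rewrite -addrA -polyCD.
by rewrite (fracE f) !(fmorph_div (shift _)) !e.
Qed.

Lemma shift0 f : shift 0 f = f.
Proof.
have e p : shift 0 (tofrac p) = tofrac p.
  by rewrite shift_tofrac addr0 comp_polyXr.
by rewrite (fracE f) (fmorph_div (shift _)) !e.
Qed.

Lemma shiftC s t f : shift s (shift t f) = shift t (shift s f).
Proof. by rewrite !shiftD addrC. Qed.

Lemma iter_shift t i f : iter i (shift t) f = shift (t *+ i) f.
Proof. by elim: i => [|i IH] /=; rewrite ?shift0 // IH shiftD mulrS. Qed.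

End Shift.

Lemma div_neq0 (L : fieldType) (a b : L) : a != 0 -> b != 0 -> a / b != 0.
Proof. by move=> a0 b0; rewrite mulf_neq0 ?invr_eq0. Qed.

Lemma square_fraction_identity (L : fieldType) (n d h g : L) : d != 0 ->
  n * d = h ^+ 2 * g -> n / d = (h / d) ^+ 2 * g.
Proof.
move=> d0 e; have -> : n / d = n * d / d ^+ 2 by field.
by rewrite e; field.
Qed.

(** * Finite groups of translations and their invariants *)

Section AdditiveGroups.
Variable k : closedFieldType.
Local Notation kx := {fraction {poly k}}.
Implicit Types (t a : k) (f : kx) (n : {poly k}) (rs : seq k).

Definition addgroup rs : Prop :=
  [/\ uniq rs, 0 \in rs & forall r s, r \in rs -> s \in rs -> r - s \in rs].

Definition orbit_poly rs a : {poly k} := \prod_(r <- rs) ('X - (a + r)%:P).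

Lemma orbit_poly_shift rs a t :
  orbit_poly rs a \Po ('X + t%:P) = orbit_poly rs (a - t).
Proof.
rewrite /orbit_poly rmorph_prod /=; apply: eq_bigr => r _.
by rewrite comp_polyB comp_polyX comp_polyC -addrA -opprB -polyCB addrAC.
Qed.

Lemma addgroupN rs r : addgroup rs -> r \in rs -> - r \in rs.
Proof. by move=> [_ r0 rB] rin; rewrite -sub0r rB. Qed.

Lemma addgroupD rs r s : addgroup rs -> r \in rs -> s \in rs -> r + s \in rs.
Proof. by move=> ag rin sin; rewrite -[s]opprK; have [_ _ ->] := ag; rewrite ?addgroupN. Qed.

Lemma addgroup_mulrn rs r i : addgroup rs -> r \in rs -> r *+ i \in rs.
Proof.
move=> ag rin; elim: i => [|i IH]; first by case: ag.
by rewrite mulrS addgroupD.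
Qed.

Lemma orbit_poly_invariant rs a t : addgroup rs -> t \in rs ->
  orbit_poly rs (a - t) = orbit_poly rs a.
Proof.
move=> ag tin; have [u _ rB] := ag; rewrite /orbit_poly.
have e : perm_eq [seq r - t | r <- rs] rs.
  apply: uniq_perm => //; first by rewrite map_inj_uniq //; apply: addIr.
  move=> r; apply/mapP/idP => [[s sin ->]|rin]; first exact: rB.
  by exists (r + t); rewrite ?addrK // addgroupD.
rewrite -[RHS](perm_big _ e) /= big_map; apply: eq_bigr => r _.
by rewrite addrAC addrA.
Qed.

Lemma root_orbit_poly rs a b : root (orbit_poly rs a) b = (b - a \in rs).
Proof.
rewrite /orbit_poly -(big_map (fun r => a + r) xpredT (fun r => 'X - r%:P)).
rewrite root_prod_XsubC; apply/mapP/idP => [[r rin ->]|bin].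
  by rewrite addrC addKr.
by exists (b - a); rewrite // addrC subrK.
Qed.

Lemma orbit_poly_monic rs a : orbit_poly rs a \is monic.
Proof. exact: monic_prod_XsubC. Qed.

(** By invariance the whole orbit of [a] consists of roots of [n], and these are distinct. *)
Lemma dvd_orbit_poly rs a n : addgroup rs -> root n a ->
    (forall t, t \in rs -> n \Po ('X + t%:P) = n) ->
  exists m, n = m * orbit_poly rs a.
Proof.
move=> [u _ _] ra inv.
have [||m em] := @uniq_roots_prod_XsubC _ n [seq a + r | r <- rs].
- apply/allP => _ /mapP[r rin ->]; move: ra; rewrite -{1}(inv r rin) /root.
  by rewrite horner_comp hornerD hornerX hornerC.
- by rewrite uniq_rootsE map_inj_uniq //; apply: addrI.
by exists m; rewrite em big_map.
Qed.

(** As [k] is closed, a nonconstant invariant polynomial has a root, hence is divisible by an orbit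
    polynomial; the quotient is invariant and of smaller degree. *)
Lemma invariant_poly_ind rs (Pr : {poly k} -> Prop) : addgroup rs ->
    (forall c, c != 0 -> Pr c%:P) ->
    (forall n a, n != 0 -> (forall t, t \in rs -> n \Po ('X + t%:P) = n) ->
      Pr n -> Pr (n * orbit_poly rs a)) ->
  forall n, n != 0 -> (forall t, t \in rs -> n \Po ('X + t%:P) = n) -> Pr n.
Proof.
move=> ag PC PM n; have [s sn] := ubnP (size n).
elim: s n sn => // s IH n sn n0 inv.
have [/size_poly1P[c c0 ->]|/closed_rootP[a ra]] := boolP (size n == 1); first exact: PC.
have [m em] := dvd_orbit_poly ag ra inv.
have m0 : m != 0 by apply: contra_neq n0 => m0; rewrite em m0 mul0r.
have Z0 : orbit_poly rs a != 0 by rewrite monic_neq0 ?orbit_poly_monic.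
have minv t : t \in rs -> m \Po ('X + t%:P) = m.
  move=> tin; apply: (mulIf Z0); rewrite -em -(inv t tin) em rmorphM /=.
  by rewrite orbit_poly_shift orbit_poly_invariant.
rewrite em; apply: PM => //; apply: IH => //.
have sZ : (1 < size (orbit_poly rs a))%N.
  rewrite /orbit_poly size_prod_XsubC ltnS.
  by case: ag => _ r0 _; case: (rs) r0.
have := sn; rewrite em size_mul //; move: sZ; rewrite -size_poly_gt0 in m0.
by move: (size m) (size (orbit_poly rs a)) m0 => x y x0; lia.
Qed.

(* Multiply numerator and denominator by the conjugates of the denominator. *)
Lemma invariant_fraction rs f : addgroup rs -> f != 0 ->
    (forall t, t \in rs -> shift t f = f) ->
  exists n d : {poly k}, [/\ f = tofrac n / tofrac d, n != 0, d != 0,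
    (forall t, t \in rs -> n \Po ('X + t%:P) = n) &
    (forall t, t \in rs -> d \Po ('X + t%:P) = d)].
Proof.
move=> ag f0 inv; have [u r0 rB] := ag.
have ef := fracE f; set n0 := \n_(repr f) in ef; set d0 := \d_(repr f) in ef.
have d00 : d0 != 0 := denom_ratioP _.
pose d := \prod_(r <- rs) (d0 \Po ('X + r%:P)).
have comp0 (q : {poly k}) r : q != 0 -> q \Po ('X + r%:P) != 0.
  by move=> q0; rewrite -size_poly_gt0 size_comp_poly2 ?size_XaddC // size_poly_gt0.
have dn0 : d != 0 by rewrite prodf_seq_neq0; apply/allP => r _; rewrite /= comp0.
have dinv t : t \in rs -> d \Po ('X + t%:P) = d.
  move=> tin; have e : perm_eq [seq t + r | r <- rs] rs.
    apply: uniq_perm => //; first by rewrite map_inj_uniq //; apply: addrI.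
    move=> r; apply/mapP/idP => [[s sin ->]|rin]; first exact: addgroupD.
    by exists (r - t); rewrite ?(addrC t) ?subrK // rB.
  rewrite /d -[RHS](perm_big _ e) /= big_map rmorph_prod; apply: eq_bigr => r _ /=.
  rewrite -comp_polyA comp_polyD comp_polyX comp_polyC -addrA -polyCD.
  by [].
pose n := n0 * \prod_(r <- rs | r != 0) (d0 \Po ('X + r%:P)).
have dE : d = d0 * \prod_(r <- rs | r != 0) (d0 \Po ('X + r%:P)).
  by rewrite /d (bigD1_seq 0) //= addr0 comp_polyXr.
have en : tofrac n = f * tofrac d.
  by rewrite dE /n [LHS]tofracM [in RHS]tofracM [RHS]mulrA {1}ef divfK ?tofrac_eq0.
have td0 : tofrac d != 0 :> kx by rewrite tofrac_eq0.
exists n, d; split=> //.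
- by rewrite en mulfK.
- by rewrite -tofrac_eq0 en; exact (mulf_neq0 f0 td0).
- move=> t tin; apply/eqP; rewrite -tofrac_eq -shift_tofrac en rmorphM inv //.
  by rewrite shift_tofrac dinv.
Qed.

Section Extension.
Variable p : nat.
Hypothesis hp : p \in [pchar k].
Variables (rs : seq k) (t : k).
Hypotheses (ag : addgroup rs) (tnin : t \notin rs).

Let p_gt0 : (0 < p)%N. Proof. exact: prime_gt0 (pcharf_prime hp). Qed.

(* With r - t *+ i rather than r + t *+ i, orbit_poly_extend is a mere reindexing. *)
Definition extend : seq k := [seq r - t *+ i | i <- iota 0 p, r <- rs].

(** By Bezout, [i] is invertible modulo [p], so [t] is a multiple of [t *+ i]. *)
Lemma mulrn_notin i : (0 < i < p)%N -> t *+ i \notin rs.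
Proof.
move=> /andP[i0 ip]; apply: contra tnin => tin.
have cop : coprime i p.
  by rewrite coprime_sym prime_coprime ?(pcharf_prime hp) // gtnNdvd.
have /(coprimeP _ i0) [[a b] /= e] := cop.
have {e}e : (a * i = b * p + 1)%N by lia.
have : t *+ i *+ a \in rs by apply: addgroup_mulrn.
by rewrite -mulrnA mulnC e mulrnDr mulnC mulrnA (mulrn_pchar hp) mul0rn add0r.
Qed.

Lemma extend_addgroup : addgroup extend.
Proof.
have [u r0 rB] := ag; split.
- apply: allpairs_uniq; rewrite ?iota_uniq // => -[i r] [j s].
  move=> /allpairsP[[i' r'] /= [iin rin [-> ->]]] /allpairsP[[j' s'] /= [jin sin [-> ->]]] /= e.
  move: iin jin rin sin e; rewrite !mem_iota /= !add0n => ip jp rin sin e.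
  have ne (m n : nat) (x y : k) : (m < n)%N -> (n < p)%N -> x \in rs -> y \in rs ->
      x - t *+ m = y - t *+ n -> False.
    move=> mn np xin yin exy; have : t *+ (n - m) \in rs.
      rewrite mulrnBr 1?ltnW //; suff -> : t *+ n - t *+ m = y - x by apply: rB.
      by rewrite -[y](subrK (t *+ n)) -exy; ring.
    by apply/negP/mulrn_notin; rewrite subn_gt0 mn (leq_ltn_trans (leq_subr _ _) np).
  case: (ltngtP i' j') => [ij|ji|eij].
  - by case: (ne i' j' r' s').
  - by case: (ne j' i' s' r').
  - by move: e; rewrite eij => /addIr ->.
- by apply/allpairsP; exists (0%N, 0); rewrite /= mem_iota p_gt0 r0 mulr0n subr0.
- move=> _ _ /allpairsP[[i r] /= [+ rin ->]] /allpairsP[[j s] /= [+ sin ->]].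
  rewrite !mem_iota /= !add0n => ip jp; apply/allpairsP.
  have [ji|ij] := leqP j i.
    exists ((i - j)%N, r - s); rewrite /= mem_iota /= add0n rB //; split=> //.
      exact: leq_ltn_trans (leq_subr _ _) ip.
    by rewrite mulrnBr //; ring.
  exists ((p - (j - i))%N, r - s); rewrite /= mem_iota /= add0n rB //; split=> //.
    by rewrite ltn_subrL subn_gt0 ij.
  rewrite mulrnBr ?mulrnBr; try lia.
  by rewrite (mulrn_pchar hp); ring.
Qed.

Lemma size_extend : (size rs < size extend)%N.
Proof.
rewrite size_allpairs size_iota; have := prime_gt1 (pcharf_prime hp).
have : (0 < size rs)%N by case: ag => _ r0 _; case: (rs) r0.
by move: (size rs) => n n0 p1; nia.
Qed.

Lemma orbit_poly_extend a : tofrac (orbit_poly extend a) =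
  \prod_(i < p) shift (t *+ i) (tofrac (orbit_poly rs a)).
Proof.
transitivity (tofrac (\prod_(i < p) orbit_poly rs (a - t *+ i)) : kx).
  congr tofrac; rewrite /orbit_poly /extend big_allpairs_dep -{1}(subn0 p) -/(index_iota 0 p).
  rewrite big_mkord; apply: eq_bigr => i _; apply: eq_bigr => r _.
  by rewrite addrAC addrA.
rewrite rmorph_prod; apply: eq_bigr => i _.
by rewrite shift_tofrac orbit_poly_shift.
Qed.

(* An invariant function is a constant times a quotient of products of orbit
   polynomials, and the orbit polynomials of the larger group are norms. *)
Lemma norm_onto f : f != 0 -> (forall r, r \in extend -> shift r f = f) ->
  exists d, [/\ d != 0, forall r, r \in rs -> shift r d = d &
    f = \prod_(i < p) shift (t *+ i) d].
Proof.
move=> f0 inv.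
pose Nm (g : kx) := exists d, [/\ d != 0, forall r, r \in rs -> shift r d = d &
    g = \prod_(i < p) shift (t *+ i) d].
have NmM g h : Nm g -> Nm h -> Nm (g * h).
  move=> [d [d0 dr ->]] [e [e0 er ->]]; exists (d * e); split.
  - exact (mulf_neq0 d0 e0).
  - by move=> r rin; rewrite rmorphM dr // er.
  - by rewrite -big_split; apply: eq_bigr => i _; rewrite rmorphM.
have NmV g : Nm g -> Nm g^-1.
  move=> [d [d0 dr ->]]; exists d^-1; split.
  - by rewrite invr_eq0.
  - by move=> r rin; rewrite (fmorphV (shift r)) dr.
  - rewrite -prodfV; apply: eq_bigr => i _; by rewrite (fmorphV (shift _)).
have Nmpoly n : n != 0 -> (forall r, r \in extend -> n \Po ('X + r%:P) = n) -> Nm (tofrac n).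
  apply: (invariant_poly_ind extend_addgroup (Pr := fun n => Nm (tofrac n))).
  (* A constant is the norm of any of its p-th roots. *)
  - move=> c c0; have [g gp] := @solve_monicpoly k p (fun i => if i == 0%N then c else 0) p_gt0.
    have {}gp : g ^+ p = c.
      rewrite gp -(prednK p_gt0) big_ord_recl /= mulr1 big1 ?addr0 // => i _.
      by rewrite mul0r.
    have g0 : g != 0 by apply: contra_neq c0 => g0; rewrite -gp g0 expr0n gtn_eqF.
    exists (@kx_cst k g); split; first by rewrite fmorph_eq0.
      by move=> r _; apply: shift_cst.
    rewrite (eq_bigr (fun _ => @kx_cst k g)); last by move=> i _; apply: shift_cst.
    by rewrite prodr_const card_ord -rmorphXn gp.
  - move=> m a m0 minv Nmm; rewrite tofracM; apply: NmM => //.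
    exists (tofrac (orbit_poly rs a)); split.
    + by rewrite tofrac_eq0 monic_neq0 ?orbit_poly_monic.
    + by move=> r rin; rewrite shift_tofrac orbit_poly_shift orbit_poly_invariant.
    + exact: orbit_poly_extend.
have [n [d [-> n0 d0 ninv dinv]]] := invariant_fraction extend_addgroup f0 inv.
by apply: NmM; [apply: Nmpoly|apply: NmV; apply: Nmpoly].
Qed.

(** This supplies the element with [p] distinct conjugates that [hilbert90] requires: translates by
    distinct multiples of [t] vanish on distinct cosets. *)
Lemma orbit_poly_moved i : (0 < i < p)%N ->
  shift (t *+ i) (tofrac (orbit_poly rs 0)) != tofrac (orbit_poly rs 0).
Proof.
move=> ip; rewrite shift_tofrac orbit_poly_shift tofrac_eq sub0r.
apply/eqP => /(congr1 (fun q : {poly k} => root q (- (t *+ i)))).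
rewrite !root_orbit_poly subrr subr0; have [_ -> _] := ag.
move=> /esym/(addgroupN ag); rewrite opprK; apply/negP; exact: mulrn_notin.
Qed.

End Extension.

(** For polynomials, induction on orbit factors: if the new orbit already divides [g], it moves into
    the square; otherwise it shares no root with [g], which stays square-free. *)
Lemma squarefree_part rs f : addgroup rs -> f != 0 ->
    (forall r, r \in rs -> shift r f = f) ->
  exists (h : kx) (g : {poly k}), [/\ h != 0, forall r, r \in rs -> shift r h = h,
    g \is monic, (forall a, root g a -> mup a g = 1%N) & f = h ^+ 2 * tofrac g].
Proof.
move=> ag f0 inv.
pose Pr (n : {poly k}) := exists h g : {poly k},
  [/\ h != 0, forall r, r \in rs -> h \Po ('X + r%:P) = h,
      g \is monic, (forall r, r \in rs -> g \Po ('X + r%:P) = g) /\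
      (forall a, root g a -> mup a g = 1%N) & n = h ^+ 2 * g].
have P n : n != 0 -> (forall r, r \in rs -> n \Po ('X + r%:P) = n) -> Pr n.
  apply: (invariant_poly_ind ag (Pr := Pr)).
  - move=> c c0; have [d dc] := @solve_monicpoly k 2 (fun i => if i == 0%N then c else 0) isT.
    have {}dc : d ^+ 2 = c by rewrite dc !big_ord_recl big_ord0 /= mulr1 mul0r !addr0.
    have d0 : d != 0 by apply: contra_neq c0 => d0; rewrite -dc d0 expr0n.
    exists d%:P, 1; split; rewrite ?polyC_eq0 ?monic1 //.
    + by move=> r _; rewrite comp_polyC.
    + by split=> [r _|a]; rewrite ?comp_polyC // (negPf (root1 a)).
    + by rewrite mulr1 -polyC_exp dc.
  - move=> {}n a n0 ninv [h [g [h0 hinv mg [ginv gsf] en]]].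
    have Z0 : orbit_poly rs a != 0 by rewrite monic_neq0 ?orbit_poly_monic.
    have Zinv r : r \in rs -> orbit_poly rs a \Po ('X + r%:P) = orbit_poly rs a.
      by move=> rin; rewrite orbit_poly_shift orbit_poly_invariant.
    have Zsf b : root (orbit_poly rs a) b -> mup b (orbit_poly rs a) = 1%N.
      rewrite root_orbit_poly /orbit_poly => bin.
      rewrite -(big_map (fun r => a + r) xpredT (fun r => 'X - r%:P)) mu_prod_XsubC.
      have [u _ _] := ag; rewrite count_uniq_mem ?map_inj_uniq //; last exact: addrI.
      by rewrite -(mem_map (addrI a)) addrC subrK in bin; rewrite bin.
    have [ra|nra] := boolP (root g a).
      have [m em] := dvd_orbit_poly ag ra ginv.
      have g0 := monic_neq0 mg.
      have m0 : m != 0 by apply: contra_neq g0 => m0; rewrite em m0 mul0r.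
      exists (h * orbit_poly rs a), m; split.
      + by rewrite mulf_neq0.
      + by move=> r rin; rewrite rmorphM /= hinv // Zinv.
      + by rewrite -(monicMr _ (orbit_poly_monic rs a)) -em.
      + split=> [r rin|b rb].
          by apply: (mulIf Z0); rewrite -em -(ginv r rin) em rmorphM /= Zinv.
        have := gsf b; rewrite em rootM rb /= mupM // => /(_ isT).
        have : (0 < mup b m)%N by rewrite -XsubC_dvd // dvdp_XsubCl.
        by case: (mup b m) => // -[|q] //= _; case: (mup _ _).
      + by rewrite en em; ring.
    exists h, (g * orbit_poly rs a); split=> //.
    + by rewrite monicMr ?orbit_poly_monic.
    + split=> [r rin|b]; first by rewrite rmorphM /= ginv // Zinv.
      have excl : root (orbit_poly rs a) b -> ~~ root g b.
        rewrite root_orbit_poly => bin; apply: contra nra.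
        rewrite -{1}(ginv _ (addgroupN ag bin)) /root horner_comp hornerD hornerX hornerC.
        by rewrite opprB addrC subrK.
      rewrite rootM => /orP[rb|rb]; last by rewrite mupMr ?excl // Zsf.
      rewrite mupMl ?gsf //; apply: contraTN rb => rb; exact: excl.
    + by rewrite en mulrA.
(* The quotient n / d and the product n d differ by the square of d, which reduces fractions to
   polynomials. *)
have [n [d [ef n0 d0 ninv dinv]]] := invariant_fraction ag f0 inv.
have nd0 : n * d != 0 by rewrite mulf_neq0.
have ndinv r : r \in rs -> (n * d) \Po ('X + r%:P) = n * d.
  by move=> rin; rewrite rmorphM /= ninv // dinv.
have [h [g [h0 hinv mg [_ gsf] en]]] := P _ nd0 ndinv.
have td0 : tofrac d != 0 :> kx by rewrite tofrac_eq0.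
have th0 : tofrac h != 0 :> kx by rewrite tofrac_eq0.
exists (tofrac h / tofrac d), g.
split; [exact (div_neq0 th0 td0)| |exact mg|exact gsf|].
- by move=> r rin; rewrite (fmorph_div (shift r)) !shift_tofrac hinv // dinv.
- have e2 : tofrac n * tofrac d = tofrac h ^+ 2 * tofrac g :> kx.
    by rewrite -tofracM en [LHS]tofracM expr2 tofracM.
  rewrite ef; exact (square_fraction_identity td0 e2).
Qed.

End AdditiveGroups.

(** * The group structure of the de Jonquieres group *)

(** The matrix [C = invmx B *m A] fixes [t]. This is a quadratic equation for [t], whose
    coefficients must vanish, so [C] is scalar. *)
Lemma mobius_inj (F L : fieldType) (c : {rmorphism F -> L}) (A B : 'M[F]_2) (t : L) :
    (forall a b d, c a * t ^+ 2 + c b * t + c d = 0 -> [/\ a = 0, b = 0 & d = 0]) ->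
    A \in unitmx -> B \in unitmx -> mobius c A t = mobius c B t ->
  exists2 l : F, l != 0 & A = l *: B.
Proof.
move=> indep uA uB e.
have nt : Defs.nondegenerate c t.
  move=> a b h; have := indep 0 a b; rewrite rmorph0 mul0r add0r => /(_ h) [].
  by [].
pose C := invmx B *m A.
have uC : C \in unitmx by rewrite unitmx_mul unitmx_inv uB uA.
have eC : mobius c C t = t.
  rewrite /C -mobius_comp ?mden_neq0 // e mobius_comp ?mden_neq0 //.
  by rewrite mulVmx // mobius1.
have BC : A = B *m C by rewrite mulKVmx.
clearbody C.
have dC : mden c C t != 0 by apply: mden_neq0.
have : c (C 1 0) * t ^+ 2 + c (C 1 1 - C 0 0) * t + c (- C 0 1) = 0.
  have h : mobius c C t * mden c C t = c (C 0 0) * t + c (C 0 1) by exact: divfK dC _.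
  rewrite eC /mden in h; rewrite rmorphB rmorphN.
  by rewrite -[RHS](subrr (c (C 0 0) * t + c (C 0 1))) -{1}h; ring.
move=> /indep [C10 /eqP C11 /eqP C01]; rewrite subr_eq0 in C11; rewrite oppr_eq0 in C01.
move: C11 C01 => /eqP C11 /eqP C01.
have CE : C = (C 0 0)%:M.
  by apply: mx2P; rewrite !mxE /= ?mulr1n ?mulr0n.
exists (C 0 0).
  apply: contraTneq uC => C00; rewrite mx2_unitE C00 C01 mul0r mul0r subr0.
  by rewrite eqxx.
by rewrite {1}BC {1}CE mul_mx_scalar.
Qed.

Section DeJonquieresGroup.
Variable k : fieldType.
Local Notation kx := {fraction {poly k}}.
Implicit Types (A P Q : 'M[kx]_2) (B : 'M[k]_2) (t : k).

Lemma x_quadratic_indep (a b d : k) :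
    @kxy_cst k a * kxy_x k ^+ 2 + @kxy_cst k b * kxy_x k + @kxy_cst k d = 0 ->
  [/\ a = 0, b = 0 & d = 0].
Proof.
rewrite /kxy_cst /kxy_x /= -tofracXn -!tofracM -!tofracD => /eqP.
rewrite tofrac_eq0 -polyC_exp -!polyCM -!polyCD polyC_eq0 => /eqP e.
have c i := congr1 (fun q : {poly k} => q`_i) e.
have := c 0%N; have := c 1%N; have := c 2%N.
by rewrite !(coefD, coefCM, coefXn, coefX, coefC, coef0) /= !(mulr0, mulr1, addr0, add0r).
Qed.

Lemma lead_kx_kxy (a : kx) : lead (@kx_kxy k a) 0 a.
Proof.
rewrite [X in lead (kx_kxy X)](fracE a) kx_kxy_frac; exists (\n_(repr a))%:P, (\d_(repr a))%:P, 0%N.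
split=> //.
- by rewrite polyC_eq0 denom_ratioP.
- exact: size_polyC_leq1.
- by rewrite size_polyC denom_ratioP.
- by rewrite [LHS]fracE coefC lead_coefC.
Qed.

(** The three terms have degrees 2, 1 and 0 in y, and comparing leading terms kills the coefficients
    one after the other. *)
Lemma y_quadratic_indep (a b d : kx) :
    @kx_kxy k a * kxy_y k ^+ 2 + @kx_kxy k b * kxy_y k + @kx_kxy k d = 0 ->
  [/\ a = 0, b = 0 & d = 0].
Proof.
move=> e; have ly : lead (kxy_y k) 1 1.
  have := @lead_tofrac _ ('X : {poly {poly k}}) 1.
  by rewrite size_polyX coefX tofrac1; apply.
have la := leadM (lead_kx_kxy a) (leadX 2 ly).
have lb := leadM (lead_kx_kxy b) ly; have ld := lead_kx_kxy d.
have {}la : lead (@kx_kxy k a * kxy_y k ^+ 2) 2 a.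
  by apply: (lead_cast la) => //; rewrite expr1n mulr1.
have {}lb : lead (@kx_kxy k b * kxy_y k) 1 b by apply: (lead_cast lb) => //; rewrite mulr1.
have l2 := leadD (leadD la (lead_lower lb (isT : (1 : int) < 2))) (lead_lower ld (isT : (0 : int) < 2)).
rewrite e !addr0 in l2; have a0 := lead_uniq l2 (lead0 _ _).
rewrite a0 rmorph0 mul0r add0r in e.
have l1 := leadD lb (lead_lower ld (isT : (0 : int) < 1)).
rewrite e addr0 in l1; have b0 := lead_uniq l1 (lead0 _ _).
rewrite b0 rmorph0 mul0r add0r in e.
by rewrite e in ld; have d0 := lead_uniq ld (lead0 _ _).
Qed.

Lemma dJ_pglE A B : A \in unitmx -> B \in unitmx ->
  crval (dJ (pgl A) (pgl B)) = dJ_map A B.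
Proof.
move=> uA uB; have [c c0 ec] := pgl_repr uA; have [d d0 ed] := pgl_repr uB.
rewrite -[LHS]/(dJ_map (repr (pgl A)) (repr (pgl B))) ec ed /dJ_map.
exact (f_equal2 pair (mobiusZ (@kxy_cst k) B _ d0) (mobiusZ (@kx_kxy k) A _ c0)).
Qed.

Lemma dJM A A' B B' : A \in unitmx -> A' \in unitmx -> B \in unitmx -> B' \in unitmx ->
  (dJ (pgl A) (pgl B) * dJ (pgl A') (pgl B'))%g =
  dJ (pgl (map_mx (mobius_kx B') A *m A')) (pgl (B *m B')).
Proof.
move=> uA uA' uB uB'; apply: val_inj.
have uA2 : map_mx (mobius_kx B') A *m A' \in unitmx.
  by rewrite unitmx_mul uA' andbT; exact (map_mobius_kx_unit uB' uA).
have uB2 : B *m B' \in unitmx by rewrite unitmx_mul uB.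
refine (etrans _ (esym (dJ_pglE uA2 uB2))).
refine (etrans _ (dJ_map_mul uA uA' uB uB')).
exact (f_equal2 (@ratmap_comp k) (dJ_pglE uA uB) (dJ_pglE uA' uB')).
Qed.

Lemma dJ_inj A A' B B' : A \in unitmx -> A' \in unitmx -> B \in unitmx -> B' \in unitmx ->
  dJ (pgl A) (pgl B) = dJ (pgl A') (pgl B') -> pgl A = pgl A' /\ pgl B = pgl B'.
Proof.
move=> uA uA' uB uB' e.
have := etrans (esym (dJ_pglE uA uB)) (etrans (congr1 (@crval k) e) (dJ_pglE uA' uB')).
move=> e'; have eB := congr1 fst e'; have eA := congr1 snd e'; split.
- have h := @mobius_inj _ _ (@kx_kxy k) A A' (kxy_y k) y_quadratic_indep uA uA' eA.
  exact (proj2 (pgl_eq uA uA') h).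
- have h := @mobius_inj _ _ (@kxy_cst k) B B' (kxy_x k) x_quadratic_indep uB uB' eB.
  exact (proj2 (pgl_eq uB uB') h).
Qed.

Lemma dJ1 : dJ (pgl 1%:M) (pgl 1%:M) = 1%g :> Cr k.
Proof. by apply: val_inj; exact (etrans (dJ_pglE (unitmx1 _ _) (unitmx1 _ _)) (dJ_map1 k)). Qed.

Lemma deJonquieresP u : deJonquieres k u <->
  exists A B, [/\ A \in unitmx, B \in unitmx & u = dJ (pgl A) (pgl B)].
Proof.
split.
- move=> [a [b [c [d [al [be [ga [de [B0 A0 e]]]]]]]]].
  pose B : 'M[k]_2 := mx_of_rows 2 [:: [:: a; b]; [:: c; d]].
  pose A : 'M[kx]_2 := mx_of_rows 2 [:: [:: al; be]; [:: ga; de]].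
  have uB : B \in unitmx by rewrite mx2_unitE !mxE.
  have uA : A \in unitmx by rewrite mx2_unitE !mxE.
  exists A, B; split=> //; apply: val_inj; refine (etrans e (esym (etrans (dJ_pglE uA uB) _))).
  by rewrite /dJ_map /mobius !mxE.
- move=> [A [B [uA uB ->]]].
  exists (B 0 0), (B 0 1), (B 1 0), (B 1 1), (A 0 0), (A 0 1), (A 1 0), (A 1 1).
  by split; [rewrite -mx2_unitE|rewrite -mx2_unitE|exact (dJ_pglE uA uB)].
Qed.

Lemma dJ_right_inverse A B : A \in unitmx -> B \in unitmx -> exists A' B',
  [/\ A' \in unitmx, B' \in unitmx & (dJ (pgl A) (pgl B) * dJ (pgl A') (pgl B') = 1)%g].
Proof.
move=> uA uB; have uB' : invmx B \in unitmx by rewrite unitmx_inv.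
pose C := map_mx (mobius_kx (invmx B)) A.
have uC : C \in unitmx := map_mobius_kx_unit uB' uA.
have uC' : invmx C \in unitmx by rewrite unitmx_inv.
have e : (dJ (pgl A) (pgl B) * dJ (pgl (invmx C)) (pgl (invmx B)))%g =
  dJ (pgl (C *m invmx C)) (pgl (B *m invmx B)) := dJM uA uC' uB uB'.
exists (invmx C), (invmx B); split=> //.
by rewrite e (mulmxV uC) (mulmxV uB) dJ1.
Qed.

Lemma deJonquieres_subgroup : subgroup (deJonquieres k).
Proof.
split.
- by apply/deJonquieresP; exists 1%:M, 1%:M; rewrite !unitmx1 dJ1.
- move=> u v /deJonquieresP[A [B [uA uB ->]]] /deJonquieresP[A' [B' [uA' uB' ->]]].
  have uAB : map_mx (mobius_kx B') A *m A' \in unitmx.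
    by rewrite unitmx_mul uA' andbT; exact (map_mobius_kx_unit uB' uA).
  have uBB : B *m B' \in unitmx by rewrite unitmx_mul uB.
  apply/deJonquieresP; exists (map_mx (mobius_kx B') A *m A'), (B *m B').
  by split; [exact uAB|exact uBB|exact (dJM uA uA' uB uB')].
- move=> u /deJonquieresP[A [B [uA uB ->]]].
  have [A' [B' [uA' uB' e]]] := dJ_right_inverse uA uB.
  have -> : ((dJ (pgl A) (pgl B))^-1 = dJ (pgl A') (pgl B'))%g.
    by apply: (mulgI (dJ (pgl A) (pgl B))); rewrite e mulgV.
  by apply/deJonquieresP; exists A', B'.
Qed.

(* the map (x, y) |-> (x + t, A(x) y) *)
Definition dJt A t : Cr k := dJ (pgl A) (pgl (tr_mx t)).

Lemma map_shift t A : map_mx (mobius_kx (tr_mx t)) A = map_mx (shift t) A.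
Proof. by apply/matrixP => i j; rewrite !mxE shiftE. Qed.

Lemma dJtM A A' s t : A \in unitmx -> A' \in unitmx ->
  (dJt A s * dJt A' t)%g = dJt (map_mx (shift t) A *m A') (s + t).
Proof.
move=> uA uA'; rewrite -map_shift /dJt -tr_mxD.
exact (dJM uA uA' (tr_mx_unit s) (tr_mx_unit t)).
Qed.

Lemma map_shift_unit t A : A \in unitmx -> map_mx (shift t) A \in unitmx.
Proof. by move=> uA; rewrite map_unitmx. Qed.

Lemma map_shift0 A : map_mx (shift 0) A = A.
Proof. by apply/matrixP => i j; rewrite mxE shift0. Qed.

Lemma dJt1 : dJt 1%:M 0 = 1%g.
Proof. by rewrite /dJt tr_mx0 dJ1. Qed.

Lemma dJtV A : A \in unitmx -> (dJt A 0)^-1%g = dJt (invmx A) 0.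
Proof.
move=> uA; apply: (mulgI (dJt A 0)); rewrite mulgV dJtM ?unitmx_inv //.
by rewrite map_shift0 mulmxV // addr0 dJt1.
Qed.

Lemma dJt_inj A A' s t : A \in unitmx -> A' \in unitmx ->
  dJt A s = dJt A' t -> pgl A = pgl A' /\ s = t.
Proof.
move=> uA uA' e.
have [eA eB] := dJ_inj uA uA' (tr_mx_unit s) (tr_mx_unit t) e; split; first exact eA.
have [c _ {}e] := proj1 (pgl_eq (tr_mx_unit s) (tr_mx_unit t)) eB.
have := congr1 (fun M : 'M_2 => M 0 0) e; have := congr1 (fun M : 'M_2 => M 0 1) e.
by rewrite !mxE /= mulr1 => -> <-; rewrite mul1r.
Qed.

Lemma dJtZ (c : kx) A t : c != 0 -> A \in unitmx -> dJt (c *: A) t = dJt A t.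
Proof. by move=> c0 uA; exact (f_equal2 (@dJ k) (pglZ c0 uA) erefl). Qed.

Lemma dJt_deJonquieres A t : A \in unitmx -> deJonquieres k (dJt A t).
Proof. by move=> uA; apply/deJonquieresP; exists A, (tr_mx t); rewrite tr_mx_unit. Qed.

End DeJonquieresGroup.

(** * Elementary subgroups of the de Jonquieres group *)

Lemma conjg_eq (G : groupType) (x y g : G) : (x * g = g * y)%g -> (x ^ g = y)%g.
Proof. by move=> e; rewrite conjgE e mulgA mulVg mul1g. Qed.

Section FiniteElementary.
Variable G : groupType.
Local Open Scope group_scope.

(** What is kept of elementarity, in a form that passes to conjugates. The bound [N] on the order
    makes the enlargement of the group of translations terminate. *)
Definition finite_elementary (p N : nat) (H : set G) : Prop :=
  [/\ subgroup H, forall u v, H u -> H v -> u * v = v * u,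
      forall u, H u -> u ^+ p = 1 &
      exists2 s : seq G, (size s <= N)%N & forall u, H u -> u \in s].

Lemma finite_elementary_conj p N g (H : set G) :
  finite_elementary p N H -> finite_elementary p N [set h ^ g | h in H].
Proof.
move=> [sH cH pH [s sN sP]]; split; first exact: conj_subgroup.
- by move=> _ _ [u Hu <-] [v Hv <-]; rewrite -!conjMg cH.
- by move=> _ [u Hu <-]; rewrite -conjXg pH // conj1g.
- exists [seq h ^ g | h <- s]; first by rewrite size_map.
  by move=> _ [u Hu <-]; apply: map_f; apply: sP.
Qed.

Lemma elementary_finite p (H : set G) : prime p -> elementary p H ->
  exists N, finite_elementary p N H.
Proof.
move=> pp [r [sH [f [fD fI fH]]]].
have inH u : H u -> exists v, u = f v by rewrite -fH => -[v _ <-]; exists v.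
have f0 : f 0%R = 1 by apply: (mulgI (f 0%R)); rewrite -fD addr0 mulg1.
have fX v n : f v ^+ n = f (v *+ n)%R.
  by elim: n => [|n IH]; rewrite ?expg0 ?mulr0n ?f0 // expgS mulrS fD IH.
exists #|{: 'rV['F_p]_r}|; split=> //.
- by move=> u v /inH[a ->] /inH[b ->]; rewrite -!fD addrC.
- move=> u /inH[a ->]; rewrite fX -[RHS]f0; congr f; apply/rowP => i.
  by rewrite mulmxnE mxE mulrn_pchar // pchar_Fp.
- exists [seq f v | v <- enum {: 'rV['F_p]_r}]; first by rewrite size_map cardE.
  by move=> u /inH[a ->]; apply: map_f; rewrite mem_enum.
Qed.

End FiniteElementary.

(** * The action on the base *)

Section ProjectionToBase.
Variables (k : closedFieldType) (p : nat).
Hypothesis hp : p \in [pchar k].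
Local Notation kx := {fraction {poly k}}.

Let p_prime : prime p := pcharf_prime hp.
Let p_gt0 : (0 < p)%N := prime_gt0 p_prime.

Lemma pth_root (c : k) : exists d, d ^+ p = c.
Proof.
have [g gp] := @solve_monicpoly k p (fun i => if i == 0%N then c else 0) p_gt0.
exists g; rewrite gp -(prednK p_gt0) big_ord_recl /= mulr1 big1 ?addr0 // => i _.
by rewrite mul0r.
Qed.

(** Only the base component is tracked; the fibre component is left unspecified. *)
Lemma dJ_exp (A : 'M[kx]_2) (B : 'M[k]_2) n : A \in unitmx -> B \in unitmx ->
  exists2 A' : 'M[kx]_2, A' \in unitmx &
    ((dJ (pgl A) (pgl B)) ^+ n)%g = dJ (pgl A') (pgl (B ^+ n)).
Proof.
move=> uA uB; elim: n => [|n [A' uA' IH]].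
  by exists 1%:M; rewrite ?unitmx1 // expg0 expr0; exact (esym (dJ1 k)).
have uBn : B ^+ n \in unitmx by apply: unitrX.
have uAA : map_mx (mobius_kx (B ^+ n)) A *m A' \in unitmx.
  by rewrite unitmx_mul uA' andbT; exact (map_mobius_kx_unit uBn uA).
exists (map_mx (mobius_kx (B ^+ n)) A *m A') => //.
by rewrite expgS IH exprS; exact (dJM uA uA' uB uBn).
Qed.

(** The base matrices commute up to scalars and have scalar p-th powers. If one of them is not
    scalar, its p-th power is a p-th power in [k], and [simultaneously_unipotent] applies; otherwise
    all act trivially. *)
Lemma translations_on_base N (G : set (Cr k)) : finite_elementary p N G ->
  G `<=` deJonquieres k ->
  exists2 h, deJonquieres k h &
    forall u, [set g ^ h | g in G]%g u ->
      exists A t, A \in unitmx /\ u = dJt A t.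
Proof.
move=> [sG cG pG _] GJ.
pose MM : set 'M[k]_2 := [set B | B \in unitmx /\
  exists2 A : 'M[kx]_2, A \in unitmx & G (dJ (pgl A) (pgl B))].
suff [Q uQ QP] : exists2 Q : 'M[k]_2, Q \in unitmx &
    forall B, MM B -> exists a b : k, a != 0 /\ B *m Q = Q *m (a *: tr_mx b).
  have u1 := unitmx1 kx 2.
  exists (dJ (pgl 1%:M) (pgl Q)); first by apply/deJonquieresP; exists 1%:M, Q.
  move=> _ [g Gg <-]; have [A [B [uA uB eg]]] := (deJonquieresP g).1 (GJ g Gg).
  have [a [b [a0 eQ]]] : exists a b : k, a != 0 /\ B *m Q = Q *m (a *: tr_mx b).
    by apply: QP; split=> //; exists A => //; rewrite -eg.
  have uA' : map_mx (mobius_kx Q) A \in unitmx := map_mobius_kx_unit uQ uA.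
  exists (map_mx (mobius_kx Q) A), b; split; first exact uA'.
  apply: conjg_eq; rewrite eg.
  refine (etrans (dJM uA u1 uB uQ) (etrans _ (esym (dJM u1 uA' uQ (tr_mx_unit b))))).
  have uQt : Q *m tr_mx b \in unitmx by rewrite unitmx_mul uQ tr_mx_unit.
  have e1 : pgl (B *m Q) = pgl (Q *m tr_mx b).
    by rewrite eQ -scalemxAr; exact (pglZ a0 uQt).
  have h1 : map_mx (mobius_kx (tr_mx b)) 1%:M = 1%:M :> 'M[kx]_2.
    exact (map_mx1 (mobius_kx_rmorphism (tr_mx_unit b)) 2).
  have e2 : map_mx (mobius_kx Q) A *m 1%:M =
      map_mx (mobius_kx (tr_mx b)) 1%:M *m map_mx (mobius_kx Q) A.
    by rewrite h1 mulmx1 mul1mx.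
  exact (f_equal2 (@dJ k) (congr1 (@pgl 2 kx) e2) e1).
have cM B B' : MM B -> MM B' -> exists l : k, B *m B' = l *: (B' *m B).
  move=> [uB [A uA GA]] [uB' [A' uA' GA']]; have e := cG _ _ GA GA'.
  have uA1 : map_mx (mobius_kx B') A *m A' \in unitmx.
    by rewrite unitmx_mul uA' andbT; exact (map_mobius_kx_unit uB' uA).
  have uA2 : map_mx (mobius_kx B) A' *m A \in unitmx.
    by rewrite unitmx_mul uA andbT; exact (map_mobius_kx_unit uB uA').
  have uB1 : B *m B' \in unitmx by rewrite unitmx_mul uB.
  have uB2 : B' *m B \in unitmx by rewrite unitmx_mul uB uB'.
  have e' := etrans (esym (dJM uA uA' uB uB')) (etrans e (dJM uA' uA uB' uB)).
  have [_ eB] := dJ_inj uA1 uA2 uB1 uB2 e'.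
  by have [l _ el] := proj1 (pgl_eq uB1 uB2) eB; exists l.
have pM B : MM B -> exists c : k, B ^+ p = c%:M.
  move=> [uB [A uA GA]]; have [A' uA' e] := dJ_exp p uA uB.
  have {}e := etrans (dJ1 k) (etrans (esym (pG _ GA)) e); have uBp : B ^+ p \in unitmx by apply: unitrX.
  have [_ eB] := dJ_inj (unitmx1 _ _) uA' (unitmx1 _ _) uBp e.
  have [c c0 ec] := proj1 (pgl_eq (unitmx1 _ _) uBp) eB.
  exists c^-1; rewrite -[LHS]scale1r -(mulVf c0) -scalerA -ec; exact: scalemx1.
have [[B0 [MB0 nB0]]|all_scalar] := pselect (exists B0, MM B0 /\ forall d : k, B0 != d%:M).
  have [c ec] := pM _ MB0; have [d dc] := pth_root c.
  have uM B : MM B -> B \in unitmx by case.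
  have sM B (s : {rmorphism k -> k}) : MM B -> False -> map_mx s B = B by [].
  have cM0 B : MM B -> exists l : k, B0 *m B = l *: (B *m B0) by move=> MB; apply: cM.
  have e0 : B0 ^+ p = (d ^+ p)%:M by rewrite ec dc.
  have n0 := nB0 d.
  have [Q [uQ _ QP]] := @simultaneously_unipotent k p _ MM B0 d hp uM sM cM0 pM MB0 e0 n0.
  by exists Q.
exists 1%:M; first exact: unitmx1.
move=> B MB; have [d eB] : exists d : k, B = d%:M.
  apply: contrapT => nB; apply: all_scalar; exists B; split=> // d.
  by apply/eqP => eB; apply: nB; exists d.
exists d, 0; split.
  apply/eqP => d0; have [uB _] := MB; move: uB.
  by rewrite eB d0 unitmxE det_scalar expr0n unitr0.
by rewrite eB mulmx1 mul1mx tr_mx0 scalemx1.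
Qed.

End ProjectionToBase.

Lemma scale_unit (F : fieldType) n (c : F) (A : 'M[F]_n) : c != 0 ->
  A \in unitmx -> c *: A \in unitmx.
Proof. by move=> c0 uA; rewrite unitmxZ // unitfE. Qed.

(** * Norms of matrices under an endomorphism *)

Section TwistedPowers.
Variables (F : fieldType) (s : {rmorphism F -> F}).
Implicit Types A P : 'M[F]_2.

(** For [s] the shift by t, this is the fibre part of the n-th power of (x + t, A(x) y), see
    [dJt_pow]. *)
Fixpoint twisted_pow A n : 'M[F]_2 :=
  if n is m.+1 then map_mx s (twisted_pow A m) *m A else 1%:M.

Lemma twisted_powSl A n :
  twisted_pow A n.+1 = map_mx (iter n s) A *m twisted_pow A n.
Proof.
elim: n => [|n IH].
  by rewrite /= map_mx1 mul1mx mulmx1; apply/matrixP => i j; rewrite mxE.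
rewrite [LHS]/= -/(twisted_pow A n.+1) {1}IH map_mxM -mulmxA.
by congr (_ *m _); apply/matrixP => i j; rewrite !mxE.
Qed.

Lemma twisted_pow_unit A n : A \in unitmx -> twisted_pow A n \in unitmx.
Proof. by move=> uA; elim: n => [|n IH]; rewrite ?unitmx1 //= unitmx_mul map_unitmx IH. Qed.

Lemma twisted_powZ a A n :
  twisted_pow (a *: A) n = (\prod_(i < n) iter i s a) *: twisted_pow A n.
Proof.
elim: n => [|n IH]; first by rewrite big_ord0 scale1r.
rewrite /= IH big_ord_recl /= map_mxZ rmorph_prod -scalemxAl -scalemxAr scalerA mulrC.
by [].
Qed.

Lemma twisted_pow_fixed (tau : {rmorphism F -> F}) A n :
    (forall x, tau (s x) = s (tau x)) -> map_mx tau A = A ->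
  map_mx tau (twisted_pow A n) = twisted_pow A n.
Proof.
move=> ts tA; elim: n => [|n IH]; first exact: map_mx1.
rewrite /= map_mxM tA -[in RHS]IH; congr (_ *m _).
by apply/matrixP => i j; rewrite !mxE.
Qed.

(** Splitting a factor off either end of the product of length n + 1 gives s(c) A = c A, as the n-th
    iterate of [s] is trivial. *)
Lemma twisted_norm_fixed A n c : A \in unitmx -> (forall x, iter n s x = x) ->
  twisted_pow A n = c%:M -> s c = c.
Proof.
move=> uA sn e; have := twisted_powSl A n; rewrite [LHS]/= e.
have -> : map_mx (iter n s) A = A by apply/matrixP => i j; rewrite mxE sn.
rewrite map_scalar_mx scalar_mxC => /(congr1 (fun M => M *m invmx A)).
rewrite -!mulmxA mulmxV // !mulmx1 => /matrixP /(_ 0 0).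
by rewrite !mxE.
Qed.

(** Dividing [A] by [d] makes its norm 1, so the inverses of the twisted powers form the cocycle [D]
    that [hilbert90] trivializes. *)
Lemma twisted_conjugate n A z d : (0 < n)%N -> A \in unitmx -> d != 0 ->
    twisted_pow A n = (\prod_(i < n) iter i s d)%:M ->
    iter n s z = z -> (forall i, (0 < i < n)%N -> iter i s z != z) ->
  exists P, [/\ P \in unitmx, map_mx s P = (d^-1 *: A) *m P &
    forall tau : {rmorphism F -> F}, (forall x, tau (s x) = s (tau x)) ->
      map_mx tau A = A -> tau z = z -> tau d = d -> map_mx tau P = P].
Proof.
move=> n0 uA d0 eA zn zi; set A' := d^-1 *: A.
have uA' : A' \in unitmx by apply: scale_unit => //; rewrite invr_eq0.
have A'n : twisted_pow A' n = 1%:M.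
  rewrite twisted_powZ eA scale_scalar_mx -big_split big1 // => i _.
  elim: (nat_of_ord i) => [|j IH]; first by rewrite /= mulVf.
  by rewrite /= -rmorphM IH rmorph1.
pose D i := invmx (twisted_pow A' i).
have D0 : D 0 = 1%:M by rewrite /D /= invmx1.
have Dn : D n = 1%:M by rewrite /D A'n invmx1.
have DS i : D i.+1 = invmx A' *m map_mx s (D i).
  have uX := twisted_pow_unit i uA'; rewrite /D /= map_invmx.
  by refine (@invrM _ _ _ _ _) => //; rewrite -unitmx_unit map_unitmx.
have [P [uP eP fP]] := hilbert90 n0 D0 DS Dn zn zi.
exists P; split=> //.
- by rewrite -[in RHS]eP mulmxA mulmxV // mul1mx.
- move=> tau ts tA tz td; apply: fP => //.
  by rewrite map_invmx map_mxZ tA fmorphV td.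
Qed.

End TwistedPowers.

(* Rescaling so that some entry is 1 turns invariance up to a scalar into invariance. *)
Lemma normalize_mx (F : fieldType) (A : 'M[F]_2) : A \in unitmx -> exists c, c != 0 /\
  forall (s : {rmorphism F -> F}) l, c *: A = l *: map_mx s (c *: A) ->
    map_mx s (c *: A) = c *: A.
Proof.
move=> uA; have [[i [j Aij]]|A0] := pselect (exists i j, A i j != 0); last first.
  suff e : A = 0 by move: uA; rewrite e unitmxE det0 unitr0.
  apply/matrixP => i j; rewrite mxE; apply/eqP; apply: contrapT => /negP Aij.
  by apply: A0; exists i, j.
exists (A i j)^-1; split; first by rewrite invr_eq0.
move=> s l e; have := congr1 (fun M : 'M_2 => M i j) e.
by rewrite !mxE mulVf // rmorph1 mulr1 => l1; rewrite [RHS]e -l1 scale1r.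
Qed.

(** * Splitting off the translations of the base *)

Section SplitBase.
Variables (k : closedFieldType) (p : nat).
Hypothesis hp : p \in [pchar k].
Local Notation kx := {fraction {poly k}}.
Implicit Types (H : set (Cr k)) (rs : seq k).

Let p_prime : prime p := pcharf_prime hp.
Let p_gt0 : (0 < p)%N := prime_gt0 p_prime.

Lemma dJt1M (s t : k) : (dJt 1%:M s * dJt 1%:M t = dJt 1%:M (s + t) :> Cr k)%g.
Proof.
refine (etrans (dJtM s t (unitmx1 _ _) (unitmx1 _ _)) _).
by rewrite map_mx1 mul1mx.
Qed.

Lemma dJt_pow (A : 'M[kx]_2) (t : k) n : A \in unitmx ->
  (dJt A t ^+ n)%g = dJt (twisted_pow (shift t) A n) (t *+ n).
Proof.
move=> uA; elim: n => [|n IH]; first by rewrite expg0 mulr0n -dJt1.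
rewrite expgSr IH mulrSr.
exact (dJtM (t *+ n) t (twisted_pow_unit (shift t) n uA) uA).
Qed.

Lemma dJt_conj (A P : 'M[kx]_2) (t : k) : A \in unitmx -> P \in unitmx ->
  exists2 A', A' \in unitmx & (dJt A t ^ dJt P 0)%g = dJt A' t.
Proof.
move=> uA uP; have uP' : invmx P \in unitmx by rewrite unitmx_inv.
have u1 : map_mx (shift t) (invmx P) *m A \in unitmx.
  by rewrite unitmx_mul uA andbT; exact (map_shift_unit t uP').
exists (map_mx (shift 0) (map_mx (shift t) (invmx P) *m A) *m P).
  by rewrite unitmx_mul uP andbT; exact (map_shift_unit 0 u1).
rewrite conjgE (dJtV uP).
have e := dJtM 0 t uP' uA.
by rewrite mulgA e (dJtM (0 + t) 0 u1 uP) addr0 add0r.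
Qed.

Definition all_dJt H : Prop :=
  forall u, H u -> exists A t, A \in unitmx /\ u = dJt A t.

Lemma all_dJt_conj H P : P \in unitmx -> all_dJt H ->
  all_dJt [set h ^ dJt P 0 | h in H]%g.
Proof.
move=> uP aH _ [u /aH[A [t [uA ->]]] <-].
by have [A' uA' e] := dJt_conj t uA uP; exists A', t.
Qed.

(** The matrix [P] from Hilbert 90 conjugates (x + t, A(x) y) to (x + t, y). Being invariant under
    [rs], it also commutes with the translations already present. *)
Lemma extend_translations N H rs (A : 'M[kx]_2) t : finite_elementary p N H ->
    addgroup rs -> (forall r, r \in rs -> H (dJt 1%:M r)) ->
    A \in unitmx -> H (dJt A t) -> t \notin rs ->
  exists2 P : 'M[kx]_2, P \in unitmx &
    forall r, r \in extend p rs t -> [set h ^ dJt P 0 | h in H]%g (dJt 1%:M r).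
Proof.
move=> fH ag Hrs uA0 HA0 tnin; have [sH cH pH _] := fH.
have [c0 [c00 nA]] := normalize_mx uA0.
have uA := scale_unit c00 uA0.
have HA : H (dJt (c0 *: A) t).
  by have e := dJtZ t c00 uA0; rewrite e.
move: (c0 *: A) uA HA nA => {c0 c00 uA0 HA0} {}A uA HA nA.
(* Commutation with a translation gives invariance up to a scalar, and the normalization of [A]
   removes the scalar. *)
have Ars r : r \in rs -> map_mx (shift r) A = A.
  move=> rin; have e := cH _ _ (Hrs r rin) HA.
  have ur := map_shift_unit r uA.
  have e1 := dJtM r t (unitmx1 _ _) uA; rewrite map_mx1 mul1mx in e1.
  have e2 := dJtM t r uA (unitmx1 _ _); rewrite mulmx1 in e2.
  have [eA _] := dJt_inj uA ur (etrans (esym e1) (etrans e e2)).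
  by have [l _ el] := proj1 (pgl_eq uA ur) eA; apply: nA el.
have tp : t *+ p = 0 by rewrite (mulrn_pchar hp).
have sp x : iter p (shift t) x = x by rewrite iter_shift tp shift0.
have [c c0 ec] : exists2 c, c != 0 & twisted_pow (shift t) A p = c%:M.
  have uN := twisted_pow_unit (shift t) p uA.
  have e := etrans (esym (pH _ HA)) (dJt_pow t p uA).
  have [e1 _] := dJt_inj (unitmx1 _ _) uN (etrans (dJt1 k) e).
  have [l l0 el] := proj1 (pgl_eq (unitmx1 _ _) uN) e1.
  exists l^-1; first exact (invr_neq0 l0).
  rewrite -[LHS]scale1r -(mulVf l0) -scalerA -el; exact: scalemx1.
have ct : shift t c = c := twisted_norm_fixed uA sp ec.
have cr r : r \in rs -> shift r c = c.
  move=> rin; have := @twisted_pow_fixed _ (shift t) (shift r) A p (shiftC r t) (Ars r rin).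
  by rewrite ec map_scalar_mx => /matrixP /(_ 0 0); rewrite !mxE.
(* Being invariant under [rs] and under [t], the scalar [c] is invariant under the enlarged group,
   as [norm_onto] requires. *)
have cext r : r \in extend p rs t -> shift r c = c.
  move=> /allpairsP[[i x] /= [_ xin ->]].
  rewrite -shiftD; suff -> : shift (- (t *+ i)) c = c by apply: cr.
  have e : shift (t *+ i) c = c by rewrite -iter_shift; elim: i => //= i ->.
  by rewrite -{1}e shiftD addNr shift0.
have [d [d0 dr ed]] := norm_onto hp ag tnin c0 cext.
(* The orbit polynomial of 0 is the element [z] of [twisted_conjugate]. *)
have zp : iter p (shift t) (tofrac (orbit_poly rs 0)) = tofrac (orbit_poly rs 0) := sp _.
have zi i : (0 < i < p)%N ->
    iter i (shift t) (tofrac (orbit_poly rs 0)) != tofrac (orbit_poly rs 0).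
  by move=> ip; rewrite iter_shift; exact: (orbit_poly_moved hp ag tnin ip).
have eN : twisted_pow (shift t) A p = (\prod_(i < p) iter i (shift t) d)%:M.
  by rewrite ec ed; congr (_%:M); apply: eq_bigr => i _; rewrite iter_shift.
have [P [uP eP fP]] := twisted_conjugate p_gt0 uA d0 eN zp zi.
exists P => //.
have [H1 HM HV] := conj_subgroup (dJt P 0) sH.
set H' := [set h ^ dJt P 0 | h in H]%g in H1 HM HV *.
have H'rs r : r \in rs -> H' (dJt 1%:M r).
  move=> rin; exists (dJt 1%:M r); first exact: Hrs.
  apply: conjg_eq.
  refine (etrans (dJtM r 0 (unitmx1 _ _) uP) (etrans _ (esym (dJtM 0 r uP (unitmx1 _ _))))).
  refine (f_equal2 (@dJt k) _ (etrans (addr0 r) (esym (add0r r)))).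
  have eP' : map_mx (shift r) P = P.
    apply: fP; [exact: shiftC|exact: Ars| |exact: dr].
    by rewrite shift_tofrac orbit_poly_shift orbit_poly_invariant.
  by rewrite map_mx1 mul1mx mulmx1 eP'.
have dV : d^-1 != 0 := invr_neq0 d0.
have H't : H' (dJt 1%:M t).
  exists (dJt A t) => //; apply: conjg_eq.
  have uA' := scale_unit dV uA.
  rewrite -(dJtZ t dV uA).
  refine (etrans (dJtM t 0 uA' uP) (etrans _ (esym (dJtM 0 t uP (unitmx1 _ _))))).
  refine (f_equal2 (@dJt k) _ (etrans (addr0 t) (esym (add0r t)))).
  by rewrite eP map_shift0 mulmx1.
have H'Nt i : H' (dJt 1%:M (- (t *+ i))).
  elim: i => [|i IH]; first by rewrite mulr0n oppr0 dJt1.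
  rewrite mulrS opprD -dJt1M; apply: (HM) => //.
  suff -> : dJt 1%:M (- t) = (dJt 1%:M t)^-1%g by apply: HV.
  by apply: (mulgI (dJt 1%:M t)); rewrite mulgV dJt1M subrr dJt1.
move=> r /allpairsP[[i x] /= [_ xin ->]].
by rewrite -dJt1M; apply: HM; [apply: H'rs|apply: H'Nt].
Qed.

(** The group of translations is enlarged as long as some element of [H'] translates the base by an
    amount outside [rs]. Each step increases [size rs], which stays at most [N] because distinct
    translations are distinct elements of a conjugate of [H]. *)
Lemma translations_split N H : finite_elementary p N H -> all_dJt H ->
  exists h rs, [/\ deJonquieres k h, addgroup rs,
    (forall r, r \in rs -> [set u ^ h | u in H]%g (dJt 1%:M r)) &
    forall u, [set u ^ h | u in H]%g u -> exists A t, [/\ A \in unitmx, t \in rs & u = dJt A t]].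
Proof.
move=> fH aH; suff st m rs H' : (N - size rs < m)%N -> finite_elementary p N H' -> all_dJt H' ->
    addgroup rs -> (forall r, r \in rs -> H' (dJt 1%:M r)) ->
    exists h rs, [/\ deJonquieres k h, addgroup rs,
      (forall r, r \in rs -> [set u ^ h | u in H']%g (dJt 1%:M r)) &
      forall u, [set u ^ h | u in H']%g u ->
        exists A t, [/\ A \in unitmx, t \in rs & u = dJt A t]].
  apply: (st N.+1 [:: 0]) => //; first by rewrite ltnS leq_subr.
  - by split=> [||r s]; rewrite ?inE // => /eqP-> /eqP->; rewrite subrr.
  - by move=> r; rewrite inE => /eqP->; rewrite dJt1; have [[]] := fH.
elim: m rs H' => // m IH rs H' sm fH' aH' ag Hrs.
have [[A [t [uA HA tnin]]]|all_in] :=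
  pselect (exists A t, [/\ A \in unitmx, H' (dJt A t) & t \notin rs]).
- have [P uP PP] := extend_translations fH' ag Hrs uA HA tnin.
  have ag' := extend_addgroup hp ag tnin.
  have fH2 := finite_elementary_conj (dJt P 0) fH'.
  have sz := size_extend hp ag tnin.
  have szN : (size (extend p rs t) <= N)%N.
    have [_ _ _ [s sN sP]] := fH2.
    rewrite -(size_map (fun r => dJt 1%:M r : Cr k)); apply: leq_trans sN; apply: uniq_leq_size.
      rewrite map_inj_uniq; first by case: ag'.
      by move=> r r' e; have [_ ->] := dJt_inj (unitmx1 _ _) (unitmx1 _ _) e.
    by move=> _ /mapP[r rin ->]; apply: sP; apply: PP.
  have [|h [rs' [Jh ag2 h1 h2]]] := IH (extend p rs t) _ _ fH2 (all_dJt_conj uP aH') ag' PP.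
    by move: sm sz szN; clear; lia.
  exists (dJt P 0 * h)%g, rs'; have e : [set u ^ (dJt P 0 * h) | u in H']%g =
      [set u ^ h | u in [set u ^ dJt P 0 | u in H']]%g.
    rewrite eqEsubset; split=> x.
    - by move=> [y Hy <-]; exists (y ^ dJt P 0)%g; [exists y|rewrite conjgM].
    - by move=> [_ [y Hy <-] <-]; exists y; rewrite ?conjgM.
  rewrite e; split=> //; have [_ JM _] := deJonquieres_subgroup k.
  by apply: JM => //; apply: dJt_deJonquieres.
exists 1%g, rs; have e : [set u ^ 1 | u in H']%g = H'.
  rewrite eqEsubset; split=> x; first by move=> [y Hy <-]; rewrite conjg1.
  by move=> Hx; exists x; rewrite ?conjg1.
rewrite e; split=> //; first by have [] := deJonquieres_subgroup k.
move=> u Hu; have [A [t [uA eu]]] := aH' _ Hu; exists A, t; split=> //.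
by apply: contrapT => /negP tnin; apply: all_in; exists A, t; rewrite -eu.
Qed.

End SplitBase.

Lemma intertwiner_fixed (F : fieldType) n (s : {rmorphism F -> F}) (A Q U : 'M[F]_n) :
    Q \in unitmx -> A *m Q = Q *m U -> map_mx s A = A -> map_mx s Q = Q ->
  map_mx s U = U.
Proof.
move=> uQ e sA sQ; apply: (can_inj (mulKmx uQ)).
by rewrite -e -[in LHS]sQ -map_mxM -e map_mxM sA sQ.
Qed.

Lemma mulmx_unit (F : fieldType) n (A B : 'M[F]_n) :
  A \in unitmx -> B \in unitmx -> A *m B \in unitmx.
Proof. by move=> uA uB; rewrite unitmx_mul uA. Qed.

Lemma conj_mx_unit (F : fieldType) n (A Q U : 'M[F]_n) :
  A \in unitmx -> Q \in unitmx -> A *m Q = Q *m U -> U \in unitmx.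
Proof.
move=> uA uQ e; have : Q *m U \in unitmx by rewrite -e unitmx_mul uA.
by rewrite unitmx_mul uQ.
Qed.

Definition torus_mx (F : fieldType) (g a b : F) : 'M[F]_2 :=
  mx_of_rows 2 [:: [:: a; b * g]; [:: b; a]].

(* A0^2 = h^2 g gives A0 the matrix h [0 g; 1 0] in the basis e1, A0 e1 / h, and the
   torus is the centralizer of [0 g; 1 0]. *)
Lemma simultaneously_in_torus (F : fieldType) (S : {rmorphism F -> F} -> Prop)
    (MM : set 'M[F]_2) (A0 : 'M[F]_2) (h g : F) : 2 \in [pchar F] ->
    (forall A, MM A -> A \in unitmx) ->
    (forall A s, MM A -> S s -> map_mx s A = A) ->
    (forall A, MM A -> exists l : F, A0 *m A = l *: (A *m A0)) ->
    MM A0 -> h != 0 -> (forall s, S s -> s h = h) ->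
    A0 ^+ 2 = (h ^+ 2 * g)%:M -> (forall d, h ^+ 2 * g != d ^+ 2) ->
  exists Q, [/\ Q \in unitmx, (forall s, S s -> map_mx s Q = Q) &
    forall A, MM A -> exists a b, A *m Q = Q *m torus_mx g a b].
Proof.
move=> p2 uM sM cM MA0 h0 sh A0sq nsq.
have e00 := congr1 (fun M : 'M_2 => M 0 0) A0sq.
have e10 := congr1 (fun M : 'M_2 => M 1 0) A0sq.
rewrite /= expr2 -mulmxE !mul2E !mxE /= mulr1n mulr0n in e00 e10.
have ga : A0 1 0 != 0.
  apply/eqP => ga; have := nsq (A0 0 0).
  by rewrite -e00 ga mulr0 addr0 expr2 eqxx.
have de : A0 1 1 = A0 0 0.
  have /eqP : A0 1 0 * (A0 0 0 + A0 1 1) = 0 by rewrite -[RHS]e10; ring.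
  by rewrite mulf_eq0 (negPf ga) /= addr_eq0 oppr_pchar2 // => /eqP.
pose Q : 'M[F]_2 := mx_of_rows 2 [:: [:: 1; A0 0 0 / h]; [:: 0; A0 1 0 / h]].
have uQ : Q \in unitmx.
  by rewrite mx2_unitE !mxE /= mul1r mulr0 subr0 mulf_neq0 ?invr_eq0.
exists Q; split=> //.
- move=> s Ss; have sA i j : s (A0 i j) = A0 i j.
    by have /matrixP /(_ i j) := sM _ _ MA0 Ss; rewrite mxE.
  by apply: mx2P; rewrite !mxE /= ?(fmorph_div s) ?sA ?(sh s Ss) ?rmorph1 ?rmorph0.
pose W : 'M[F]_2 := mx_of_rows 2 [:: [:: 0; h * g]; [:: h; 0]].
have eW : A0 *m Q = Q *m W.
  apply: mx2P; rewrite !mul2E !mxE /= ?de.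
  - by field.
  - transitivity ((A0 0 0 * A0 0 0 + A0 0 1 * A0 1 0) / h); first by field.
    by rewrite e00; field.
  - by field.
  - transitivity (A0 1 0 * A0 0 0 / h + A0 1 0 * A0 0 0 / h); first by field.
    by rewrite addrr_pchar2 //; ring.
move=> A MA; have [l el] := cM A MA.
have uA := uM A MA.
have A0u := uM _ MA0.
have l1 : l = 1.
  have : A0 *m (A0 *m A) = l ^+ 2 *: (A *m (A0 *m A0)).
    by rewrite el -scalemxAr [A0 *m (A *m A0)]mulmxA el -scalemxAl scalerA -!mulmxA.
  rewrite mulmxA; have -> : A0 *m A0 = (h ^+ 2 * g)%:M by rewrite -A0sq expr2.
  rewrite scalar_mxC => e.
  have u : (h ^+ 2 * g)%:M *m A \in unitmx.
    by rewrite unitmx_mul uA andbT -A0sq unitmx_unit unitrX.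
  have : (l ^+ 2)%:M = 1%:M :> 'M[F]_2.
    by apply: (can_inj (mulmxK u)); rewrite mul1mx [LHS]mul_scalar_mx -e.
  move=> /matrixP /(_ 0 0); rewrite !mxE /= => l2.
  by apply: (pchar_expI p2); rewrite expr1n -[LHS]mulr1n l2.
pose U := invmx Q *m (A *m Q); have eU : A *m Q = Q *m U by rewrite mulKVmx.
clearbody U; have eWU : W *m U = U *m W.
  apply: (can_inj (mulKmx uQ)); rewrite !mulmxA -eW -eU -!mulmxA -eU -eW !mulmxA.
  by rewrite el l1 scale1r.
exists (U 0 0), (U 1 0); rewrite eU; congr (_ *m _).
have c00 := congr1 (fun M : 'M_2 => M 0 0) eWU.
have c10 := congr1 (fun M : 'M_2 => M 1 0) eWU.
rewrite /= !mul2E !mxE /= !(mul0r, mulr0, add0r, addr0) in c00 c10.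
apply: mx2P; rewrite !mxE //=; apply: (mulfI h0).
- by rewrite mulrC -c00; ring.
- by rewrite [RHS]c10 mulrC -?c10.
Qed.

(** Taking determinants, the p-th power of the determinant is c^2; as p is odd, dividing [c] by the
    power (p - 1)/2 of the determinant gives a p-th root of [c]. *)
Lemma pth_power_of_det (F : fieldType) (p : nat) (A : 'M[F]_2) (c : F) : odd p ->
  A \in unitmx -> A ^+ p = c%:M -> exists d, c = d ^+ p.
Proof.
move=> op uA e; have c2 : \det A ^+ p = c ^+ 2.
  have -> : \det A ^+ p = \det (A ^+ p).
    by elim: (p) => [|n IH]; rewrite ?expr0 ?det1 // !exprS -mulmxE det_mulmx IH.
  by rewrite e det_scalar.
have dA : \det A != 0 by move: uA; rewrite unitmxE unitfE.
have c0 : c != 0.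
  apply/eqP => c0; move: c2; rewrite c0 expr0n => /eqP.
  by rewrite expf_eq0 (negPf dA) andbF.
exists (c / \det A ^+ p./2); rewrite expr_div_n -exprM mulnC exprM c2 -exprM mul2n.
rewrite -{1}[p]odd_double_half op exprD expr1 mulfK //.
by rewrite expf_neq0.
Qed.

Lemma scalar_pow_fixed (F : fieldType) (s : {rmorphism F -> F}) n (A : 'M[F]_2) (c : F) :
  A ^+ n = c%:M -> map_mx s A = A -> s c = c.
Proof.
move=> e sA; have : map_mx s (A ^+ n) = A ^+ n.
  elim: (n) => [|m IH]; first exact: map_mx1.
  by rewrite exprS -mulmxE map_mxM sA IH.
by rewrite e map_scalar_mx => /matrixP /(_ 0 0); rewrite !mxE.
Qed.

(** * Normal form of the fibre matrices *)

Section NormalForm.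
Variables (k : closedFieldType) (p : nat).
Hypothesis hp : p \in [pchar k].
Local Notation kx := {fraction {poly k}}.

Let hpx : p \in [pchar kx].
Proof. by rewrite (fmorph_pchar (@kx_cst k)). Qed.

Lemma normal_form rs (MM : set 'M[kx]_2) : addgroup rs ->
    (forall A, MM A -> A \in unitmx) ->
    (forall A r, MM A -> r \in rs -> map_mx (shift r) A = A) ->
    (forall A B, MM A -> MM B -> exists l : kx, A *m B = l *: (B *m A)) ->
    (forall A, MM A -> exists c : kx, A ^+ p = c%:M) ->
  exists Q, [/\ Q \in unitmx, (forall r, r \in rs -> map_mx (shift r) Q = Q) &
    (forall A, MM A -> exists a b, a != 0 /\ A *m Q = Q *m (a *: tr_mx b)) \/
    (p = 2%N /\ exists g : {poly k},
       [/\ g \is monic, (forall a, root g a -> mup a g = 1%N) &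
           forall A, MM A -> exists a b, A *m Q = Q *m torus_mx (tofrac g) a b])].
Proof.
move=> ag uM sM cM pM.
pose S (s : {rmorphism kx -> kx}) := exists2 r, r \in rs & s = shift r.
have sM' A s : MM A -> S s -> map_mx s A = A by move=> MA [r rin ->]; apply: sM.
have Sr r : r \in rs -> S (shift r) by exists r.
have [[A0 [MA0 nA0]]|all_scalar] :=
    pselect (exists A0, MM A0 /\ forall d : kx, A0 != d%:M); last first.
  exists 1%:M; split; [exact: unitmx1|by move=> r _; rewrite map_mx1|left=> A MA].
  have [d eA] : exists d : kx, A = d%:M.
    apply: contrapT => nA; apply: all_scalar; exists A; split=> // d.
    by apply/eqP => eA; apply: nA; exists d.
  exists d, 0; split.
    by apply/eqP => d0; have := uM _ MA; rewrite eA d0 unitmxE det_scalar expr0n unitr0.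
  by rewrite eA mulmx1 mul1mx tr_mx0 scalemx1.
have cM0 A : MM A -> exists l : kx, A0 *m A = l *: (A *m A0) by move=> MA; apply: cM.
have [c ec] := pM _ MA0.
have [[d ed]|nsq] := pselect (exists d, c = d ^+ p).
  have e0 : A0 ^+ p = (d ^+ p)%:M by rewrite ec ed.
  have [Q [uQ sQ QP]] := simultaneously_unipotent hpx uM sM' cM0 pM MA0 e0 (nA0 d).
  by exists Q; split=> //; [move=> r /Sr; exact: sQ|left].
(* For odd [p] the scalar is a p-th power by [pth_power_of_det], so only [p = 2] remains. *)
have [p2|op] := even_prime (pcharf_prime hp); last first.
  by case: nsq; exact (pth_power_of_det op (uM _ MA0) ec).
have c0 : c != 0.
  apply/eqP => c0; apply: nsq; exists 0; rewrite c0 p2; exact (esym (expr0n kx 2)).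
have cinv r : r \in rs -> shift r c = c.
  move=> rin; exact (scalar_pow_fixed ec (sM _ _ MA0 rin)).
have [h [g [h0 hinv gm gs eg]]] := squarefree_part ag c0 cinv.
have hp2 : 2 \in [pchar kx] := eq_ind p (fun q => q \in [pchar kx]) hpx 2 p2.
have sh s : S s -> s h = h by move=> [r rin ->]; apply: hinv.
have e0 : A0 ^+ 2 = (h ^+ 2 * tofrac g)%:M by rewrite -eg -ec p2.
have nsq' d : h ^+ 2 * tofrac g != d ^+ 2.
  by rewrite -eg; apply/eqP => e; apply: nsq; exists d; rewrite p2.
have [Q [uQ sQ QP]] := simultaneously_in_torus hp2 uM sM' cM0 MA0 h0 sh e0 nsq'.
exists Q; split=> //; first by move=> r /Sr; exact: sQ.
by right; split=> //; exists g.
Qed.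

End NormalForm.

Lemma scaled_tr_fixed (F : fieldType) (s : {rmorphism F -> F}) (a b : F) : a != 0 ->
  map_mx s (a *: tr_mx b) = a *: tr_mx b -> s b = b.
Proof.
move=> a0 /matrixP e; have := e 0 1; have := e 0 0.
by rewrite !mxE /= !mulr1 => ea; rewrite rmorphM /= ea => /(mulfI a0).
Qed.

Lemma torus_mx_unit (F : fieldType) (g a b : F) : 2 \in [pchar F] ->
  torus_mx g a b \in unitmx -> a ^+ 2 + b ^+ 2 * g != 0.
Proof.
move=> p2; rewrite mx2_unitE !mxE /= => h; apply: contraNneq h => e.
by rewrite -[X in _ == X]e -[X in _ + X](oppr_pchar2 p2); apply/eqP; ring.
Qed.

Section BaseTranslations.
Variable k : closedFieldType.
Local Notation kx := {fraction {poly k}}.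
Variable rs : seq k.

Definition base_translations : set (PGL 2 k) := translations [set r | r \in rs].

Lemma base_translations_subgroup : addgroup rs -> subgroup base_translations.
Proof.
move=> ag; have [_ r0 _] := ag; split.
- by exists 0 => //; rewrite -/(tr_mx _) tr_mx0 pgl1.
- move=> _ _ [r rin <-] [s sin <-]; exists (r + s); first exact: addgroupD.
  by rewrite -!/(tr_mx _) pglM ?tr_mx_unit // tr_mxD.
- move=> _ [r rin <-]; exists (- r); first exact: addgroupN.
  by rewrite -!/(tr_mx _) pglV ?tr_mx_unit // tr_mxV.
Qed.

(** [kx_invariants] uses chosen representatives, which are known only up to a scalar; Möbius
    transformations ignore it. *)
Lemma base_translations_invariants (f : kx) :
  (forall r, r \in rs -> shift r f = f) -> kx_invariants base_translations f.
Proof.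
move=> inv _ [r rin <-]; rewrite -/(tr_mx r).
have [c c0 ->] := pgl_repr (tr_mx_unit r).
rewrite -[RHS](inv r rin) shiftE /mobius_kx.
by rewrite (mobiusZ (@kx_cst k) (tr_mx r) (kx_x k) c0).
Qed.

End BaseTranslations.

Section ElementarySubgroups.
Variables (k : closedFieldType) (p : nat).
Hypothesis hp : p \in [pchar k].
Local Notation kx := {fraction {poly k}}.

Lemma dJt_splitM rs N (H : set (Cr k)) (A : 'M[kx]_2) t : finite_elementary p N H ->
    addgroup rs -> (forall r, r \in rs -> H (dJt 1%:M r)) -> t \in rs ->
    A \in unitmx -> H (dJt A t) -> H (dJt A 0).
Proof.
move=> [[_ HM _] _ _ _] ag Hrs tin uA HA.
have := HM _ _ (Hrs (- t) (addgroupN ag tin)) HA.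
have e := dJtM (- t) t (unitmx1 _ _) uA.
by rewrite e map_mx1 mul1mx addNr.
Qed.

(** Conjugation by the invariant matrix [Q] fixes the translations and puts the fibre parts in
    normal form; invariance of the fibre matrices passes to their normal forms, which places their
    entries in the invariant field. *)
Lemma split_normal_form N rs (H : set (Cr k)) : finite_elementary p N H ->
    addgroup rs -> (forall r, r \in rs -> H (dJt 1%:M r)) ->
    (forall u, H u -> exists A t, [/\ A \in unitmx, t \in rs & u = dJt A t]) ->
  exists2 Q : 'M[kx]_2, Q \in unitmx &
    [/\ forall r, r \in rs -> [set u ^ dJt Q 0 | u in H]%g (dJt 1%:M r),
      forall u, [set u ^ dJt Q 0 | u in H]%g u ->
        exists A t, [/\ A \in unitmx, t \in rs, u = dJt A t &
          [set u ^ dJt Q 0 | u in H]%g (dJt A 0)] &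
      (forall A, A \in unitmx -> [set u ^ dJt Q 0 | u in H]%g (dJt A 0) ->
        exists b, pgl A = pgl (tr_mx b) /\ kx_invariants (base_translations rs) b) \/
      (p = 2%N /\ exists g : {poly k},
       [/\ g \is monic, (forall a, root g a -> mup a g = 1%N) &
           forall A, A \in unitmx -> [set u ^ dJt Q 0 | u in H]%g (dJt A 0) ->
             twisted_torus g (base_translations rs) (pgl A)])].
Proof.
move=> fH ag Hrs HA; have [[H1 HM HV] cH pH _] := fH.
pose MM : set 'M[kx]_2 := [set A | [/\ A \in unitmx, H (dJt A 0) &
  forall r, r \in rs -> map_mx (shift r) A = A]].
have uM A : MM A -> A \in unitmx by case.
have sM A r : MM A -> r \in rs -> map_mx (shift r) A = A by move=> [_ _ h]; apply: h.
have cM A B : MM A -> MM B -> exists l : kx, A *m B = l *: (B *m A).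
  move=> [uA hA _] [uB hB _]; have e := cH _ _ hA hB.
  have eAB := dJtM 0 0 uA uB; rewrite map_shift0 in eAB.
  have eBA := dJtM 0 0 uB uA; rewrite map_shift0 in eBA.
  have uAB := mulmx_unit uA uB.
  have uBA := mulmx_unit uB uA.
  have [e1 _] := dJt_inj uAB uBA (etrans (esym eAB) (etrans e eBA)).
  by have [l _ el] := proj1 (pgl_eq uAB uBA) e1; exists l.
have pM A : MM A -> exists c : kx, A ^+ p = c%:M.
  move=> [uA hA _]; have e := dJt_pow 0 p uA.
  have eA n : twisted_pow (shift 0) A n = A ^+ n.
    by elim: n => [|n IH] //=; rewrite IH map_shift0 exprSr.
  rewrite eA mul0rn in e.
  have uAp : A ^+ p \in unitmx by rewrite unitmx_unit; exact: unitrX.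
  have [e1 _] := dJt_inj (unitmx1 _ _) uAp (etrans (dJt1 k) (etrans (esym (pH _ hA)) e)).
  have [l l0 el] := proj1 (pgl_eq (unitmx1 _ _) uAp) e1; exists l^-1.
  rewrite -[LHS]scale1r -(mulVf l0) -scalerA -el; exact: scalemx1.
have [Q [uQ sQ nf]] := normal_form hp ag uM sM cM pM.
exists Q => //; set H' := [set u ^ dJt Q 0 | u in H]%g.
have trQ r : r \in rs -> (dJt 1%:M r ^ dJt Q 0 = dJt 1%:M r)%g.
  move=> rin; apply: conjg_eq.
  refine (etrans (dJtM r 0 (unitmx1 _ _) uQ) (etrans _ (esym (dJtM 0 r uQ (unitmx1 _ _))))).
  refine (f_equal2 (@dJt k) _ (etrans (addr0 r) (esym (add0r r)))).
  by rewrite map_mx1 mul1mx mulmx1 sQ.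
have splitE (A : 'M[kx]_2) t : A \in unitmx -> (dJt 1%:M t * dJt A 0 = dJt A t)%g.
  by move=> uA; have e := dJtM t 0 (unitmx1 _ _) uA; rewrite e map_mx1 mul1mx addr0.
have cjE (A U : 'M[kx]_2) : A \in unitmx -> U \in unitmx -> A *m Q = Q *m U ->
    (dJt A 0 ^ dJt Q 0 = dJt U 0)%g.
  move=> uA uU e; apply: conjg_eq.
  refine (etrans (dJtM 0 0 uA uQ) (etrans _ (esym (dJtM 0 0 uQ uU)))).
  by rewrite !map_shift0 e.
have normalized u : H u -> exists A t, [/\ MM A, t \in rs & u = dJt A t].
  move=> Hu; have [A0 [t [uA0 tin eu]]] := HA u Hu.
  have [c0 [c00 nA]] := normalize_mx uA0; have uA := scale_unit c00 uA0.
  have euA : u = dJt (c0 *: A0) t by rewrite eu; exact (esym (dJtZ t c00 uA0)).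
  move: (c0 *: A0) uA euA nA => A uA euA nA.
  have hA0 : H (dJt A 0) by apply: (dJt_splitM fH ag Hrs tin uA); rewrite -euA.
  exists A, t; split=> //; split=> // r rin.
  have e := cH _ _ (Hrs r rin) hA0.
  have ur := map_shift_unit r uA.
  have e1 := splitE A r uA.
  have e2 := dJtM 0 r uA (unitmx1 _ _); rewrite mulmx1 in e2.
  have [eA _] := dJt_inj uA ur (etrans (esym e1) (etrans e e2)).
  by have [l _ el] := proj1 (pgl_eq uA ur) eA; apply: nA el.
have imE u : H' u -> exists A U t, [/\ MM A, U \in unitmx, A *m Q = Q *m U, t \in rs & u = dJt U t].
  move=> [v /normalized[A [t [MA tin ->]]] <-]; have uA := uM _ MA.
  pose U := invmx Q *m (A *m Q); have eU : A *m Q = Q *m U by rewrite mulKVmx.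
  clearbody U; have uU := conj_mx_unit uA uQ eU.
  exists A, U, t; split=> //.
  by rewrite -(splitE A t uA) conjMg trQ // (cjE A U uA uU eU) splitE.
split.
- by move=> r rin; exists (dJt 1%:M r); [exact: Hrs|exact: trQ].
- move=> u /imE[A [U [t [[uA hA _] uU eU tin ->]]]]; exists U, t; split=> //.
  by exists (dJt A 0); [exact hA|exact (cjE A U uA uU eU)].
have im0 B : B \in unitmx -> H' (dJt B 0) ->
    exists A U, [/\ MM A, U \in unitmx, A *m Q = Q *m U & pgl B = pgl U].
  move=> uB /imE[A [U [t [MA uU eU tin eB]]]].
  by exists A, U; exact (And4 MA uU eU (proj1 (dJt_inj uB uU eB))).
have invU A (U : 'M[kx]_2) r : MM A -> A *m Q = Q *m U -> r \in rs -> map_mx (shift r) U = U.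
  by move=> MA eU rin; apply: intertwiner_fixed uQ eU (sM _ _ MA rin) (sQ r rin).
case: nf => [unip|[p2 [g [gm gs tor]]]]; [left|right; split=> //; exists g; split=> //].
- move=> B uB hB; have [A [U [MA uU eU ->]]] := im0 B uB hB.
  have [a [b [a0 eab]]] := unip A MA.
  have eU' : U = a *: tr_mx b by apply: (can_inj (mulKmx uQ)); rewrite -eU.
  exists b; split; first by rewrite eU'; exact (pglZ a0 (tr_mx_unit b)).
  apply: base_translations_invariants => r rin; have := invU A U r MA eU rin.
  rewrite eU'; exact (scaled_tr_fixed a0).
- move=> B uB hB; have [A [U [MA uU eU ->]]] := im0 B uB hB.
  have [a [b eab]] := tor A MA.
  have eU' : U = torus_mx (tofrac g) a b by apply: (can_inj (mulKmx uQ)); rewrite -eU.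
  have iU r i j : r \in rs -> shift r (U i j) = U i j.
    by move=> rin; have /matrixP /(_ i j) := invU A U r MA eU rin; rewrite mxE.
  have ea : U 0 0 = a by rewrite eU' mxE.
  have eb : U 1 0 = b by rewrite eU' mxE.
  have det0 : a ^+ 2 + b ^+ 2 * tofrac g != 0.
    have hp2 : 2 \in [pchar k] := eq_ind p (fun q => q \in [pchar k]) hp 2 p2.
    have hx2 : 2 \in [pchar kx] by rewrite (fmorph_pchar (@kx_cst k)).
    by apply: (torus_mx_unit hx2); rewrite -eU'.
  exists a, b; split; [| |exact det0|by rewrite eU'].
  + by apply: base_translations_invariants => r rin; rewrite -ea; exact: iU.
  + by apply: base_translations_invariants => r rin; rewrite -eb; exact: iU.
Qed.

Lemma elementary_normal_form (G : set (Cr k)) : G `<=` deJonquieres k -> elementary p G ->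
  exists (L : set (PGL 2 kx)) (R : set (PGL 2 k)),
    [/\ conjugate_in (deJonquieres k) G (prod_LR L R),
        subgroup R,
        R `<=` translations [set: k],
        subgroup L &
        L `<=` translations (kx_invariants R) \/
        (p = 2%N /\
         exists g : {poly k},
           [/\ g \is monic, (forall a, root g a -> mup a g = 1%N) &
               L `<=` twisted_torus g R])].
Proof.
move=> GJ /(elementary_finite (pcharf_prime hp))[N fG].
have [h1 Jh1 all1] := translations_on_base hp fG GJ.
have fG1 := finite_elementary_conj h1 fG.
have [h2 [rs [Jh2 ag Hrs all2]]] := translations_split hp fG1 all1.
have fG2 := finite_elementary_conj h2 fG1.
have [Q uQ] := split_normal_form fG2 ag Hrs all2.
set H2 := [set u ^ h2 | u in [set u ^ h1 | u in G]]%g in fG2 *.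
have fH := finite_elementary_conj (dJt Q 0) fG2.
set H := [set u ^ dJt Q 0 | u in H2]%g in fH *.
move=> [Htr Hsp Hnf]; have [[H1 HM HV] _ _ _] := fH.
have lK (l : PGL 2 kx) : exists2 A, A \in unitmx & l = pgl A := pglP l.
have dJ0 (A : 'M[kx]_2) : dJ (pgl A) 1%g = dJt A 0 by rewrite /dJt tr_mx0 pgl1.
have HdJ A : H (dJ (pgl A) 1%g) <-> H (dJt A 0) by rewrite dJ0.
(* [L] collects the fibre parts of the elements acting trivially on the base. *)
exists [set l | H (dJ l 1%g)], (base_translations rs); split.
- have JJ := deJonquieres_subgroup k.
  apply: (conj_in_trans JJ (K := [set u ^ h1 | u in G]%g)); first by exists h1.
  apply: (conj_in_trans JJ (K := H2)); first by exists h2.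
  exists (dJt Q 0); first exact: dJt_deJonquieres.
  rewrite -/H eqEsubset; split=> u.
  + move=> /Hsp[A [t [uA tin -> hA]]]; exists (pgl A).
      by rewrite /= dJ0.
    by exists (pgl (tr_mx t)) => //; exists t.
  + move=> [l hl [_ [t tin <-] <-]]; have [A uA eA] := lK l.
    have e : (dJt 1%:M t * dJt A 0 = dJ l (pgl (tr_mx t)))%g.
      have e := dJtM t 0 (unitmx1 _ _) uA; rewrite e map_mx1 mul1mx addr0.
      by rewrite eA.
    rewrite -/(tr_mx t) -e; apply: HM; first exact: Htr.
    by move: hl; rewrite /= eA dJ0.
- exact: base_translations_subgroup.
- by move=> _ [t _ <-]; exists t.
- split=> /=.
  + by have := H1; rewrite -(dJt1 k) -dJ0 pgl1.
  + move=> l l'; have [A uA ->] := lK l; have [A' uA' ->] := lK l'.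
    move=> /HdJ hA /HdJ hA'; refine (eq_ind_r (fun l => H (dJ l 1%g)) _ (pglM uA uA')).
    apply/HdJ; have := HM _ _ hA hA'; have e := dJtM 0 0 uA uA'.
    by rewrite e map_shift0 addr0.
  + move=> l; have [A uA ->] := lK l => /HdJ hA.
    refine (eq_ind_r (fun l => H (dJ l 1%g)) _ (pglV uA)); apply/HdJ.
    by have := HV _ hA; rewrite (dJtV uA).
- case: Hnf => [tr|[p2 [g [gm gs tor]]]]; [left|right; split=> //; exists g; split=> //].
  + move=> l /=; have [A uA ->] := lK l; rewrite dJ0 => hA.
    by have [b [e bi]] := tr A uA hA; exact (ex_intro2 _ _ b bi (esym e)).
  + move=> l /=; have [A uA ->] := lK l; rewrite dJ0 => hA; exact: tor.
Qed.

End ElementarySubgroups.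

Theorem theorem3 (k : closedFieldType) (p : nat) (hp : p \in [pchar k]) :
  (forall G : set (Cr k), G `<=` deJonquieres k -> elementary p G ->
     exists (L : set (PGL 2 {fraction {poly k}})) (R : set (PGL 2 k)),
       [/\ conjugate_in (deJonquieres k) G (prod_LR L R),
           subgroup R,
           R `<=` translations [set: k],
           subgroup L &
           L `<=` translations (kx_invariants R) \/
           (p = 2%N /\
            exists g : {poly k},
              [/\ g \is monic, (forall a, root g a -> mup a g = 1%N) &
                  L `<=` twisted_torus g R])]) /\
  (p = 2%N ->
     [/\ (forall H : set (PGL 3 k), klein H ->
            [\/ conjugate H (kleinG1 k), conjugate H (kleinG2 k) |
                exists t : k, [/\ t != 0, t != 1 & conjugate H (kleinG3 t)]]),
         ~ conjugate (kleinG1 k) (kleinG2 k),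
         ~ birationally_conjugate (kleinG1 k) (kleinG2 k),
         (forall t : k, t != 0 -> t != 1 ->
            [/\ ~ conjugate (kleinG1 k) (kleinG3 t),
                ~ conjugate (kleinG2 k) (kleinG3 t) &
                birationally_conjugate (kleinG1 k) (kleinG3 t)]) &
         (forall t t' : k, t != 0 -> t != 1 -> t' != 0 -> t' != 1 ->
            conjugate (kleinG3 t) (kleinG3 t') <->
            t' \in [:: t; t + 1; t^-1; (t + 1) / t; (t + 1)^-1; t / (t + 1)])]).
Proof.
split; first exact: elementary_normal_form.
move=> p2; rewrite p2 in hp; split.
- exact: klein_classification.
- by move/birational_of_conjugate; exact: G1_G2_not_birationally_conjugate.
- exact: G1_G2_not_birationally_conjugate.
- move=> t t0 t1; split.
  + exact: G1_G3_not_conjugate.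
  (* A conjugation between the second and third types would, through the birational one between the
     first and third, make the first two birationally conjugate. *)
  + move/birational_of_conjugate/conjugate_sym => h.
    apply: (G1_G2_not_birationally_conjugate hp); apply: conjugate_trans h.
    exact: G1_G3_birationally_conjugate.
  + exact: G1_G3_birationally_conjugate.
- by move=> t t' t0 t1 t0' t1'; exact: G3_conjugate.
Qed.
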